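(* Let $m\in\mathbb{N}$ and let $F(\mathbf{x})=\sum f(\mathbf{n})\mathbf{x}^{\mathbf{n}}\in\bar{\mathbb{Q}}[[x_1,\ldots,x_m]]$ be the power series representation of a rational function. For $N\in\mathbb{N}_0$ put $h_N=\max\{h(f(\mathbf{n})):\ \Vert\mathbf{n}\Vert\le N\}$. If $h_N=o(N)$, then, up to scalar multiplication, every irreducible factor of the denominator of $F$ has the form $1-\zeta\mathbf{x}^{\mathbf{n}}$ where $\zeta$ is a root of unity and $\mathbf{n}\in\mathbb{N}_0^m\setminus\{0\}$.
   Context: $\mathbb{N}_0$ is the set of nonnegative integers; for $\mathbf{n}\in\mathbb{N}_0^m$, $\mathbf{x}^{\mathbf{n}}=x_1^{n_1}\cdots x_m^{n_m}$ and $\Vert\mathbf{n}\Vert=n_1+\cdots+n_m$. $h$ is the absolute logarithmic Weil height on $\bar{\mathbb{Q}}$. *)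

(* Defs.v *)
From HB Require Import structures.
From mathcomp Require Import all_boot all_order all_algebra.
From mathcomp Require Import mpoly.
From mathcomp Require Import complex.
From mathcomp Require Import Rstruct.
From Stdlib Require Reals ClassicalEpsilon.
Set Implicit Arguments. Unset Strict Implicit. Unset Printing Implicit Defensive.
Import Order.TTheory GRing.Theory Num.Theory.
Local Open Scope ring_scope.

Notation Rr := Rdefinitions.R.
Notation Cc := (Rdefinitions.R)[i].

Definition cabs (z : Cc) : Rr := ComplexField.Normc.normc z.

Definition algebraic (z : Cc) : Prop :=
  exists p : {poly rat}, p != 0 /\ root (map_poly ratr p) z.

(* Absolute logarithmic Weil height, via the Mahler measure of the minimal
   polynomial:  h(z) = (1/d) log( a_d * prod_i max(1,|z_i|) ),
   where q = prod_i (X - z_i) is the monic minimal polynomial of z over Q,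
   d = deg q, and a_d = the least positive integer D with D*q in Z[X]
   (so that D*q is the primitive irreducible integer minimal polynomial). *)
Definition weil_height_spec (z : Cc) (h : Rr) : Prop :=
  exists (q : {poly rat}) (rs : seq Cc) (D : nat),
    [/\ q \is monic /\ root (map_poly ratr q) z,
        (forall p : {poly rat}, p != 0 -> root (map_poly ratr p) z ->
           (size q <= size p)%N),
        map_poly ratr q = \prod_(a <- rs) ('X - a%:P),
        ((0 < D)%N /\ (forall i, q`_i *+ D \is a Num.int)) /\
        (forall D' : nat, (0 < D')%N -> (forall i, q`_i *+ D' \is a Num.int) ->
           (D <= D')%N) &
        h = Rpower.ln (D%:R * \prod_(a <- rs) Num.max 1 (cabs a))
            / (size q).-1%:R ].

Definition weil_height (z : Cc) : Rr :=
  ClassicalEpsilon.epsilon (inhabits 0) (weil_height_spec z).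

Definition height_max (m : nat) (f : 'X_{1..m} -> Cc) (N : nat) : Rr :=
  \big[Num.max/0]_(n : 'X_{1..m < N.+1}) weil_height (f n).

Definition series_mul (m : nat) (Q : {mpoly Cc[m]}) (f : 'X_{1..m} -> Cc)
  (n : 'X_{1..m}) : Cc :=
  \sum_(u <- msupp Q | (u <= n)%MM) Q@_u * f (n - u)%MM.

Definition qbar_poly (m : nat) (p : {mpoly Cc[m]}) : Prop :=
  forall u, algebraic p@_u.

Definition is_const (m : nat) (p : {mpoly Cc[m]}) : Prop := p = (p@_0)%:MP.

Definition qbar_dvd (m : nat) (D Q : {mpoly Cc[m]}) : Prop :=
  exists E, qbar_poly E /\ Q = D * E.

Definition qbar_coprime (m : nat) (P Q : {mpoly Cc[m]}) : Prop :=
  forall D, qbar_poly D -> qbar_dvd D P -> qbar_dvd D Q -> is_const D.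

Definition qbar_irreducible (m : nat) (D : {mpoly Cc[m]}) : Prop :=
  [/\ qbar_poly D, ~ is_const D &
      forall A B, qbar_poly A -> qbar_poly B -> D = A * B ->
        is_const A \/ is_const B].

Definition rational_series (m : nat) (f : 'X_{1..m} -> Cc) : Prop :=
  exists P Q : {mpoly Cc[m]}, [/\ qbar_poly P, qbar_poly Q, Q != 0 &
     forall n, series_mul Q f n = P@_n].

(* Main.v *)
(**
The coefficients of [f] lie in a number field, so multiplying [Q] by its conjugates gives a
rational polynomial [G] with [G(0) = 1].  Substituting [x_i := x_i t], Bezout over [k(x)[t]]
replaces [f] by a series [V] with [G V] independent of [t] and nonzero; since the heights are
[o(N)], [V] grows subexponentially at every place.  At the finite places this forces [G] to have
integral coefficients (a Gauss-norm argument in the style of Fatou's lemma).  At the infinite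
place it forces the roots in [t] of [G(c t)] to have modulus at least one whenever all
[|c_i| <= 1], so the power sums of their inverses are bounded by the degree.  These power sums
are the values of the coefficients [p_k] of the logarithmic derivative [- t G' / G], whose
coefficients are therefore bounded integers.

Comparing with the partial logarithmic derivatives, [|u|] divides [p_u u_j] for all [u] and [j];
so the exponents occurring in the [p_k] lie on finitely many rays.  On a ray, [p] satisfies a
linear recurrence and takes finitely many values, hence is eventually periodic.  Consequently
[G] divides [\prod (1 - x^w) E(G)] for finitely many [w != 0], where [E] is the Euler derivation.
A prime [D] with [D(0) != 0] does not divide [E(D)], so a prime factor of [G] divides some
[1 - x^w].  The derivations annihilating [x^w] show that such a prime is a polynomial in a single
monomial, and the claim follows by factoring it in one variable.
*)

Require Import Defs.
From HB Require Import structures.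
From mathcomp Require Import all_boot all_order all_algebra.
From mathcomp Require Import ssrcomplements mpoly.
From mathcomp Require Import complex.
From mathcomp Require Import Rstruct.
From mathcomp Require Import cyclic separable cyclotomic.
From mathcomp Require Import ring lra zify.
From Stdlib Require Import Classical ClassicalEpsilon.
Set Implicit Arguments. Unset Strict Implicit. Unset Printing Implicit Defensive.
Import Order.TTheory GRing.Theory Num.Theory.
Local Open Scope ring_scope.

(** * Prime factorisation in polynomial rings *)

(** Coprimality of [P] and [Q] does not survive specialisation: at a point [c] a zero of [Q(c t)]
    may be cancelled by [P(c t)], and then the growth of [f] says nothing about it. In the Bezout
    relation the right-hand side [r] is free of [t], so wherever [r(c)] is nonzero every zero of
    [Q(c t)] is a pole of the new series. The points with [r(c) = 0] are avoided by moving the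
    radius of the circle from which coefficients are recovered, at the price of a factor 2.

    The height enters through one quantity only: degree times height is the logarithm of a leading
    coefficient times the product of the large conjugates, which bounds the denominator and all
    conjugates of [f(n)] at once. Hence every conjugate series obeys the same growth bounds, and so
    does their product; rational coefficients are needed to reach integers, for which boundedness
    leaves finitely many values.

    That [Q(0)] is nonzero is not assumed: it follows from a Bezout relation of the same kind,
    written after removal of the lowest power of [t]. *)

Lemma ex_first (P : nat -> Prop) (i : nat) :
  ~ P i -> exists2 j, ~ P j & forall k, (k < j)%N -> P k.
Proof.
elim/ltn_ind: i => i IH nPi.
case: (classic (exists2 k, (k < i)%N & ~ P k)) => [[k lki nPk]|H].
  exact: IH lki nPk.
exists i => // k lki; apply: NNPP => nPk; apply: H; by exists k.
Qed.

Definition cv (A : pzRingType) (a b : nat -> A) (k : nat) : A :=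
  \sum_(i < k.+1) a i * b (k - i)%N.

Section Divisibility.
Variable R : idomainType.
Implicit Types a b c p q : R.

(** Exact divisibility; over a domain [dvdp] on polynomials only means divisibility up to a nonzero
    scalar. *)
Definition dvdr a b : Prop := exists c, b = c * a.

Lemma dvdr_refl a : dvdr a a. Proof. by exists 1; rewrite mul1r. Qed.

Lemma dvdr0 a : dvdr a 0. Proof. by exists 0; rewrite mul0r. Qed.

Lemma dvdr_mull a b c : dvdr a c -> dvdr a (b * c).
Proof. by case=> d ->; exists (b * d); rewrite mulrA. Qed.

Lemma dvdr_mulr a b c : dvdr a b -> dvdr a (b * c).
Proof. by rewrite mulrC; apply: dvdr_mull. Qed.

Lemma dvdrD a b c : dvdr a b -> dvdr a c -> dvdr a (b + c).
Proof. by case=> d -> [e ->]; exists (d + e); rewrite mulrDl. Qed.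

Lemma dvdrN a b : dvdr a b -> dvdr a (- b).
Proof. by case=> d ->; exists (- d); rewrite mulNr. Qed.

Lemma dvdr_addl a b c : dvdr a b -> dvdr a (c + b) -> dvdr a c.
Proof. by move=> ab acb; rewrite -(addrK b c); apply/dvdrD/dvdrN. Qed.

Lemma dvdr_trans a b c : dvdr a b -> dvdr b c -> dvdr a c.
Proof. by move=> ab [d ->]; apply: dvdr_mull. Qed.

Lemma dvdr_sum a (I : Type) (r : seq I) (P : pred I) (F : I -> R) :
  (forall i, P i -> dvdr a (F i)) -> dvdr a (\sum_(i <- r | P i) F i).
Proof.
move=> H; elim/big_rec: _ => [|i x Pi ax]; first exact: dvdr0.
by apply: dvdrD => //; apply: H.
Qed.

Definition prime_elt p : Prop :=
  [/\ p != 0, p \isn't a GRing.unit &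
      forall a b, dvdr p (a * b) -> dvdr p a \/ dvdr p b].

Lemma prime_dvdr_mul p a b : prime_elt p ->
  ~ dvdr p a -> ~ dvdr p b -> ~ dvdr p (a * b).
Proof. by case=> _ _ H na nb /H []. Qed.

Lemma prime_dvdr_prod p (u : R) (s : seq R) : prime_elt p ->
  u \is a GRing.unit -> dvdr p (u * \prod_(q <- s) q) -> exists2 q, q \in s & dvdr p q.
Proof.
move=> pp uu; have [_ pnu pM] := pp; case/pM => [[c e]|].
  by move: uu; rewrite e unitrM (negPf pnu) andbF.
elim: s => [|q s IH].
  rewrite big_nil => -[c e]; have : (1 : R) \is a GRing.unit by exact: unitr1.
  by rewrite e unitrM (negPf pnu) andbF.
rewrite big_cons => /pM [pq|/IH [r rs pr]]; first by exists q; rewrite ?mem_head.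
by exists r => //; rewrite inE rs orbT.
Qed.

Lemma prime_dvdr_prime p q : prime_elt p -> prime_elt q -> dvdr p q ->
  exists2 w, w \is a GRing.unit & q = w * p.
Proof.
move=> [p0 pnu _] [q0 _ qM] [w e]; exists w => //.
have [[c ec]|[c ec]] : dvdr q w \/ dvdr q p.
- by apply: qM; rewrite -e; apply: dvdr_refl.
- have : q * (1 - c * p) = 0 by rewrite mulrBr mulr1 {1}e ec; ring.
  move/eqP; rewrite mulf_eq0 (negPf q0) subr_eq0 => /eqP e1.
  have : (1 : R) \is a GRing.unit by exact: unitr1.
  by rewrite e1 unitrM (negPf pnu) andbF.
have : p * (1 - c * w) = 0 by rewrite mulrBr mulr1 {1}ec e; ring.
move/eqP; rewrite mulf_eq0 (negPf p0) subr_eq0 => /eqP e1.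
by apply/unitrP; exists c; split; rewrite // mulrC.
Qed.

Lemma cv_prime p (f g : nat -> R) (i j : nat) : prime_elt p ->
  ~ dvdr p (f i) -> (forall k, (k < i)%N -> dvdr p (f k)) ->
  ~ dvdr p (g j) -> (forall k, (k < j)%N -> dvdr p (g k)) ->
  ~ dvdr p (cv f g (i + j)).
Proof.
move=> pp nf Hf ng Hg.
have ilt : (i < (i + j).+1)%N by lia.
rewrite /cv (bigD1 (Ordinal ilt)) //= addKn => H.
apply: (prime_dvdr_mul pp nf ng); apply: dvdr_addl H; apply: dvdr_sum => k ki.
have {}ki : (k : nat) != i.
  by apply: contra ki => /eqP ki; apply/eqP/val_inj.
case: (ltnP k i) => lki; first by apply/dvdr_mulr/Hf.
by apply/dvdr_mull/Hg; have := ltn_ord k; lia.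
Qed.

(** Asking for prime rather than irreducible factors makes uniqueness of the factorisation
    automatic. *)
Definition ufd : Prop := forall a, a != 0 -> exists u (s : seq R),
  [/\ u \is a GRing.unit, (forall p, p \in s -> prime_elt p)
    & a = u * \prod_(p <- s) p].

End Divisibility.

Lemma irreducible_prime (R : idomainType) (a : R) : ufd R -> a != 0 ->
  a \isn't a GRing.unit ->
  (forall b c, a = b * c -> b \is a GRing.unit \/ c \is a GRing.unit) ->
  prime_elt a.
Proof.
move=> UR a0 anu airr; have [u [s [uu sp e]]] := UR _ a0.
case: s sp e => [|p s] sp e; first by rewrite e big_nil mulr1 uu in anu.
have pp : prime_elt p by apply: sp; rewrite mem_head.
have {}e : a = p * (u * \prod_(q <- s) q) by rewrite e big_cons; ring.
have [p0 pnu pM] := pp.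
have [pu|cu] := airr _ _ e; first by rewrite pu in pnu.
move: (u * _) cu e => w cw e.
have dvE b : dvdr a b <-> dvdr p b.
  split=> [[c ->]|[c ->]]; first by exists (c * w); rewrite e; ring.
  by exists (c / w); rewrite e [p * w]mulrC mulrA divrK.
by split=> // b c; rewrite !dvE; apply: pM.
Qed.

Section PolyUfd.
Variable R : idomainType.
Implicit Types (p q : R) (f g h : {poly R}).

Lemma dvdr_polyC p f : dvdr p%:P f <-> forall i, dvdr p f`_i.
Proof.
split=> [[g ->] i|H]; first by rewrite coefMC; exists g`_i.
have [g Hg] : exists g : nat -> R, forall i, f`_i = g i * p.
  exists (fun i => proj1_sig (constructive_indefinite_description _ (H i))) => i.
  by case: (constructive_indefinite_description _ (H i)).
exists (\poly_(i < size f) g i); apply/polyP => i; rewrite coefMC coef_poly Hg.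
case: ltnP => // ge; rewrite mul0r -Hg; exact: nth_default.
Qed.

Lemma prime_polyC p : prime_elt p -> prime_elt p%:P.
Proof.
move=> pp; have [p0 pnu pM] := pp; split; first by rewrite polyC_eq0.
  rewrite poly_unitE coefC eqxx negb_and; by rewrite pnu orbT.
move=> f g H; apply: NNPP => /not_or_and[/dvdr_polyC/not_all_ex_not[i0 ni]].
move=> /dvdr_polyC/not_all_ex_not[j0 nj].
have [i {}ni Hi] := ex_first (P := fun i => dvdr p f`_i) ni.
have [j {}nj Hj] := ex_first (P := fun i => dvdr p g`_i) nj.
apply: (cv_prime pp ni Hi nj Hj); rewrite /cv -coefM.
by move/dvdr_polyC: H.
Qed.

Definition primitive f : Prop := forall p, prime_elt p -> ~ dvdr p%:P f.

Lemma not_primitive f : ~ primitive f -> exists2 p, prime_elt p & dvdr p%:P f.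
Proof.
move=> nf; apply: NNPP => H; apply: nf => p pp pf; apply: H; by exists p.
Qed.

Hypothesis UR : ufd R.

(** The prime factors of [a] are cancelled one at a time: each divides the cofactor, since it cannot
    divide the primitive [f]. *)
Lemma primitive_dvdr (a : R) f g : primitive f -> a != 0 ->
  dvdr f (a%:P * g) -> dvdr f g.
Proof.
move=> fp /UR [u [s [uu sp ->]]].
elim: s g sp => [|p s IH] g sp.
  rewrite big_nil mulr1 => -[h e]; exists (u^-1%:P * h).
  by rewrite -mulrA -e mulrA -polyCM mulVr // mul1r.
rewrite big_cons => -[h e].
have pp : prime_elt p by apply: sp; rewrite mem_head.
have [p0 _ pM] := prime_polyC pp.
have [|[h' eh]|/fp []//] := pM h f.
  rewrite -e !polyCM; by exists (u%:P * (\prod_(q <- s) q)%:P * g); ring.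
apply: IH => [q qs|]; first by apply: sp; rewrite inE qs orbT.
by exists h'; apply: (mulIf p0); rewrite [RHS]mulrAC -eh -e !polyCM; ring.
Qed.

Lemma primitive_factor (a : R) f g h : primitive f -> a != 0 ->
  a%:P * f = g * h -> exists g' h', [/\ f = g' * h', size g' = size g & size h' = size h].
Proof.
move=> fp /UR [u [s [uu sp ->]]].
elim: s g h sp => [|p s IH] g h sp.
  rewrite big_nil mulr1 => e; exists (u^-1 *: g), h; split=> //.
    by rewrite -scalerAl -e mul_polyC scalerA mulVr // scale1r.
  by rewrite size_scale // invr_eq0; apply: contraTneq uu => ->; rewrite unitr0.
rewrite big_cons => e.
have pp : prime_elt p by apply: sp; rewrite mem_head.
have [p0 _ pM] := prime_polyC pp.
have H : dvdr p%:P (g * h).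
  by rewrite -e !polyCM; exists (u%:P * (\prod_(q <- s) q)%:P * f); ring.
have sz (k : {poly R}) : size (k * p%:P) = size k.
  by rewrite mulrC mul_polyC size_scale //; case: pp.
have sp' : forall q, q \in s -> prime_elt q.
  by move=> q qs; apply: sp; rewrite inE qs orbT.
case: (pM _ _ H) => -[k ek].
- have [||g' [h' [e1 e2 e3]]] := IH k h => //.
    apply: (mulIf p0); rewrite mulrAC [RHS]mulrAC -ek -e !polyCM; ring.
  by exists g', h'; split=> //; rewrite ek sz.
have [||g' [h' [e1 e2 e3]]] := IH g k => //.
  apply: (mulIf p0); rewrite mulrAC -[RHS]mulrA -ek -e !polyCM; ring.
by exists g', h'; split=> //; rewrite ek sz.
Qed.

(** [gcdp f g] is a gcd over the fraction field. If it is constant, a Bezout relation makes [f]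
    divide a scalar multiple of [h]; otherwise irreducibility makes its cofactor in [f] constant,
    and [f] divides a scalar multiple of [g]. Primitivity removes the scalars. *)
Lemma primitive_irreducible_prime f : primitive f -> (1 < size f)%N ->
  (forall g h, f = g * h -> (size g <= 1)%N \/ (size h <= 1)%N) -> prime_elt f.
Proof.
move=> fp sf irr; have f0 : f != 0 by rewrite -size_poly_gt0; lia.
split=> //; first by rewrite poly_unitE; case: eqP => // e; rewrite e in sf.
move=> g h H; have [->|g0] := eqVneq g 0; first by left; apply: dvdr0.
have d0 : gcdp f g != 0 by rewrite gcdp_eq0 negb_and f0.
have [[a b] /= a0 eab] := Pdiv.Idomain.dvdpP _ _ (dvdp_gcdl f g).
have [[a' b'] /= a0' eab'] := Pdiv.Idomain.dvdpP _ _ (dvdp_gcdr f g).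
have [k eh] := H; rewrite -mul_polyC in eab; rewrite -mul_polyC in eab'.
have [d1|d1] := leqP (size (gcdp f g)) 1.
  right; have [[u v] /= Huv] := Bezoutp f g.
  have [[c1 c2] /andP[/= c10 c20] Hc] := eqpP _ _ Huv.
  have [d ed] : exists d, gcdp f g = d%:P by exists (gcdp f g)`_0; apply: size1_polyC.
  have dn0 : d != 0 by move: d0; rewrite ed polyC_eq0.
  apply: (@primitive_dvdr (c2 * d)) => //; first by rewrite mulf_neq0.
  have Hc' : c1%:P * (u * f + v * g) = c2%:P * d%:P by rewrite !mul_polyC -ed.
  exists (c1%:P * (u * h + v * k)); rewrite polyCM -Hc'.
  have -> : c1%:P * (u * f + v * g) * h = c1%:P * (u * h * f + v * (g * h)) by ring.
  by rewrite eh; ring.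
have bn0 : b != 0.
  by apply: contraNneq a0 => b0; move/eqP: eab; rewrite b0 mul0r mulf_eq0 (negPf f0) orbF polyC_eq0.
left; have [f1 [f2 [ef s1 s2]]] := primitive_factor fp a0 eab.
have {d1}sb : (size b <= 1)%N by case: (irr _ _ ef); lia.
have {}sb := size1_polyC sb; move: (b`_0) sb => c ec.
have c0 : c != 0 by move: bn0; rewrite ec polyC_eq0.
apply: (@primitive_dvdr (c * a')) => //; first by rewrite mulf_neq0.
exists (b' * a%:P); rewrite polyCM -mulrA eab' -ec mulrCA -eab; ring.
Qed.

(** A prime constant dividing [f] divides its leading coefficient, so it is associated to one of the
    primes of that coefficient; their number drops each time one is divided out. *)
Lemma primitive_part f : f != 0 -> exists (t : seq R) g,
  [/\ forall p, p \in t -> prime_elt p, primitive g & f = (\prod_(p <- t) p)%:P * g].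
Proof.
move=> f0; have l0 : lead_coef f != 0 by rewrite lead_coef_eq0.
have [u [s [uu sp e]]] := UR l0; move: {-1}(size s) (erefl (size s)) => n en.
elim: n f u s uu sp e en {l0} f0 => [|n IH] f u s uu sp e en f0;
  case: (classic (primitive f)) => fp.
- by exists [::], f; split=> //; rewrite big_nil mul1r.
- case/not_primitive: fp => p pp [g eg].
  have : dvdr p (lead_coef f).
    by rewrite eg lead_coefM lead_coefC; exists (lead_coef g).
  by rewrite e => /(prime_dvdr_prod pp uu) [q]; rewrite (size0nil en).
- by exists [::], f; split=> //; rewrite big_nil mul1r.
case/not_primitive: fp => p pp [g eg].
have p0 : p != 0 by case: pp.
have : dvdr p (lead_coef f).
  by rewrite eg lead_coefM lead_coefC; exists (lead_coef g).
rewrite e => /(prime_dvdr_prod pp uu) [q qs pq].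
have [w wu eq] := prime_dvdr_prime pp (sp _ qs) pq.
have g0 : g != 0 by apply: contraNneq f0 => g0; rewrite eg g0 mul0r.
have H1 : u * w \is a GRing.unit by rewrite unitrM uu.
have H2 r : r \in rem q s -> prime_elt r by move/mem_rem/sp.
have H3 : lead_coef g = u * w * \prod_(p <- rem q s) p.
  apply: (mulIf p0); rewrite -{1}[p]lead_coefC -lead_coefM -eg e.
  by rewrite (big_rem q) //=; set X := \prod_(_ <- _) _; rewrite [in LHS]eq; ring.
have H4 : size (rem q s) = n by rewrite size_rem // en.
have [t [h [tp hp eh]]] := IH g _ _ H1 H2 H3 H4 g0.
exists (p :: t), h; split=> //.
  by move=> r; rewrite inE => /orP[/eqP-> //|]; apply: tp.
rewrite big_cons eg {1}eh polyCM; ring.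
Qed.


Lemma poly_ufd : ufd {poly R}.
Proof.
move=> f; move: {2}(size f).+1 (ltnSn (size f)) => n.
elim: n f => // n IH f; rewrite ltnS => sf f0.
have [t [g [tp gp ef]]] := primitive_part f0.
have /andP[t0 g0] : (\prod_(p <- t) p != 0) && (g != 0).
  by move: f0; rewrite ef mulf_eq0 polyC_eq0 negb_or.
have sg : size g = size f by rewrite ef mul_polyC size_scale.
suff [u [s [uu sp eg]]] : exists u s, [/\ u \is a GRing.unit,
    (forall p : {poly R}, p \in s -> prime_elt p) & g = u * \prod_(p <- s) p].
  exists u, ([seq p%:P | p <- t] ++ s); split=> //.
    move=> p; rewrite mem_cat => /orP[/mapP[q qt ->]|]; last exact: sp.
    by apply/prime_polyC/tp.
  by rewrite big_cat big_map /= ef eg rmorph_prod /=; ring.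
have [s1|s1] := leqP (size g) 1.
  have e := size1_polyC s1; have c0 : g`_0 != 0 by move: g0; rewrite {1}e polyC_eq0.
  have [u [s [uu sp ec]]] := UR c0.
  exists u%:P, [seq p%:P | p <- s]; split.
  - rewrite poly_unitE size_polyC coefC (_ : u != 0) ?uu //.
    by apply: contraTneq uu => ->; rewrite unitr0.
  - by move=> p /mapP[q qs ->]; apply/prime_polyC/sp.
  by rewrite e ec big_map polyCM rmorph_prod.
case: (classic (exists h k, [/\ g = h * k, (1 < size h)%N & (1 < size k)%N])); last first.
  move=> irr; exists 1, [:: g]; split; first exact: unitr1.
    move=> p; rewrite inE => /eqP ->; apply: primitive_irreducible_prime => // h k ehk.
    case: (leqP (size h) 1) => [|sh]; [by left|right].
    by rewrite leqNgt; apply/negP => sk; apply: irr; exists h, k.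
  by rewrite big_seq1 mul1r.
case=> h [k [ehk sh sk]].
have /andP[h0 k0] : (h != 0) && (k != 0).
  by move: g0; rewrite ehk mulf_eq0 negb_or.
have ss : size g = (size h + size k).-1 by rewrite ehk size_mul.
have [u [s [uu sp eh]]] := IH h (ltac:(lia)) h0.
have [u' [s' [uu' sp' ek]]] := IH k (ltac:(lia)) k0.
exists (u * u'), (s ++ s'); split; first by rewrite unitrM uu.
  by move=> p; rewrite mem_cat => /orP[/sp|/sp'].
by rewrite ehk eh ek big_cat /=; ring.
Qed.
End PolyUfd.

Lemma ufd_iso (R S : idomainType) (f : {rmorphism R -> S}) :
  injective f -> (forall y, exists x, f x = y) -> ufd S -> ufd R.
Proof.
move=> fI fS US.
have unitf x : (f x \is a GRing.unit) -> x \is a GRing.unit.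
  move=> fu; have [y ey] := fS (f x)^-1; apply/unitrP; exists y.
  by split; apply: fI; rewrite rmorphM ey rmorph1 (mulVr, mulrV).
have dvdf a b : dvdr (f a) (f b) <-> dvdr a b.
  split=> [[c]|[c ->]]; last by exists (f c); rewrite rmorphM.
  have [d <-] := fS c; rewrite -rmorphM => /fI ->; by exists d.
have primef p : prime_elt (f p) -> prime_elt p.
  case=> p0 pnu pM; split; first by apply: contra p0 => /eqP ->; rewrite rmorph0.
    by apply: contra pnu => pu; apply: rmorph_unit.
  by move=> a b /dvdf; rewrite rmorphM => /pM[] /dvdf; [left|right].
move=> a a0; have /US [u [s [uu sp e]]] : f a != 0 by rewrite -(rmorph0 f) (inj_eq fI).
have [u' eu] := fS u.
have [s' es] : exists s', s = map f s'.
  elim: s {sp e} => [|y s [s' ->]]; first by exists [::].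
  by have [x <-] := fS y; exists (x :: s').
exists u', s'; split; first by apply: unitf; rewrite eu.
  by move=> p ps; apply/primef/sp; rewrite es map_f.
by apply: fI; rewrite e rmorphM rmorph_prod eu es big_map.
Qed.

Lemma muni_mwiden (R : idomainType) n (p : {mpoly R[n]}) : muni (mwiden p) = p%:P.
Proof.
rewrite {1}[p](mpolyE) (big_morph _ (@mwidenD n R) (@mwiden0 n R)).
rewrite (big_morph _ (@muniD n R) (@muni0 n R)) [in RHS](mpolyE p) rmorph_sum /=.
apply: eq_bigr => u _; rewrite mwidenZ muniZ mwidenX muniE msuppX big_seq1.
rewrite mcoeffX eqxx scale1r mnmwiden_ordmax expr0 -!mul_polyC mulr1 -polyCM mul_mpolyC.
congr ((_ *: 'X_[_])%:P); apply/mnmP => i; by rewrite mnmE mnmwiden_widen.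
Qed.

(** All coefficients of [p] can be read off [muni p]; this is the injectivity of [muni] in
    [mpoly_ufd]. *)
Lemma coef_muni (R : idomainType) n (p : {mpoly R[n.+1]}) (u : 'X_{1..n.+1}) :
  ((muni p)`_(u ord_max))@_[multinom u (widen_ord (leqnSn n) i) | i < n] = p@_u.
Proof.
rewrite muniE coef_sum raddf_sum /= [in RHS](mpolyE p) raddf_sum /=.
apply: eq_bigr => w _; rewrite coefZ coefXn mcoeffZ mcoeffX.
have [->|nw] := eqVneq w u.
  by rewrite !eqxx mulr1 mcoeffZ mcoeffX eqxx.
rewrite mulr0; case: (eqVneq (u ord_max) (w ord_max)) => [e|] /=; last by rewrite mulr0 mcoeff0.
rewrite mulr1 mcoeffZ mcoeffX; case: eqP; rewrite ?mulr0 // => /mnmP H.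
case/eqP: nw; apply/mnmP => i; case: (unliftP ord_max i) => [j|] ->; last by [].
have := H j; rewrite !mnmE; have -> // : lift ord_max j = widen_ord (leqnSn n) j.
by apply: val_inj; rewrite /= /bump; have := ltn_ord j; case: leqP => //; lia.
Qed.

Lemma mpoly_ufd (k : fieldType) n : ufd {mpoly k[n]}.
Proof.
elim: n => [|n IH].
  move=> p p0; exists p, [::]; split=> //; last by rewrite big_nil mulr1.
  have e : p = (p@_0)%:MP.
    by apply/mpolyP => u; rewrite mcoeffC (_ : u = 0%MM) ?eqxx ?mulr1 //; apply/mnmP => -[].
  rewrite e; apply: (rmorph_unit (@mpolyC 0 k)).
  by rewrite unitfE; move: p0; rewrite {1}e mpolyC_eq0.
apply: (@ufd_iso _ _ (@muni n k)); last exact: poly_ufd.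
  move=> p q e; apply/mpolyP => u; by rewrite -!coef_muni e.
move=> q; exists (\sum_(i < size q) (mwiden q`_i) * ('X_ord_max) ^+ i).
rewrite rmorph_sum /= -[RHS]coefK poly_def; apply: eq_bigr => i _.
rewrite rmorphM rmorphXn /= muni_mwiden -mul_polyC; congr (_ * _ ^+ _).
have := muniE ('X_ord_max : {mpoly k[n.+1]}); rewrite msuppX big_seq1 mcoeffX eqxx scale1r.
rewrite mnm1E eqxx expr1 => ->; rewrite (_ : [multinom _ | _ < n] = 0%MM) ?mpolyX0 ?scale1r //.
apply/mnmP => j; rewrite !mnmE; apply/eqP; rewrite eqb0.
by apply/eqP => /(congr1 val) /= ej; have := ltn_ord j; rewrite -ej ltnn.
Qed.

(** * Power series over a ring and the grading by total degree *)

Section Series.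
Variable A : comNzRingType.
Implicit Types (a b c : nat -> A) (p q : {poly A}) (k n : nat).

Definition sq p : nat -> A := fun k => p`_k.

Lemma cv_sq p q k : cv (sq p) (sq q) k = (p * q)`_k.
Proof. by rewrite coefM. Qed.

Lemma eq_cv a a' b b' k : (forall i, (i <= k)%N -> a i = a' i) ->
  (forall i, (i <= k)%N -> b i = b' i) -> cv a b k = cv a' b' k.
Proof.
by move=> ea eb; apply: eq_bigr => i _; rewrite ea ?eb ?leq_subr // -ltnS.
Qed.

Definition tr n a : {poly A} := \poly_(i < n) a i.

(** A coefficient of a product involves finitely many terms, so [cv] inherits the ring laws of
    polynomials. *)
Lemma cv_tr n a b k : (k < n)%N -> cv a b k = (tr n a * tr n b)`_k.
Proof.
move=> kn; rewrite -cv_sq; apply: eq_cv => i ik; rewrite /sq coef_poly ifT //; lia.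
Qed.

Lemma cvC a b k : cv a b k = cv b a k.
Proof. by rewrite !(@cv_tr k.+1) // mulrC. Qed.

Lemma cvA a b c k : cv a (cv b c) k = cv (cv a b) c k.
Proof.
have H a' b' : forall i, (i <= k)%N -> cv a' b' i = sq (tr k.+1 a' * tr k.+1 b') i.
  by move=> i ik; rewrite (@cv_tr k.+1).
have T a' : forall i, (i <= k)%N -> a' i = sq (tr k.+1 a') i.
  by move=> i ik; rewrite /sq coef_poly ltnS ik.
by rewrite (eq_cv (T a) (H b c)) (eq_cv (H a b) (T c)) !cv_sq mulrA.
Qed.

Lemma cvDr a b c k : cv a (fun i => b i + c i) k = cv a b k + cv a c k.
Proof. by rewrite -big_split; apply: eq_bigr => i _; rewrite mulrDr. Qed.

Lemma cvNr a b k : cv a (fun i => - b i) k = - cv a b k.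
Proof. by rewrite -sumrN; apply: eq_bigr => i _; rewrite mulrN. Qed.

Lemma cvBr a b c k : cv a (fun i => b i - c i) k = cv a b k - cv a c k.
Proof. by rewrite (cvDr a b (fun i => - c i)) cvNr. Qed.

Lemma cv0r a k : cv a (fun=> 0) k = 0.
Proof. by apply: big1 => i _; rewrite mulr0. Qed.

Lemma cv_recl a b k : cv a b k = a 0 * b k + \sum_(i < k) a i.+1 * b (k - i.+1)%N.
Proof. by rewrite /cv big_ord_recl subn0. Qed.

Lemma cv_eq0 a b n : a 0 = 1 ->
  (forall k, (k < n)%N -> cv a b k = 0) -> forall k, (k < n)%N -> b k = 0.
Proof.
move=> a0 H k; elim/ltn_ind: k => k IH kn.
have := H k kn; rewrite cv_recl a0 mul1r big1 ?addr0 // => i _.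
by rewrite IH ?mulr0 //; have := ltn_ord i; lia.
Qed.

Lemma cv_inj a b c : a 0 = 1 ->
  (forall k, cv a b k = cv a c k) -> forall k, b k = c k.
Proof.
move=> a0 H k; apply/eqP; rewrite -subr_eq0; apply/eqP.
apply: (@cv_eq0 a (fun i => b i - c i) k.+1) => // i _.
by rewrite cvBr H subrr.
Qed.

(** The first [n] coefficients of the series [c / a] when [a 0 = 1]; carrying the list of earlier
    values makes the recursion structural. *)
Fixpoint quot_seq a c n : seq A :=
  if n is n'.+1 then let s := quot_seq a c n' in
    rcons s (c n' - \sum_(i < n') a i.+1 * s`_(n' - i.+1))
  else [::].

Lemma cv_solve a c : a 0 = 1 -> exists b, forall k, cv a b k = c k.
Proof.
move=> a0; have sz n : size (quot_seq a c n) = n.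
  by elim: n => //= n IH; rewrite size_rcons IH.
pose b i := (quot_seq a c i.+1)`_i.
have nthE n i : (i < n)%N -> (quot_seq a c n)`_i = b i.
  elim: n => // n IH; rewrite ltnS leq_eqVlt => /predU1P[-> //|lt].
  by rewrite /= nth_rcons sz lt IH.
exists b => k; rewrite cv_recl a0 mul1r {1}/b /= nth_rcons sz ltnn eqxx.
rewrite (eq_bigr (fun i : 'I_k => a i.+1 * b (k - i.+1)%N)) ?subrK // => i _.
by rewrite nthE //; have := ltn_ord i; lia.
Qed.

End Series.

Lemma cv_rmorph (A B : comNzRingType) (f : {rmorphism A -> B}) (a b : nat -> A) k :
  f (cv a b k) = cv (f \o a) (f \o b) k.
Proof. by rewrite rmorph_sum; apply: eq_bigr => i _; rewrite rmorphM. Qed.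

Section Graded.
Variables (m : nat) (R : comNzRingType).
Local Notation A := {mpoly R[m]}.
Implicit Types (p q : A) (u w : 'X_{1..m}).

(* The substitution [x_i := x_i t]: the coefficient of [t^k] is the homogeneous part of degree [k]. *)
Definition grd p : {poly A} :=
  mmap (@polyC _ \o @mpolyC m R) (fun i => ('X_i)%:P * 'X) p.
HB.instance Definition _ := GRing.RMorphism.copy grd
  (mmap (@polyC _ \o @mpolyC m R) (fun i => ('X_i)%:P * 'X) : A -> {poly A}).

Lemma grdM p q : grd (p * q) = grd p * grd q.
Proof. exact: (rmorphM (mmap (@polyC _ \o @mpolyC m R) (fun i => ('X_i)%:P * 'X))). Qed.

Lemma grdE p : grd p = \sum_(u <- msupp p) (p@_u *: 'X_[u])%:P * 'X^(mdeg u).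
Proof.
apply: eq_bigr => u _ /=; rewrite /mmap1.
under eq_bigr do rewrite exprMn.
rewrite big_split /= -expr_sum -mdegE mulrA -mul_mpolyC polyCM.
congr (_ * _ * _); rewrite mpolyXE_id rmorph_prod /=.
by apply: eq_bigr => i _; rewrite rmorphXn.
Qed.

Lemma mcoeff_grd p k u : ((grd p)`_k)@_u = p@_u *+ (mdeg u == k).
Proof.
rewrite grdE coef_sum raddf_sum /= [in RHS](mpolyE p) raddf_sum -sumrMnl /=.
apply: eq_bigr => w _; rewrite coefCM coefXn mulr_natr mcoeffMn mcoeffZ mcoeffX.
case: (eqVneq w u) => [->|]; first by rewrite eq_sym.
by rewrite mulr0 !mul0rn.
Qed.

Lemma grd0 p : (grd p)`_0 = (p@_0)%:MP.
Proof.
apply/mpolyP => u; rewrite mcoeff_grd mcoeffC mdeg_eq0.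
by case: eqP => [->|]; rewrite ?mulr0 ?mulr1.
Qed.

Lemma grd_eq0 p k : (msize p <= k)%N -> (grd p)`_k = 0.
Proof.
move=> sp; apply/mpolyP => u; rewrite mcoeff_grd mcoeff0.
case: eqP => // e; rewrite memN_msupp_eq0 //; apply/negP => /msize_mdeg_lt; lia.
Qed.

Lemma size_grd p : (size (grd p) <= msize p)%N.
Proof. by apply/leq_sizeP => k; apply: grd_eq0. Qed.

Lemma horner_grd p (c : R) : forall u, ((grd p).[c%:MP])@_u = c ^+ mdeg u * p@_u.
Proof.
move=> u; rewrite grdE horner_sum raddf_sum /= [in RHS](mpolyE p) raddf_sum /= mulr_sumr.
apply: eq_bigr => w _; rewrite hornerCM hornerXn -rmorphXn /= mulrC mcoeffCM.
rewrite mcoeffZ mcoeffX; case: eqP => [->|] //; by rewrite !mulr0.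
Qed.

Lemma horner_grd1 p : (grd p).[1] = p.
Proof.
by apply/mpolyP => u; rewrite -[1]/(1%:MP) horner_grd expr1n mul1r.
Qed.

Definition grs (f : 'X_{1..m} -> R) (k : nat) : A :=
  \sum_(n : 'X_{1..m < k.+1} | mdeg n == k) f n *: 'X_[n].

Lemma mcoeff_grs f k u : (grs f k)@_u = f u *+ (mdeg u == k).
Proof.
rewrite /grs big_mkcond raddf_sum /=.
case: (ltnP (mdeg u) k.+1) => lt.
  rewrite (bigD1 (BMultinom lt)) //= big1 ?addr0 => [|w /eqP nw].
    by case: eqP; rewrite ?mcoeff0 // mcoeffZ mcoeffX eqxx mulr1.
  case: (mdeg w == k); rewrite ?mcoeff0 // mcoeffZ mcoeffX.
  by case: eqP; rewrite ?mulr0 // => e; case: nw; apply: val_inj.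
rewrite gtn_eqF // big1 // => w _; case: (eqVneq (mdeg w) k); rewrite ?mcoeff0 // => wk.
by rewrite mcoeffZ mcoeffX; case: eqP lt => [<-|]; rewrite ?wk ?ltnn ?mulr0.
Qed.

(** [series_mul] over an arbitrary ring, so that it can be transported along ring morphisms. *)
Definition smul (Q : A) (f : 'X_{1..m} -> R) (n : 'X_{1..m}) : R :=
  \sum_(u <- msupp Q | (u <= n)%MM) Q@_u * f (n - u)%MM.

Lemma smulE Q f n : smul Q f n =
  \sum_(w : 'X_{1..m < (mdeg n).+1} | (w <= n)%MM) Q@_w * f (n - w)%MM.
Proof.
pose I : subFinType _ := 'X_{1..m < (mdeg n).+1}.
rewrite /smul (big_mksub_cond I) ?msupp_uniq //=; last first.
  by move=> u _ /mnm_lepP un; rewrite ltnS !mdegE; apply: leq_sum.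
rewrite big_mkcondr; apply: eq_bigr => w _; case: ifPn => //.
by move/memN_msupp_eq0 => ->; rewrite mul0r.
Qed.

Lemma cv_grd Q P f : (forall n, smul Q f n = P@_n) ->
  forall k, cv (sq (grd Q)) (grs f) k = (grd P)`_k.
Proof.
move=> H k; have [F FE] : exists F : A, forall n, (mdeg n <= k)%N -> F@_n = f n.
  by exists (\sum_(n : 'X_{1..m < k.+1}) f n *: 'X_[n]) => n nk; rewrite mcoeff_mpoly.
rewrite (@eq_cv _ _ (sq (grd Q)) _ (sq (grd F))) // => [|i ik].
  rewrite cv_sq -grdM; apply/mpolyP => u.
  transitivity ((Q * F)@_u *+ (mdeg u == k)); first exact: (mcoeff_grd (Q * F) k u).
  rewrite (mcoeff_grd P k u).
  case: eqP => // uk; rewrite -H smulE; congr (_ *+ _).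
  rewrite (mcoeff_poly_mul_lin _ _ (ltnSn _)); apply: eq_bigr => w _.
  by rewrite FE // -uk mdegB.
apply/mpolyP => u; rewrite mcoeff_grs mcoeff_grd.
by case: eqP => // ui; rewrite FE // ui.
Qed.

End Graded.

Lemma map_grd m (R S : comNzRingType) (f : {rmorphism R -> S}) (p : {mpoly R[m]}) k :
  (grd (map_mpoly f p))`_k = map_mpoly f (grd p)`_k.
Proof.
apply/mpolyP => u; rewrite mcoeff_grd !mcoeff_map_mpoly mcoeff_grd.
by rewrite raddfMn.
Qed.

Lemma map_grs m (R S : comNzRingType) (f : {rmorphism R -> S}) (g : 'X_{1..m} -> R) k :
  grs (f \o g) k = map_mpoly f (grs g k).
Proof.
by apply/mpolyP => u; rewrite mcoeff_grs mcoeff_map_mpoly mcoeff_grs raddfMn.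
Qed.

(** A gcd of positive degree has a prime factor of positive degree. It divides scalar multiples of
    [p] and of [q], and its degree keeps it from dividing the scalars, so it is a common prime
    divisor. Hence the gcd is constant and a Bezout relation has a constant right-hand side. *)
Lemma ufd_bezout (A : idomainType) (p q : {poly A}) : ufd A -> q != 0 ->
  (forall d, prime_elt d -> dvdr d p -> dvdr d q -> False) ->
  exists a b r, r != 0 /\ a * p + b * q = r%:P.
Proof.
move=> UA q0 cop.
have d0 : gcdp p q != 0 by rewrite gcdp_eq0 negb_and q0 orbT.
have [d1|d1] := leqP (size (gcdp p q)) 1.
  have [[u v] /= Huv] := Bezoutp p q.
  have [[c1 c2] /andP[/= c10 c20] Hc] := eqpP _ _ Huv.
  have ed := size1_polyC d1; move: (gcdp p q)`_0 ed => d ed.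
  have dn0 : d != 0 by move: d0; rewrite ed polyC_eq0.
  exists (c1%:P * u), (c1%:P * v), (c2 * d); split; first by rewrite mulf_neq0.
  by rewrite -!mulrA -mulrDr !mul_polyC Hc ed -mul_polyC polyCM.
have [u [s [uu sp ed]]] := poly_ufd UA d0.
have [/hasP[f fs sf]|ns] := boolP (has (fun f : {poly A} => (1 < size f)%N) s).
  have fp := sp _ fs; have fd : dvdr f (gcdp p q).
    by rewrite ed (big_rem f) //=; exists (u * \prod_(y <- rem f s) y); ring.
  suff H g : dvdp (gcdp p q) g -> dvdr f g.
    by case: (cop f fp); apply: H; rewrite ?dvdp_gcdl ?dvdp_gcdr.
  case/Pdiv.Idomain.dvdpP=> -[a b] /= a0 e.
  have [_ _ fM] := fp; case: (fM a%:P g) => //.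
    by rewrite mul_polyC e; apply: dvdr_mull.
  case=> c ea; have c0 : c != 0.
    by apply: contraNneq a0 => c0; rewrite -(polyC_eq0) ea c0 mul0r.
  have f0 : f != 0 by case: fp.
  have : (size c + size f).-1 = 1%N by rewrite -size_mul // -ea size_polyC a0.
  by move=> H; exfalso; move: sf c0 H; rewrite -(size_poly_gt0 c); lia.
have : (size (gcdp p q) <= 1)%N; last by rewrite leqNgt d1.
rewrite ed; have su : (size u <= 1)%N by move: uu; rewrite poly_unitE => /andP[/eqP ->].
elim: s u su ns {sp uu ed} => [|f s IH] u su ns; first by rewrite big_nil mulr1.
move: ns; rewrite /= negb_or -leqNgt => /andP[sf ns].
rewrite big_cons mulrA; apply: IH => //.
apply: leq_trans (size_polyMleq _ _) _; rewrite -subn1 leq_subLR; exact: leq_add.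
Qed.

Lemma prime_exp_bound (A : idomainType) (p a : A) : ufd A -> prime_elt p ->
  a != 0 -> exists n, ~ dvdr (p ^+ n) a.
Proof.
move=> UA pp /UA [u [s [uu sp ->]]]; exists (size s).+1.
have p0 : p != 0 by case: pp.
have [n en] : exists n, size s = n by exists (size s).
rewrite en; elim: n s u uu sp en => [|n IH] s u uu sp en H.
  have [q] := prime_dvdr_prod pp uu (s := s) H; by rewrite (size0nil en).
have [q qs pq] : exists2 q, q \in s & dvdr p q.
  by apply: (prime_dvdr_prod pp uu); apply: dvdr_trans H; exists (p ^+ n.+1); rewrite exprSr.
have [w wu eq] := prime_dvdr_prime pp (sp _ qs) pq.
apply: (IH (rem q s) (u * w)); first by rewrite unitrM uu.
- by move=> r /mem_rem/sp.
- by rewrite size_rem // en.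
case: H => c; rewrite (big_rem q) //=; set X := \prod_(_ <- _) _ => e.
exists c; apply: (mulIf p0); rewrite -[RHS]mulrA -exprSr -e [in RHS]eq; ring.
Qed.

(** Divide [V] by the largest power of [p] dividing all its coefficients, which exists because [V 0]
    is nonzero. If some [q j] escaped [p], the first such index, which is positive, and the first
    index where the reduced [V] escapes [p] would add up to a positive index at which the product is
    nonzero modulo [p]. *)
Lemma cv_const_prime (A : idomainType) (p : A) (q V : nat -> A) : ufd A ->
  prime_elt p -> cv q V 0 != 0 -> (forall k, cv q V k.+1 = 0) ->
  dvdr p (q 0%N) -> forall j, dvdr p (q j).
Proof.
move=> UA pp n0 H pq0 j; apply: NNPP => nj.
have [i ni Hi] := ex_first (P := fun j => dvdr p (q j)) nj.
have V0 : V 0%N != 0.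
  by apply: contraNneq n0 => e; rewrite cv_recl big_ord0 e mulr0 addr0.
have [N nN] := prime_exp_bound UA pp V0.
have [s ns Hs] := ex_first (P := fun s => forall k, dvdr (p ^+ s) (V k)) (i := N)
  (fun H => nN (H 0%N)).
case: s ns Hs => [[]|s ns Hs]; first by move=> k; exists (V k); rewrite expr0 mulr1.
have Hs' := Hs _ (ltnSn s).
pose W k := proj1_sig (constructive_indefinite_description _ (Hs' k)).
have WE k : V k = W k * p ^+ s.
  by rewrite /W; case: (constructive_indefinite_description _ _).
have [l0 nl0] : exists l, ~ dvdr p (W l).
  apply: not_all_ex_not => HW; apply: ns => k.
  by have [c e] := HW k; exists c; rewrite WE e exprS mulrA.
have [l nl Hl] := ex_first (P := fun k => dvdr p (W k)) nl0.
apply: (cv_prime pp ni Hi nl Hl).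
have i0 : (0 < i)%N by case: (i) ni => //.
have ps0 : p ^+ s != 0 by rewrite expf_neq0 //; case: pp.
suff -> : cv q W (i + l) = 0 by apply: dvdr0.
apply: (mulIf ps0); rewrite mul0r -(prednK i0) addSn -(H (i.-1 + l)%N) /cv mulr_suml.
by apply: eq_bigr => k _; rewrite WE mulrA.
Qed.

(** * Coprimality in the grading variable *)

Section GradedCoprime.
Variables (k : fieldType) (L : closedFieldType) (emb : {rmorphism k -> L}).
Hypothesis k0 : [pchar k] =i pred0.
Variable m : nat.
Local Notation A := {mpoly k[m]}.

Lemma natr_inj : injective (fun n => n%:R : k).
Proof.
move/pcharf0P: k0 => H a b; wlog ab : a b / (a <= b)%N.
  by move=> W e; case: (leqP a b) => [|/ltnW] ab; [apply: W|symmetry; apply: W].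
move=> /= e; have : (b - a)%:R = 0 :> k by rewrite natrB // e subrr.
by move/eqP; rewrite H; lia.
Qed.

Lemma poly_nat_eq0 (p : {poly k}) : (forall n, p.[n.+1%:R] = 0) -> p = 0.
Proof.
move=> H; apply: contraTeq isT => p0.
have := max_poly_roots p0 (rs := [seq n.+1%:R | n <- iota 0 (size p)]).
rewrite size_map size_iota ltnn; apply => //.
  by apply/allP => _ /mapP[n _ ->]; rewrite rootE H.
by rewrite map_inj_uniq ?iota_uniq // => a b /natr_inj [].
Qed.

Lemma horner_mcoeff (d : {poly A}) (l : k) u :
  (map_poly (mcoeff u) d).[l] = (d.[l%:MP])@_u.
Proof.
have sd : (size (map_poly (mcoeff u) d) <= size d)%N by exact: size_poly.
rewrite (horner_coef_wide _ sd) horner_coef raddf_sum /=.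
apply: eq_bigr => i _; rewrite coef_map_id0 ?mcoeff0 //.
by rewrite -rmorphXn /= [in RHS]mulrC mcoeffCM mulrC.
Qed.

(** A common divisor [d], specialised at [t = l] and rescaled by [x := x / l], divides both [P] and
    [Q], so [d(l)] is free of [x] for all nonzero [l], and [d] lies in [k[t]]. A nonzero root [l] of
    [d] in [L] would give [Q(l x) = 0]; the root 0 contradicts the nonvanishing of the constant
    coefficient of [Q1]. *)
Lemma graded_coprime (P Q : A) (P1 Q1 : {poly A}) e : Q != 0 ->
  grd P = 'X^e * P1 -> grd Q = 'X^e * Q1 -> Q1`_0 != 0 ->
  (forall D, dvdr D P -> dvdr D Q -> D = (D@_0)%:MP) ->
  forall d, prime_elt d -> dvdr d P1 -> dvdr d Q1 -> False.
Proof.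
move=> Q0 eP eQ Q10 cop d dp dP dQ.
have resc (p : A) (l : k) : l != 0 -> (grd (grd p).[l%:MP]).[l^-1%:MP] = p.
  move=> l0; apply/mpolyP => u; rewrite !horner_grd mulrA -exprMn mulVf //.
  by rewrite expr1n mul1r.
have dvd_l l p q : l != 0 -> grd p = 'X^e * q -> dvdr d q ->
    dvdr (grd d.[l%:MP]).[l^-1%:MP] p.
  move=> l0 ep [g eg]; exists ((grd (l%:MP ^+ e * g.[l%:MP])).[l^-1%:MP]).
  rewrite -{1}(resc p l) //.
  rewrite ep.
  rewrite eg.
  rewrite !hornerM.
  rewrite hornerXn.
  rewrite mulrA.
  rewrite grdM.
  by rewrite hornerM.
have dl0 l u : l != 0 -> u != 0%MM -> d.[l%:MP]@_u = 0.
  move=> l0 u0; have := cop _ (dvd_l _ _ _ l0 eP dP) (dvd_l _ _ _ l0 eQ dQ).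
  move/(congr1 (mcoeff u)); rewrite horner_grd mcoeffC (negPf u0) mulr0 => /eqP.
  by rewrite mulf_eq0 expf_eq0 invr_eq0 (negPf l0) andbF => /eqP.
have dE i u : u != 0%MM -> (d`_i)@_u = 0.
  move=> u0; pose du := map_poly (mcoeff u) d.
  suff : du = 0.
    by move/(congr1 (coefp i)); rewrite /coefp coef_map_id0 ?coef0 ?mcoeff0.
  apply: poly_nat_eq0 => n; rewrite horner_mcoeff dl0 //.
  by rewrite -[0]/(0%:R) (inj_eq natr_inj).
pose d1 := map_poly (mcoeff 0) d.
have ed : d = map_poly (@mpolyC m k) d1.
  apply/polyP => i; rewrite coef_map coef_map_id0 ?mcoeff0 //.
  apply/mpolyP => u; rewrite mcoeffC; case: eqP => [->|/eqP u0]; rewrite ?mulr1 ?mulr0 //.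
  exact: dE.
have [d0 dnu _] := dp.
have sd : size d1 != 1%N.
  apply: contra dnu => /eqP s1; have e1 := size1_polyC (eq_leq s1).
  have c0 : d1`_0 != 0 by rewrite -(polyC_eq0) -e1 -size_poly_eq0 s1.
  rewrite ed e1 map_polyC /=; apply: (rmorph_unit (@polyC A)).
  by apply: (rmorph_unit (@mpolyC m k)); rewrite unitfE.
have sd' : size (map_poly emb d1) != 1%N by rewrite size_map_poly.
have [l rl] := closed_rootP _ sd'.
pose h (p : {poly A}) := (map_poly (map_mpoly emb) p).[l%:MP].
have hd : h d = 0.
  rewrite /h ed -map_poly_comp /=.
  rewrite (eq_map_poly (g := @mpolyC m L \o emb)) => [|c]; last by rewrite /= map_mpolyC.
  by rewrite map_poly_comp horner_map (rootP rl) rmorph0.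
have hQ1 : h Q1 = 0.
  by case: dQ => g ->; rewrite /h rmorphM hornerM -/(h d) hd mulr0.
have emb0 : injective (@map_mpoly m k L emb).
  by move=> p q /mpolyP e1; apply/mpolyP => u; have := e1 u;
     rewrite !mcoeff_map_mpoly => /fmorph_inj.
have [l0|l0] := eqVneq l 0.
  case/eqP: Q10; apply: emb0; rewrite rmorph0 -hQ1 /h l0 rmorph0 horner_coef0.
  by rewrite coef_map.
case/eqP: Q0; apply/mpolyP => u; rewrite mcoeff0; apply: (fmorph_inj emb).
have : ((grd (map_mpoly emb Q)).[l%:MP])@_u = 0.
  have -> : grd (map_mpoly emb Q) = map_poly (map_mpoly emb) (grd Q).
    by apply/polyP => i; rewrite map_grd coef_map.
  by rewrite eQ rmorphM hornerM -/(h Q1) hQ1 mulr0 mcoeff0.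
rewrite horner_grd mcoeff_map_mpoly rmorph0 => /eqP.
by rewrite mulf_eq0 expf_eq0 (negPf l0) andbF => /eqP.
Qed.

End GradedCoprime.

(** * Algebraic numbers *)

(** The subfield structure on [Qb] needs a boolean predicate, hence the classical decision. *)
Definition algb : {pred Cc} :=
  fun z => if excluded_middle_informative (algebraic z) then true else false.

Lemma algbP (z : Cc) : reflect (algebraic z) (z \in algb).
Proof.
rewrite unfold_in /algb; case: excluded_middle_informative => H; by constructor.
Qed.

Lemma algebraicE (z : Cc) : algebraic z <-> algebraicOver (ratr : rat -> Cc) z.
Proof. by split=> [[p [p0 rp]]|[p p0 rp]]; exists p. Qed.

Lemma algb_divring : divring_closed algb.
Proof.
split.
- by apply/algbP/algebraicE/algebraic1.
- move=> x y /algbP/algebraicE ax /algbP/algebraicE ay.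
  exact/algbP/algebraicE/algebraic_sub.
- move=> x y /algbP/algebraicE ax /algbP/algebraicE ay.
  exact/algbP/algebraicE/algebraic_div.
Qed.

HB.instance Definition _ := GRing.isDivringClosed.Build Cc algb algb_divring.

Record Qb := MkQb { qval : Cc; qvalP : qval \in algb }.
HB.instance Definition _ := [isSub for qval].
HB.instance Definition _ := [Choice of Qb by <:].
HB.instance Definition _ := [SubChoice_isSubIntegralDomain of Qb by <:].
HB.instance Definition _ := [SubIntegralDomain_isSubField of Qb by <:].

HB.instance Definition _ := GRing.RMorphism.copy qval (val : Qb -> Cc).

Lemma qval_inj : injective qval. Proof. exact: val_inj. Qed.

Definition qrat (r : rat) : Qb := MkQb (introT (algbP (ratr r))
  (proj2 (algebraicE _) (algebraic_id (ratr : {rmorphism rat -> Cc}) r))).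

Lemma qrat_zmod : zmod_morphism qrat.
Proof. by move=> x y; apply: val_inj; rewrite /= !rmorphB. Qed.
Lemma qrat_monoid : monoid_morphism qrat.
Proof. by split=> [|x y]; apply: val_inj; rewrite /= ?rmorph1 ?rmorphM. Qed.
HB.instance Definition _ := GRing.isZmodMorphism.Build rat Qb qrat qrat_zmod.
HB.instance Definition _ := GRing.isMonoidMorphism.Build rat Qb qrat qrat_monoid.

Lemma map_qrat (p : {poly rat}) :
  map_poly qval (map_poly qrat p) = map_poly ratr p.
Proof. by rewrite -map_poly_comp; apply: eq_map_poly. Qed.

Lemma qrat_algebraic (x : Qb) : algebraicOver qrat x.
Proof.
have /algbP/algebraicE[p p0 rp] := qvalP x; exists p => //.
by rewrite -(fmorph_root qval) map_qrat.
Qed.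

Lemma qb_char0 : [pchar Qb] =i pred0.
Proof.
apply/pcharf0P => n.
by rewrite -(inj_eq qval_inj) rmorph_nat rmorph0 pnatr_eq0.
Qed.

(** * Minimal polynomials over the rationals *)

Section MinPoly.
Variables (L : fieldType) (e : {rmorphism rat -> L}).

Definition is_min_poly (z : L) (q : {poly rat}) : Prop :=
  [/\ q \is monic, root (map_poly e q) z &
    forall p, p != 0 -> root (map_poly e p) z -> (size q <= size p)%N].

Lemma min_poly_exists z : algebraicOver e z -> exists q, is_min_poly z q.
Proof.
case=> p p0 rp; pose P n := exists p : {poly rat},
  [/\ p != 0, root (map_poly e p) z & size p = n].
have [n nPn Hn] := ex_first (P := fun n => ~ P n) (i := size p)
  (fun H => H (ex_intro _ p (And3 p0 rp (erefl _)))).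
have [q [q0 rq sq]] := NNPP _ nPn.
exists ((lead_coef q)^-1 *: q).
have l0 : (lead_coef q)^-1 != 0 by rewrite invr_eq0 lead_coef_eq0.
split; first by rewrite monicE lead_coefZ mulVf // lead_coef_eq0.
  by rewrite map_polyZ /= rootZ // fmorph_eq0.
move=> r r0 rr; rewrite size_scale // sq leqNgt; apply/negP => /Hn; apply.
by exists r.
Qed.

Lemma min_poly_dvd z q p : is_min_poly z q -> root (map_poly e p) z -> q %| p.
Proof.
case=> qm rq H rp; rewrite /dvdp; apply: contraT => r0.
have : root (map_poly e (p %% q)) z.
  move: rp; rewrite {1}(divp_eq p q) rmorphD rmorphM !rootE hornerD hornerM.
  by rewrite (rootP rq) mulr0 add0r.
by move/(H _ r0); rewrite leqNgt ltn_modp monic_neq0.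
Qed.

Lemma size_min_poly z q : is_min_poly z q -> (1 < size q)%N.
Proof.
case=> qm rq _; rewrite ltnNge; apply/negP => /size1_polyC eq.
move: rq qm; rewrite eq map_polyC rootC fmorph_eq0 => /eqP ->.
by rewrite monicE lead_coefC eq_sym oner_eq0.
Qed.

(** With [q = h * g] and [g] the gcd of [q] and its derivative, [z] is a root of [h] or of [g], and
    minimality gives that factor full degree. For [g] this is impossible, since it divides the
    nonzero derivative. *)
Lemma min_poly_separable z q : is_min_poly z q -> separable_poly q.
Proof.
move=> qmin; have [qm rq H] := qmin; have s1 := size_min_poly qmin.
have q0 := monic_neq0 qm.
rewrite unlock /coprimep; set g := gcdp _ _.
have g0 : g != 0 by rewrite gcdp_eq0 negb_and q0.
have /dvdpP[h eh] : g %| q by apply: dvdp_gcdl.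
have h0 : h != 0 by apply: contraNneq q0 => h0; rewrite eh h0 mul0r.
have sg : (0 < size g)%N by rewrite size_poly_gt0.
have sh : (0 < size h)%N by rewrite size_poly_gt0.
have ss : size q = (size h + size g).-1 by rewrite {1}eh size_mul.
move: rq; rewrite {1}eh rmorphM rootM => /orP[/(H _ h0)|/(H _ g0)] le.
  by apply/eqP; move: (size q) (size h) (size g) ss sg sh le => a b c; lia.
have d0 : q^`() != 0.
  apply/eqP => /(congr1 (coefp (size q).-2)); rewrite /= coef_deriv coef0.
  have -> : (size q).-2.+1 = (size q).-1 by lia.
  move/eqP; rewrite -/(lead_coef q) (monicP qm) pnatr_eq0; lia.
have /(dvdp_leq d0)/(leq_trans le) : g %| q^`() by apply: dvdp_gcdr.
by rewrite leqNgt lt_size_deriv.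
Qed.

End MinPoly.

Lemma qb_split (p : {poly Qb}) : p \is monic ->
  exists ts : seq Qb, p = \prod_(t <- ts) ('X - t%:P).
Proof.
move=> pm; have [rs /= ers] := closed_field_poly_normal (map_poly qval p).
have pm' : map_poly qval p \is monic by rewrite map_monic.
rewrite (monicP pm') scale1r in ers.
have Ha r : r \in rs -> r \in algb.
  move=> rrs; apply/algbP/algebraicE.
  apply/integral_algebraic; apply: (@integral_root _ _ _ (map_poly qval p)).
  - by rewrite monic_neq0.
  - by rewrite ers root_prod_XsubC.
  - move=> _ /(nthP 0)[i _ <-]; rewrite coef_map.
    by apply/integral_algebraic/algebraicE/algbP; apply: qvalP.
have [ts ets] : exists ts : seq Qb, rs = map qval ts.
  elim: rs Ha {ers} => [|r rs IH] Ha; first by exists [::].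
  have [|ts ->] := IH; first by move=> x xr; apply: Ha; rewrite inE xr orbT.
  by exists (MkQb (Ha r (mem_head _ _)) :: ts).
exists ts; apply: (map_poly_inj qval).
rewrite [LHS]ers ets big_map rmorph_prod; apply: eq_bigr => t _.
by rewrite rmorphB /= map_polyX map_polyC.
Qed.

(** Iterating the primitive element theorem puts the finitely many coefficients of all polynomials
    in play into one field [Q(th)]. *)
Lemma qb_PET (s : seq Qb) : exists th : Qb, forall x, x \in s ->
  exists r : {poly rat}, (map_poly qrat r).[th] = x.
Proof.
elim: s => [|y s [th IH]]; first by exists 0.
have [p p0 rp] := qrat_algebraic th; have [q q0 rq] := qrat_algebraic y.
have [|n [[r1 e1] [r2 e2]]] := pchar0_PET p0 rp q0 rq; first exact: pchar_num.
exists (y *+ n - th) => x; rewrite inE => /orP[/eqP->|/IH[r er]]; first by exists r2.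
exists (r \Po r1); by rewrite map_comp_poly horner_comp e1.
Qed.

(* Elements of [Q(t)] are represented by polynomials; [tau t] realises them at a conjugate [t]. *)
Definition tau (t : Qb) : {poly rat} -> Qb := horner_eval t \o map_poly qrat.
HB.instance Definition _ t := GRing.RMorphism.copy (tau t) (horner_eval t \o map_poly qrat).

Lemma tauXn t j : tau t 'X^j = t ^+ j.
Proof. by rewrite /tau /= map_polyXn horner_evalE hornerXn. Qed.

Lemma det_diagonalized (R : idomainType) n (M V : 'M[R]_n) (D : 'rV[R]_n) :
  M *m V = V *m diag_mx D -> \det V != 0 -> \det M = \prod_i D 0 i.
Proof.
move=> e V0; apply: (mulfI V0); rewrite mulrC -det_mulmx e det_mulmx det_diag.
by rewrite mulrC.
Qed.

(** * Norms from a number field as determinants *)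

Section Norm.
Variables (q : {poly rat}) (ts : seq Qb).
Hypotheses (qm : q \is monic) (eq : map_poly qrat q = \prod_(t <- ts) ('X - t%:P)).
Hypothesis tsu : uniq ts.
Local Notation d := (size ts).

Lemma size_conj : size q = d.+1.
Proof. by rewrite -(size_map_poly qrat) eq size_prod_XsubC. Qed.

Lemma tau_mod t (r : {poly rat}) : t \in ts -> tau t (r %% q) = tau t r.
Proof.
move=> tts; rewrite [in RHS](divp_eq r q) rmorphD rmorphM /=.
suff -> : tau t q = 0 by rewrite mulr0 add0r.
by rewrite /tau /= horner_evalE eq; apply/rootP; rewrite root_prod_XsubC.
Qed.

Lemma tauE t (r : {poly rat}) n : (size r <= n)%N ->
  tau t r = \sum_(i < n) qrat r`_i * t ^+ i.
Proof.
move=> sr; rewrite /tau /= horner_evalE (horner_coef_wide (n := n)) ?size_map_poly //.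
by apply: eq_bigr => i _; rewrite coef_map.
Qed.

Lemma size_mod (r : {poly rat}) : (size (r %% q)%R <= d)%N.
Proof. by rewrite -ltnS -size_conj ltn_modp monic_neq0. Qed.

(** The product over the conjugates is the determinant of multiplication by [X] on the basis of
    powers modulo [q]. That matrix is rational, and the Vandermonde matrix of [ts], nonsingular as
    [ts] is duplicate-free, diagonalises it with the conjugates of [X] on the diagonal. *)
Lemma norm_rat m (X : {mpoly {poly rat}[m]}) :
  exists N : {mpoly rat[m]}, \prod_(t <- ts) map_mpoly (tau t) X = map_mpoly qrat N.
Proof.
pose c (j k : nat) (u : 'X_{1..m}) : rat := (('X^j * X@_u) %% q)`_k.
pose M : 'M[{mpoly rat[m]}]_d := \matrix_(j, k) \sum_(u <- msupp X) c j k u *: 'X_[u].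
have cM (j k : 'I_d) u : (M j k)@_u = c j k u.
  rewrite mxE raddf_sum /=; case: (boolP (u \in msupp X)) => us.
    rewrite (bigD1_seq u) ?msupp_uniq //= mcoeffZ mcoeffX eqxx mulr1 big1 ?addr0 // => w nw.
    by rewrite mcoeffZ mcoeffX (negPf nw) mulr0.
  rewrite big_seq big1 => [|w ws]; last first.
    by rewrite mcoeffZ mcoeffX; case: eqP ws us => [->->|]; rewrite ?mulr0.
  by rewrite /c (memN_msupp_eq0 us) mulr0 mod0p coef0.
pose V : 'M[Qb]_d := \matrix_(k, i) ts`_i ^+ k.
pose VM := map_mx (@mpolyC m Qb) V.
pose Xd : 'rV[{mpoly Qb[m]}]_d := \row_i map_mpoly (tau ts`_i) X.
have e : map_mx (map_mpoly qrat) M *m VM = VM *m diag_mx Xd.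
  apply/matrixP => j i; rewrite mul_mx_diag !mxE; apply/mpolyP => u.
  rewrite raddf_sum /= mcoeffCM mcoeff_map_mpoly.
  have tsi : ts`_i \in ts by rewrite mem_nth.
  transitivity (tau ts`_i (('X^j * X@_u) %% q)).
    rewrite (tauE _ (size_mod _)); apply: eq_bigr => k _.
    rewrite 2![map_mx _ _ _ _]mxE mulrC mcoeffCM mcoeff_map_mpoly cM mulrC.
    by congr (_ * _); rewrite mxE.
  rewrite tau_mod // rmorphM /=; congr (_ * _).
  exact: tauXn.
have V0 : \det VM != 0.
  rewrite det_map_mx mpolyC_eq0.
  have -> : V = Vandermonde d (\row_(i < d) ts`_i).
    by apply/matrixP => i j; rewrite !mxE.
  rewrite det_Vandermonde; apply/prodf_neq0 => i _; apply/prodf_neq0 => j ij.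
  by rewrite !mxE subr_eq0 nth_uniq //; move: ij; rewrite ltn_neqAle eq_sym => /andP[].
exists (\det M); rewrite -det_map_mx (det_diagonalized e V0) (big_nth 0) big_mkord.
by apply: eq_bigr => i _; rewrite mxE.
Qed.

(** The powers of [t] form an eigenvector of multiplication by [r] modulo [q], so its characteristic
    polynomial annihilates [tau t r]. The degree bound lets the height of a value be compared across
    the whole field. *)
Lemma conj_degree t (r : {poly rat}) : t \in ts ->
  exists p, [/\ p != 0, root (map_poly qrat p) (tau t r) & (size p <= d.+1)%N].
Proof.
move=> tts.
pose M : 'M[rat]_d := \matrix_(k, j) (('X^j * r) %% q)`_k.
exists (char_poly M); split; last by rewrite size_char_poly.
  by rewrite monic_neq0 // char_poly_monic.
rewrite map_char_poly -eigenvalue_root_char.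
have d0 : (0 < d)%N by case: (ts) tts.
apply/eigenvalueP; exists (\row_k t ^+ k).
  apply/rowP => j; rewrite !mxE.
  transitivity (tau t (('X^j * r) %% q)).
    rewrite (tauE _ (size_mod _)); apply: eq_bigr => k _.
    by rewrite !mxE mulrC.
  rewrite tau_mod // rmorphM mulrC /=; congr (_ * _).
  exact: tauXn.
apply/eqP => /rowP/(_ (Ordinal d0)); rewrite !mxE expr0 => /eqP.
by rewrite oner_eq0.
Qed.

End Norm.

(** * Heights and the growth of coefficients *)

Local Notation rln := Stdlib.Reals.Rpower.ln.

Lemma rlnXn (x : Rr) n : 0 < x -> rln (x ^+ n) = n%:R * rln x.
Proof. by move=> /RltP x0; rewrite -RpowE Rpower.ln_pow // INRE. Qed.

Lemma ler_rln (x y : Rr) : 0 < x -> 0 < y -> rln x <= rln y -> x <= y.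
Proof.
move=> x0 y0 le; rewrite leNgt; apply/negP => lt.
have : rln y < rln x by apply/RltP; apply: Rpower.ln_increasing; apply/RltP.
by rewrite ltNge le.
Qed.

Lemma rln1 : rln (1 : Rr) = 0 :> Rr. Proof. exact: Rpower.ln_1. Qed.

Lemma rln_ge0 (x : Rr) : 1 <= x -> 0 <= rln x.
Proof.
rewrite le_eqVlt => /predU1P[<-|lt]; first by rewrite rln1.
apply/ltW/RltP; rewrite -rln1; apply: Rpower.ln_increasing; last exact/RltP.
by apply/RltP; rewrite ltr01.
Qed.

Lemma rln_gt0 (x : Rr) : 1 < x -> 0 < rln x.
Proof.
move=> lt; apply/RltP; rewrite -rln1; apply: Rpower.ln_increasing; last exact/RltP.
by apply/RltP; rewrite ltr01.
Qed.

Lemma cabs_ge0 z : 0 <= cabs z.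
Proof. by case: z => a b; apply: sqrtr_ge0. Qed.

Lemma denominator_ex (q : {poly rat}) :
  exists2 D, (0 < D)%N & forall i, q`_i *+ D \is a Num.int.
Proof.
have [p [a a0 ->]] := rat_poly_scale q; exists `|a|%N; first by rewrite absz_gt0.
move=> i; rewrite coefZ coef_map /= -mulr_natr -[_%:R]/((`|a|%N : int)%:~R) abszE.
have [a_ge|a_lt] := ger0P a.
  by rewrite mulrAC mulVf ?mul1r ?intr_int // intr_eq0.
by rewrite mulrAC rmorphN mulrN mulVf ?mulN1r ?rpredN ?intr_int // intr_eq0.
Qed.

Lemma weil_height_spec_ex z : algebraic z -> weil_height_spec z (weil_height z).
Proof.
move/algebraicE => /min_poly_exists[q [qm rq H]].
apply: epsilon_spec; have [rs ers] := closed_field_poly_normal (map_poly ratr q : {poly Cc}).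
have [D0 D0p D0i] := denominator_ex q.
pose P D := (0 < D)%N /\ forall i, q`_i *+ D \is a Num.int.
have [D nnP HD] := ex_first (P := fun D => ~ P D) (i := D0) (fun H => H (conj D0p D0i)).
have {nnP} [Dp Di] := NNPP _ nnP.
exists (rln (D%:R * \prod_(a <- rs) Num.max 1 (cabs a)) / (size q).-1%:R).
exists q, rs, D; split=> //.
  by move: ers; rewrite lead_coef_map (monicP qm) rmorph1 scale1r.
split=> // D' D'p D'i; rewrite leqNgt; apply/negP => /HD; apply; by split.
Qed.

Lemma integral_scale_root (q : {poly rat}) D (a : Qb) : q \is monic -> (0 < D)%N ->
  (forall i, q`_i *+ D \is a Num.int) -> root (map_poly qrat q) a ->
  integralOver (intr : int -> Qb) (D%:R * a).
Proof.
move=> qm D0 qD rq; have q0 := monic_neq0 qm.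
pose e := (size q).-1; have se : size q = e.+1 by rewrite /e prednK // size_poly_gt0.
have qe : q`_e = 1 by rewrite -(monicP qm).
(* These are the coefficients of [D^e q(X / D)], with one factor [D] kept apart to make the
   coefficient of [q] integral. *)
pose c i : rat := if i == e then 1 else q`_i *+ D * D%:R ^+ (e - i.+1).
have cint i : c i \is a Num.int.
  by rewrite /c; case: eqP => // _; rewrite rpredM ?qD // rpredX // natr_int.
pose p : {poly int} := \poly_(i < e.+1) Num.floor (c i).
have pc i : (i < e.+1)%N -> (p`_i)%:~R = c i by move=> ie; rewrite coef_poly ie floorK.
have pe : p`_e = 1 by apply/eqP; rewrite -(eqr_int rat) pc // /c eqxx.
have sp : size p = e.+1.
  by apply/eqP; rewrite eqn_leq size_poly /= ltnNge;
    apply/negP => /leq_sizeP/(_ e (leqnn _)); rewrite pe.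
exists p; first by rewrite monicE lead_coefE sp pe.
rewrite rootE (horner_coef_wide _ (n := e.+1)); last first.
  by rewrite (leq_trans (size_poly _ _)) // sp.
have := rootP rq; rewrite (horner_coef_wide _ (n := e.+1)) ?size_map_poly ?se // => H.
move/(congr1 (GRing.mul (D%:R ^+ e))): H; rewrite mulr0 => H.
apply/eqP; rewrite -[RHS]H mulr_sumr; apply: eq_bigr => -[i /= ie] _.
rewrite !coef_map /= exprMn mulrA mulrA; congr (_ * _).
have -> : (p`_i)%:~R = qrat (c i) by rewrite -(pc _ ie) rmorph_int.
rewrite /c; case: eqP => [->|nie]; first by rewrite qe rmorph1 mul1r mulr1.
have -> : (D%:R : Qb) ^+ e = D%:R * D%:R ^+ (e - i.+1) * D%:R ^+ i.
  by rewrite -exprS -exprD; congr (_ ^+ _); lia.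
rewrite rmorphM rmorphMn rmorphXn rmorph_nat -mulr_natr; ring.
Qed.

Section Heights.
Variables (th : Qb) (q : {poly rat}) (ts : seq Qb).
Hypotheses (qmin : is_min_poly qrat th q).
Hypothesis (eq : map_poly qrat q = \prod_(t <- ts) ('X - t%:P)).

Lemma th_conj : th \in ts.
Proof. by case: qmin => _ + _; rewrite eq root_prod_XsubC. Qed.

Lemma tau_ker (r : {poly rat}) t : tau th r = 0 -> t \in ts -> tau t r = 0.
Proof.
move=> r0 tts; have /dvdpP[s ->] : q %| r by apply: (min_poly_dvd qmin); apply/rootP.
rewrite rmorphM /= {2}/tau /= horner_evalE eq.
suff -> : (\prod_(t <- ts) ('X - t%:P)).[t] = 0 by rewrite mulr0.
by apply/rootP; rewrite root_prod_XsubC.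
Qed.

Lemma tau_comp t (p r : {poly rat}) : tau t (p \Po r) = (map_poly qrat p).[tau t r].
Proof. by rewrite /tau /= !horner_evalE map_comp_poly horner_comp. Qed.

Lemma conj_root (r p : {poly rat}) t : root (map_poly qrat p) (tau th r) -> t \in ts ->
  root (map_poly qrat p) (tau t r).
Proof.
by move=> /rootP e tts; apply/rootP; rewrite -tau_comp; apply: tau_ker; rewrite ?tau_comp.
Qed.

(** [X] is the Mahler measure of the primitive integral minimal polynomial of the value: its leading
    coefficient [D] times the conjugates outside the unit disc. It dominates [D] and every
    conjugate, and its logarithm is the height times the degree of the value, which is at most
    [size ts]. *)
Lemma height_data (r : {poly rat}) : exists (X : Rr) (D : nat),
  [/\ (0 < D)%N, D%:R <= X, (forall t, t \in ts -> cabs (qval (tau t r)) <= X),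
      (forall t, t \in ts -> integralOver (intr : int -> Qb) (D%:R * tau t r)) &
      rln X <= weil_height (qval (tau th r)) * (size ts)%:R].
Proof.
have /weil_height_spec_ex[q1 [rs [D [[q1m q1r] q1min ers [[D0 qD] _] eh]]]] :
  algebraic (qval (tau th r)) by apply/algbP/qvalP.
have rq1 : root (map_poly qrat q1) (tau th r) by rewrite -(fmorph_root qval) map_qrat.
pose M := \prod_(a <- rs) Num.max 1 (cabs a).
have M1 (s : seq Cc) : 1 <= \prod_(a <- s) Num.max 1 (cabs a).
  elim: s => [|a s IH]; rewrite ?big_nil // big_cons mulr_ege1 // le_max lexx //.
have D1 : 1 <= D%:R :> Rr by rewrite ler1n.
have X1 : 1 <= D%:R * M by rewrite mulr_ege1 ?M1.
exists (D%:R * M), D; split=> //.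
- by rewrite ler_peMr ?M1 // ler0n.
- move=> t tts; have : qval (tau t r) \in rs.
    have := conj_root rq1 tts; rewrite -(fmorph_root qval) map_qrat ers.
    by rewrite root_prod_XsubC.
  move=> ars; apply: (@le_trans _ _ M); last by rewrite ler_peMl // (le_trans ler01) ?M1.
  rewrite /M (big_rem (qval (tau t r))) //=.
  apply: (@le_trans _ _ (Num.max 1 (cabs (qval (tau t r))))); first by rewrite le_max lexx orbT.
  by rewrite ler_peMr ?M1 // le_max ler01.
- by move=> t tts; apply: (integral_scale_root q1m D0 qD); apply: conj_root.
have qm : q \is monic by case: qmin.
have [p [p0 rp sp]] := conj_degree qm eq r th_conj.
have s1 : (size q1 <= (size ts).+1)%N.
  apply: leq_trans sp; apply: q1min => //.
  by move: rp; rewrite -(fmorph_root qval) map_qrat.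
have s2 : (1 < size q1)%N.
  rewrite ltnNge; apply/negP => /size1_polyC e1; move: q1r q1m.
  rewrite e1 map_polyC rootC fmorph_eq0 => /eqP ->.
  by rewrite monicE lead_coefC eq_sym oner_eq0.
rewrite eh -/M mulrAC ler_pdivlMr; last by rewrite ltr0n; lia.
by rewrite ler_wpM2l ?rln_ge0 // ler_nat; lia.
Qed.

Lemma height_growth m (f : 'X_{1..m} -> {poly rat}) :
  (forall eps : Rr, 0 < eps -> exists N0 : nat, forall N : nat, (N0 <= N)%N ->
     height_max (fun n => qval (tau th (f n))) N <= eps * N%:R) ->
  exists D : 'X_{1..m} -> nat,
  [/\ forall n, (0 < D n)%N,
      forall n t, t \in ts -> integralOver (intr : int -> Qb) ((D n)%:R * tau t (f n))
    & forall rho : Rr, 1 < rho -> exists2 C : Rr, 0 <= C & forall n,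
        (D n)%:R <= C * rho ^+ mdeg n /\
        forall t, t \in ts -> cabs (qval (tau t (f n))) <= C * rho ^+ mdeg n].
Proof.
move=> Hh.
have ts0 : 0 < (size ts)%:R :> Rr by rewrite ltr0n; case: (ts) th_conj.
have /constructive_indefinite_description[XD HXD] : exists XD : 'X_{1..m} -> Rr * nat,
  forall n, [/\ (0 < (XD n).2)%N, (XD n).2%:R <= (XD n).1,
   (forall t, t \in ts -> cabs (qval (tau t (f n))) <= (XD n).1),
      (forall t, t \in ts -> integralOver (intr : int -> Qb) ((XD n).2%:R * tau t (f n))) &
      rln (XD n).1 <= weil_height (qval (tau th (f n))) * (size ts)%:R].
  have H n : exists XD : Rr * nat, [/\ (0 < XD.2)%N, XD.2%:R <= XD.1,
   (forall t, t \in ts -> cabs (qval (tau t (f n))) <= XD.1),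
      (forall t, t \in ts -> integralOver (intr : int -> Qb) (XD.2%:R * tau t (f n))) &
      rln XD.1 <= weil_height (qval (tau th (f n))) * (size ts)%:R].
    by have [X [D H]] := height_data (f n); exists (X, D).
  exists (fun n => proj1_sig (constructive_indefinite_description _ (H n))) => n.
  exact: proj2_sig (constructive_indefinite_description _ (H n)).
exists (fun n => (XD n).2); split.
- by move=> n; case: (HXD n).
- by move=> n t tts; case: (HXD n) => _ _ _ + _; apply.
move=> rho rho1; have l0 := rln_gt0 rho1; have rho0 : 0 < rho by apply: lt_trans rho1.
(* With this [eps], height times degree is at most [maxn N0 (mdeg n)] times [rln rho], which bounds
   the Mahler measure by [rho ^+ maxn N0 (mdeg n)]. *)
have [|N0 HN0] := Hh (rln rho / (size ts)%:R); first by rewrite divr_gt0.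
exists (rho ^+ N0); first by rewrite exprn_ge0 // ltW.
move=> n; have [D0 DX cX _ hX] := HXD n.
have X0 : 0 < (XD n).1 by apply: lt_le_trans DX; rewrite ltr0n.
suff H : (XD n).1 <= rho ^+ N0 * rho ^+ mdeg n.
  by split=> [|t tts]; apply: le_trans H => //; apply: cX.
apply: (@le_trans _ _ (rho ^+ maxn N0 (mdeg n))); last first.
  rewrite -exprD; apply: ler_weXn2l; [exact: ltW|lia].
apply: ler_rln => //; first by rewrite exprn_gt0.
rewrite rlnXn //; apply: (le_trans hX).
have nb : (mdeg n < (maxn N0 (mdeg n)).+1)%N by lia.
have := HN0 _ (leq_maxl N0 (mdeg n)).
have hle : weil_height (qval (tau th (f n))) <=
    height_max (fun n => qval (tau th (f n))) (maxn N0 (mdeg n)).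
  exact: (@le_bigmax _ _ _ _ (fun w : 'X_{1..m < (maxn N0 (mdeg n)).+1} =>
    weil_height (qval (tau th (f w)))) (BMultinom nb)).
move/(le_trans hle) => {}hle.
apply: (@le_trans _ _ (rln rho / (size ts)%:R * (maxn N0 (mdeg n))%:R * (size ts)%:R)).
  by rewrite ler_wpM2r // ltW.
by rewrite mulrAC divfK ?gt_eqF // mulrC.
Qed.

End Heights.

(** * Subexponential growth *)

Section Subexponential.
Implicit Types (s t : nat -> Cc).

Definition subexp s : Prop := forall rho : Rr, 1 < rho ->
  exists C : Rr, forall k, cabs (s k) <= C * rho ^+ k.

Lemma cabsD x y : cabs (x + y) <= cabs x + cabs y.
Proof. exact: (@le_normcD Rr x y). Qed.

Lemma cabsM x y : cabs (x * y) = cabs x * cabs y.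
Proof. exact: ComplexField.Normc.normcM. Qed.

Lemma cabs0 : cabs 0 = 0. Proof. exact: ComplexField.Normc.normc0. Qed.
Lemma cabs1 : cabs 1 = 1. Proof. exact: ComplexField.Normc.normc1. Qed.

Lemma cabs_nat n : cabs n%:R = n%:R.
Proof. by rewrite [LHS](@normcMn Rr 1 n) -/(cabs 1) cabs1. Qed.

Lemma cabsN x : cabs (- x) = cabs x. Proof. exact: (@normcN Rr x). Qed.

Lemma cabsXn x n : cabs (x ^+ n) = cabs x ^+ n.
Proof. by elim: n => [|n IH]; rewrite ?cabs1 // !exprS cabsM IH. Qed.

Lemma cabs_prod (I : Type) (r : seq I) (P : pred I) (F : I -> Cc) :
  cabs (\prod_(i <- r | P i) F i) = \prod_(i <- r | P i) cabs (F i).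
Proof. exact: (big_morph cabs cabsM cabs1). Qed.

Lemma cabs_sum (I : Type) (r : seq I) (P : pred I) (F : I -> Cc) :
  cabs (\sum_(i <- r | P i) F i) <= \sum_(i <- r | P i) cabs (F i).
Proof.
elim/big_rec2: _ => [|i x y _ H]; first by rewrite cabs0.
by apply: le_trans (cabsD _ _) _; rewrite lerD2l.
Qed.

Lemma subexp_ge0 s rho C : (forall k, cabs (s k) <= C * rho ^+ k) -> 0 <= C :> Rr.
Proof. by move/(_ 0%N); rewrite expr0 mulr1; apply: le_trans (cabs_ge0 _). Qed.

Lemma bernoulli (x : Rr) n : 0 <= x -> 1 + n%:R * x <= (1 + x) ^+ n.
Proof.
move=> x0; elim: n => [|n IH]; first by rewrite mul0r addr0 expr0.
rewrite exprS; apply: (@le_trans _ _ ((1 + x) * (1 + n%:R * x))).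
  rewrite -subr_ge0 (_ : _ - _ = n%:R * x ^+ 2); last by rewrite -natr1; ring.
  by rewrite mulr_ge0 ?ler0n ?exprn_ge0.
by rewrite ler_wpM2l // addr_ge0.
Qed.

Lemma linear_le_exp (rho : Rr) : 1 < rho ->
  exists2 C : Rr, 0 <= C & forall k, k.+1%:R <= C * rho ^+ k.
Proof.
move=> rho1; pose x := rho - 1; have x0 : 0 < x by rewrite subr_gt0.
exists (1 + x^-1); first by rewrite addr_ge0 // invr_ge0 ltW.
move=> k; have -> : rho = 1 + x by rewrite /x; ring.
have c0 : 0 <= 1 + x^-1 by rewrite addr_ge0 // invr_ge0 ltW.
apply: le_trans (ler_wpM2l c0 (bernoulli k (ltW x0))).
have xx : x^-1 * x = 1 by rewrite mulVf ?gt_eqF.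
have -> : (1 + x^-1) * (1 + k%:R * x) = 1 + k%:R * x + x^-1 + k%:R * (x^-1 * x) by ring.
rewrite xx -natr1.
have : 0 <= k%:R * x + x^-1 by rewrite addr_ge0 ?mulr_ge0 ?ler0n ?invr_ge0 // ltW.
by lra.
Qed.

(** Splitting [rho] as a square leaves one factor for each of two growth rates, be they of two
    series or of a series and a polynomial weight. *)
Lemma sqrt_gt1 (rho : Rr) : 1 < rho -> 1 < Num.sqrt rho /\ Num.sqrt rho ^+ 2 = rho.
Proof.
move=> r1; have r0 : 0 < rho by apply: lt_trans r1.
split; last by rewrite sqr_sqrtr // ltW.
by rewrite -sqrtr1 ltr_sqrt.
Qed.

Lemma subexp_le s t : (forall k, cabs (s k) <= cabs (t k)) -> subexp t -> subexp s.
Proof.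
move=> le Ht rho r1; have [C HC] := Ht rho r1; exists C => k.
exact: le_trans (le k) (HC k).
Qed.

Lemma subexpD s t : subexp s -> subexp t -> subexp (fun k => s k + t k).
Proof.
move=> Hs Ht rho r1; have [C HC] := Hs rho r1; have [E HE] := Ht rho r1.
by exists (C + E) => k; rewrite mulrDl; apply: le_trans (cabsD _ _) _; apply: lerD.
Qed.

Lemma subexpM s t : subexp s -> subexp t -> subexp (fun k => s k * t k).
Proof.
move=> Hs Ht rho /sqrt_gt1[r1 <-].
have [C HC] := Hs _ r1; have [E HE] := Ht _ r1.
exists (C * E) => k; rewrite cabsM -exprM mul2n -addnn exprD mulrACA.
by apply: ler_pM; rewrite ?cabs_ge0.
Qed.

Lemma subexp_nat : subexp (fun k => k.+1%:R).
Proof.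
move=> rho /linear_le_exp[C _ HC]; exists C => k; apply: le_trans (HC k).
by rewrite cabs_nat.
Qed.

Lemma subexp_eventually0 s n : (forall k, (n <= k)%N -> s k = 0) -> subexp s.
Proof.
move=> H rho r1; exists (\sum_(i < n) cabs (s i)) => k.
have S0 : 0 <= \sum_(i < n) cabs (s i) by apply: sumr_ge0 => i _; apply: cabs_ge0.
have [kn|nk] := ltnP k n; last first.
  by rewrite H // cabs0 mulr_ge0 ?exprn_ge0 // ltW // (lt_trans _ r1).
apply: (@le_trans _ _ (\sum_(i < n) cabs (s i))).
  by rewrite (bigD1 (Ordinal kn)) //= lerDl; apply: sumr_ge0 => i _; apply: cabs_ge0.
by rewrite ler_peMr // exprn_ege1 // ltW.
Qed.

Lemma subexp_cv s t : subexp s -> subexp t -> subexp (cv s t).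
Proof.
move=> Hs Ht rho /sqrt_gt1[r1 <-].
have [C HC] := Hs _ r1; have [E HE] := Ht _ r1; have [K K0 HK] := linear_le_exp r1.
set r := Num.sqrt rho in r1 HC HE HK *.
have r0 : 0 <= r by rewrite ltW // (lt_trans _ r1).
have C0 := subexp_ge0 HC; have der0 := subexp_ge0 HE.
exists (K * (C * E)) => k; rewrite -exprM mul2n -addnn exprD mulrACA.
apply: (@le_trans _ _ (\sum_(i < k.+1) C * E * r ^+ k)).
  apply: le_trans (cabs_sum _ _ _) _; apply: ler_sum => i _.
  rewrite cabsM; have -> : r ^+ k = r ^+ i * r ^+ (k - i).
    by rewrite -exprD subnKC // -ltnS.
  by rewrite mulrACA; apply: ler_pM; rewrite ?cabs_ge0.
rewrite sumr_const card_ord -mulr_natl; apply: ler_wpM2r; last exact: HK.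
by rewrite !mulr_ge0 ?exprn_ge0.
Qed.

Lemma card_bmultinom m k : (#|{: 'X_{1..m < k.+1}}| <= k.+1 ^ m)%N.
Proof.
pose g (n : 'X_{1..m < k.+1}) : {ffun 'I_m -> 'I_k.+1} := [ffun i => inord (n i)].
have gi : injective g.
  move=> n n' /ffunP e; apply/val_inj/mnmP => i; have := congr1 val (e i).
  have b (w : 'X_{1..m < k.+1}) : (w i < k.+1)%N.
    by apply: leq_trans (bmdeg w); rewrite ltnS mdegE (bigD1 i) //= leq_addr.
  by rewrite !ffunE /= !inordK.
by have := leq_card g gi; rewrite card_ffun !card_ord.
Qed.

Lemma subexp_grs m (f : 'X_{1..m} -> Cc) (c : 'I_m -> Cc) :
  (forall i, cabs (c i) <= 1) ->
  (forall rho : Rr, 1 < rho -> exists C : Rr, forall n, cabs (f n) <= C * rho ^+ mdeg n) ->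
  subexp (fun k => (grs f k).@[c]).
Proof.
move=> c1 Hf.
have Hcard j : subexp (fun k => (k.+1%:R) ^+ j).
  elim: j => [|j IH]; last first.
    by apply: subexp_le (subexpM subexp_nat IH) => k; rewrite exprS.
  move=> rho r1; exists 1 => k; rewrite expr0 cabs1 mul1r exprn_ege1 // ltW //.
move=> rho /sqrt_gt1[r1 <-]; have [C HC] := Hf _ r1; have [E HE] := Hcard m _ r1.
exists (E * C) => k; rewrite -exprM mul2n -addnn exprD mulrACA.
have C0 : 0 <= C by have := HC 0%MM; rewrite mdeg0 expr0 mulr1; apply: le_trans (cabs_ge0 _).
have r0 : 0 <= Num.sqrt rho by rewrite ltW // (lt_trans _ r1).
rewrite /grs raddf_sum /=; apply: le_trans (cabs_sum _ _ _) _.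
apply: (@le_trans _ _ (\sum_(n : 'X_{1..m < k.+1}) C * Num.sqrt rho ^+ k)).
  rewrite [leRHS](bigID (fun n : 'X_{1..m < k.+1} => mdeg n == k)) /=.
  rewrite -[leLHS]addr0; apply: lerD; last first.
    by apply: sumr_ge0 => n _; rewrite mulr_ge0 ?exprn_ge0.
  apply: ler_sum => n /eqP nk; rewrite mevalZ cabsM -[leRHS]mulr1.
  apply: ler_pM; rewrite ?cabs_ge0 //; first by have := HC n; rewrite nk.
  rewrite mevalX cabs_prod; apply: prodr_ile1 => i _.
  by rewrite cabs_ge0 cabsXn exprn_ile1 ?cabs_ge0.
rewrite sumr_const -mulr_natl; apply: ler_wpM2r; first by rewrite mulr_ge0 ?exprn_ge0.
apply: le_trans (HE k); apply: (@le_trans _ _ (k.+1 ^ m)%:R).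
  by rewrite ler_nat card_bmultinom.
by rewrite -natrX cabs_nat.
Qed.

End Subexponential.

(** * Subexponential growth of denominators *)

Section LocalIntegrality.
Variable p : nat.
Hypothesis pp : prime p.

Local Notation integral := (integralOver (intr : int -> Qb)).

(* [p^e] clears the [p]-part of the denominator of [z], uniformly at all places above [p]. *)
Definition pden e (z : Qb) : Prop :=
  exists s : nat, ~~ (p %| s)%N /\ integral ((p ^ e * s)%:R * z).

Lemma pden0 e : pden e 0.
Proof. by exists 1%N; rewrite Euclid_dvd1 // mulr0; split=> //; apply: integral0. Qed.

Lemma pden_mono e e' z : (e <= e')%N -> pden e z -> pden e' z.
Proof.
move=> le [s [ps iz]]; exists s; split=> //.
have -> : (p ^ e' * s)%:R * z = (p ^ (e' - e))%:R * ((p ^ e * s)%:R * z).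
  by rewrite mulrA -natrM mulnA -expnD subnK.
by apply: integral_mul => //; apply: integral_nat.
Qed.

Lemma pdenM e e' z z' : pden e z -> pden e' z' -> pden (e + e') (z * z').
Proof.
move=> [s [ps iz]] [s' [ps' iz']]; exists (s * s')%N.
split; first by rewrite Euclid_dvdM // negb_or ps.
by have := integral_mul iz iz'; congr integralOver; rewrite expnD !natrM; ring.
Qed.

Lemma pdenD e z z' : pden e z -> pden e z' -> pden e (z + z').
Proof.
move=> [s [ps iz]] [s' [ps' iz']]; exists (s * s')%N.
split; first by rewrite Euclid_dvdM // negb_or ps.
have := integral_add (integral_mul (integral_nat intr s') iz)
  (integral_mul (integral_nat intr s) iz').
by congr integralOver; rewrite !natrM; ring.
Qed.

Lemma pden_sum e (I : Type) (r : seq I) (P : pred I) (F : I -> Qb) :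
  (forall i, P i -> pden e (F i)) -> pden e (\sum_(i <- r | P i) F i).
Proof.
move=> H; elim/big_rec: _ => [|i x Pi]; [exact: pden0|exact/pdenD/H].
Qed.

Lemma pden_scale D z : (0 < D)%N -> integral (D%:R * z) -> pden (logn p D) z.
Proof.
move=> D0 iz; have [s cs eD] := pfactor_coprime pp D0.
by exists s; rewrite -prime_coprime // mulnC -eD.
Qed.

Lemma pden_alg z : exists e, pden e z.
Proof.
have [q [qm rq _]] := min_poly_exists (qrat_algebraic z).
have [D D0 qD] := denominator_ex q.
by exists (logn p D); apply: pden_scale => //; apply: (integral_scale_root qm).
Qed.

Lemma pden_seq (s : seq Qb) : exists e, forall z, z \in s -> pden e z.
Proof.
elim: s => [|z s [e IH]]; first by exists 0%N.
have [e' He'] := pden_alg z; exists (maxn e e') => y; rewrite inE => /orP[/eqP->|/IH].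
  by apply: pden_mono He'; rewrite leq_maxr.
by apply: pden_mono; rewrite leq_maxl.
Qed.

Section Sequences.
Variable m : nat.
Implicit Types s t : nat -> {mpoly Qb[m]}.

(* Denominators grow subexponentially at [p]: their [p]-adic valuation at degree [k] is [o(k)]. *)
Definition psub s : Prop := forall M, (0 < M)%N ->
  exists C, forall k u, pden (C + k %/ M) (s k)@_u.

Lemma psubD s t : psub s -> psub t -> psub (fun k => s k + t k).
Proof.
move=> Hs Ht M M0; have [C HC] := Hs M M0; have [E HE] := Ht M M0.
exists (C + E)%N => k u; rewrite mcoeffD; apply: pdenD.
  by apply: pden_mono (HC k u); lia.
by apply: pden_mono (HE k u); lia.
Qed.

Lemma psub_cv s t : psub s -> psub t -> psub (cv s t).
Proof.
move=> Hs Ht M M0; have [C HC] := Hs M M0; have [E HE] := Ht M M0.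
exists (C + E)%N => k u; rewrite /cv raddf_sum /=; apply: pden_sum => i _.
rewrite mcoeffM; apply: pden_sum => w _.
apply: pden_mono (pdenM (HC _ _) (HE _ _)).
have ik : (i <= k)%N by rewrite -ltnS.
(* It remains that the integer parts of [i / M] and [(k - i) / M] add up to at most that of
   [k / M]. *)
rewrite addnACA leq_add2l leq_divRL // mulnDl.
apply: leq_trans (leq_add (leq_trunc_div _ _) (leq_trunc_div _ _)) _.
by rewrite subnKC.
Qed.

Lemma psub_poly (a : {poly {mpoly Qb[m]}}) : psub (sq a).
Proof.
move=> M M0.
have [e He] := pden_seq (flatten [seq [seq c@_u | u <- msupp c] | c <- (a : seq _)]).
exists e => k u; rewrite /sq.
have [ka|ka] := ltnP k (size a); last by rewrite nth_default // mcoeff0; apply: pden0.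
have [us|us] := boolP (u \in msupp a`_k); last first.
  by rewrite memN_msupp_eq0 //; apply: pden0.
apply: pden_mono (leq_addr _ _) (He _ _); apply/flattenP.
exists [seq a`_k@_u | u <- msupp a`_k]; last exact: map_f.
by apply/mapP; exists a`_k => //; apply: mem_nth.
Qed.

Lemma psub_grs (f : 'X_{1..m} -> Qb) :
  (forall M, (0 < M)%N -> exists C, forall n, pden (C + mdeg n %/ M) (f n)) ->
  psub (grs f).
Proof.
move=> H M M0; have [C HC] := H M M0; exists C => k u; rewrite mcoeff_grs.
by case: eqP => [<-|_]; [exact: HC|exact: pden0].
Qed.

End Sequences.

Lemma expr1D_le (x : Rr) n : 0 <= x <= 1 -> (1 + x) ^+ n <= 1 + (2 ^+ n - 1) * x.
Proof.
case/andP=> x0 x1; elim: n => [|n IH]; first by rewrite !expr0 subrr mul0r addr0.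
rewrite exprS; apply: (@le_trans _ _ ((1 + x) * (1 + (2 ^+ n - 1) * x))).
  by rewrite ler_wpM2l // addr_ge0.
rewrite exprS; have : 1 <= (2 : Rr) ^+ n by rewrite exprn_ege1 // ler1n.
move: (2 ^+ n) => y y1; rewrite -subr_ge0.
rewrite (_ : _ - _ = (y - 1) * x * (1 - x)); last by ring.
by rewrite !mulr_ge0 // subr_ge0.
Qed.

(** By convexity [(1 + x)^M <= 1 + (2^M - 1) x] on [[0, 1]], whence the choice [x = 2^-M]. *)
Lemma root_of_two M : exists2 rho : Rr, 1 < rho & rho ^+ M <= 2.
Proof.
have e0 : (0 : Rr) < 2 ^+ M by rewrite exprn_gt0 // ltr0n.
have e1 : (1 : Rr) <= 2 ^+ M by rewrite exprn_ege1 // ler1n.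
exists (1 + (2 ^+ M)^-1); first by rewrite ltrDl invr_gt0.
apply: le_trans (expr1D_le _ _) _.
  by rewrite invr_ge0 ltW //= invf_le1.
rewrite mulrBl mulfV ?gt_eqF // mul1r.
have : 0 <= (2 ^+ M : Rr)^-1 by rewrite invr_ge0 ltW.
by lra.
Qed.

(** With [a] the valuation, take the [M]-th power of [2^a <= p^a <= D <= C rho^deg], where
    [rho^M <= 2]: it gives [2^(a M) <= 2^(N + deg)]. *)
Lemma logn_growth (I : Type) (deg D : I -> nat) : (forall i, 0 < D i)%N ->
  (forall rho : Rr, 1 < rho -> exists2 C : Rr, 0 <= C &
      forall i, (D i)%:R <= C * rho ^+ deg i) ->
  forall M, (0 < M)%N -> exists C, forall i, (logn p (D i) <= C + deg i %/ M)%N.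
Proof.
move=> D0 HD M M0; have [rho r1 rM] := root_of_two M.
have [C C0 HC] := HD _ r1.
have [N HN] : exists N : nat, C ^+ M <= 2 ^+ N.
  exists (Num.bound (C ^+ M)); have CM0 : 0 <= C ^+ M by rewrite exprn_ge0.
  apply: le_trans (ltW (archi_boundP CM0)) _.
  by rewrite -natrX ler_nat ltnW // ltn_expl.
have r0 : 0 <= rho by rewrite ltW // (lt_trans _ r1).
(* The extra 1 pays for splitting the integer part of [(N + deg i) / M]. *)
exists N.+1 => i; set a := logn p (D i).
have : (2 : Rr) ^+ (a * M) <= 2 ^+ (N + deg i).
  rewrite exprM exprD.
  apply: (@le_trans _ _ ((C * rho ^+ deg i) ^+ M)).
    apply: lerXn2r; rewrite ?nnegrE ?exprn_ge0 ?mulr_ge0 ?exprn_ge0 // ?ler0n //.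
    apply: le_trans (HC i); rewrite -natrX ler_nat.
    have pD : (p ^ a <= D i)%N by apply: dvdn_leq => //; apply: pfactor_dvdnn.
    apply: leq_trans pD; have p2 := prime_gt1 pp.
    by case: (posnP a) => [->|a0] //; rewrite leq_exp2r.
  rewrite exprMn -exprM mulnC exprM; apply: ler_pM; rewrite ?exprn_ge0 //.
  by apply: lerXn2r; rewrite ?nnegrE ?exprn_ge0 ?ler0n.
rewrite -!natrX ler_nat leq_exp2l // -leq_divRL // => H.
apply: leq_trans H _; apply: leq_trans (leq_divDl _ _ _) _.
by have := leq_div N M; lia.
Qed.

(** By Gauss's lemma [X - y] is proportional to an integral factor of a monic integral polynomial,
    and the leading coefficient of that factor is a unit. *)
Lemma rat_integral_int (y : rat) : integral (qrat y) -> y \is a Num.int.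
Proof.
case=> g gm; have eg : map_poly (intr : int -> Qb) g = map_poly qrat (map_poly (intr : int -> rat) g).
  by rewrite -map_poly_comp; apply: eq_map_poly => c /=; rewrite rmorph_int.
rewrite eg fmorph_root -dvdp_XsubCl => /dvdpP_rat_int[p1 [a a0 e1] [r e2]].
have lp : lead_coef p1 * lead_coef r = 1 by rewrite -lead_coefM -e2 (monicP gm).
have lu : lead_coef p1 \is a GRing.unit by apply/unitrP; exists (lead_coef r); rewrite mulrC.
have l1 : a * (lead_coef p1)%:~R = 1.
  rewrite -[RHS](lead_coefXsubC y) e1 lead_coefZ lead_coef_map_inj //; exact: intr_inj.
have e0 : - y = a * (p1`_0)%:~R.
  by have := congr1 (coefp 0) e1; rewrite /= coefZ coef_map coefB coefX coefC eqxx sub0r.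
rewrite -[y]opprK rpredN e0.
have l0 : (lead_coef p1)%:~R != 0 :> rat.
  by rewrite intr_eq0; apply: contraTneq lu => ->; rewrite unitr0.
have aE : a = (lead_coef p1)%:~R^-1 by apply: (mulIf l0); rewrite l1 mulVf.
by rewrite aE -rmorphV // -rmorphM intr_int.
Qed.

Lemma pden_rat e (x : rat) : pden e (qrat x) ->
  exists s : nat, ~~ (p %| s)%N /\ (p ^ e * s)%:R * x \is a Num.int.
Proof.
case=> s [ps iz]; exists s; split=> //; apply: rat_integral_int.
by rewrite rmorphM rmorph_nat.
Qed.

End LocalIntegrality.

(** * The denominator does not vanish at the origin *)

Section SeriesMore.
Variable A : comNzRingType.

Lemma cv_Xn e (s : nat -> A) k : cv (sq 'X^e) s (e + k) = s k.
Proof.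
have lt : (e < (e + k).+1)%N by lia.
rewrite /cv (bigD1 (Ordinal lt)) //= /sq coefXn eqxx mul1r addKn big1 ?addr0 // => i ne.
by rewrite coefXn -val_eqE /= in ne *; rewrite (negPf ne) mul0r.
Qed.

Lemma poly_Xn_factor (p : {poly A}) e :
  (forall i, (i < e)%N -> p`_i = 0) -> exists p1, p = 'X^e * p1.
Proof.
move=> H; exists (drop_poly e p); rewrite -{1}(poly_take_drop e p) mulrC.
suff -> : take_poly e p = 0 by rewrite add0r.
by apply/polyP => i; rewrite coef_take_poly coef0; case: ifP => // /H.
Qed.

(** As [Q F = P], the series [a F + b] has product [a P + b Q = r] with [Q]. *)
Lemma bezout_series (P Q a b : {poly A}) (F : nat -> A) (r : A) :
  (forall k, cv (sq Q) F k = P`_k) -> a * P + b * Q = r%:P ->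
  forall k, cv (sq Q) (fun k => cv (sq a) F k + b`_k) k = r%:P`_k.
Proof.
move=> H e k; rewrite cvDr -e coefD; congr (_ + _); last by rewrite -cv_sq cvC.
rewrite -[LHS]/(cv (sq Q) (cv (sq a) F) k).
rewrite cvA (eq_cv (a' := cv (sq a) (sq Q)) (b' := F)) => [|i _|//]; last exact: cvC.
by rewrite -cvA -cv_sq; apply: eq_cv.
Qed.

Lemma coef_Xn_shift (p : {poly A}) e k : ('X^e * p)`_(e + k) = p`_k.
Proof. by rewrite coefXnM ltnNge leq_addr addKn. Qed.

Lemma cv_shift (Q1 P1 : {poly A}) e (F : nat -> A) :
  (forall k, cv (sq ('X^e * Q1)) F k = ('X^e * P1)`_k) ->
  forall k, cv (sq Q1) F k = P1`_k.
Proof.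
move=> H k; rewrite -(coef_Xn_shift P1 e) -H -[LHS](cv_Xn e) cvA.
by apply: eq_cv => // i _; rewrite cv_sq.
Qed.

Lemma cv_scalars (Q1 Q2 V1 V2 : nat -> A) (r1 r2 : A) :
  (forall k, cv Q1 V1 k = r1%:P`_k) -> (forall k, cv Q2 V2 k = r2%:P`_k) ->
  forall k, cv (cv Q1 Q2) (cv V1 V2) k = (r1 * r2)%:P`_k.
Proof.
move=> H1 H2 k.
transitivity (cv (cv Q1 V1) (cv Q2 V2) k); last first.
  rewrite (eq_cv (a' := sq r1%:P) (b' := sq r2%:P)) => [|i _|i _]; rewrite ?H1 ?H2 //.
  by rewrite cv_sq -polyCM.
have E (a b c : nat -> A) : forall i, cv (cv a b) c i = cv a (cv b c) i by move=> i; rewrite cvA.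
rewrite !E; apply: eq_cv => // i _; rewrite !cvA; apply: eq_cv => // j _; exact: cvC.
Qed.

End SeriesMore.

Lemma mcoeff0M (R : comNzRingType) m (p q : {mpoly R[m]}) :
  (p * q)@_0%MM = p@_0%MM * q@_0%MM.
Proof. exact: rmorphM. Qed.

Lemma dvdr_cv (A : idomainType) (p : A) (q F : nat -> A) k :
  (forall j, dvdr p (q j)) -> dvdr p (cv q F k).
Proof. by move=> H; apply: dvdr_sum => i _; apply: dvdr_mulr. Qed.

Lemma dvdr_horner1 (A : idomainType) (p : A) (q : {poly A}) :
  (forall j, dvdr p q`_j) -> dvdr p q.[1].
Proof.
by move=> H; rewrite horner_coef; apply: dvdr_sum => i _; rewrite expr1n mulr1.
Qed.

Lemma mpoly_const_unit (k : fieldType) m (D : {mpoly k[m]}) :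
  D != 0 -> D = (D@_0)%:MP -> D \is a GRing.unit.
Proof.
move=> D0 e; rewrite e; apply: (rmorph_unit (@mpolyC m k)).
by rewrite unitfE; move: D0; rewrite {1}e mpolyC_eq0.
Qed.

Section Denominator.
Variables (m : nat) (P Q : {mpoly Qb[m]}) (f : 'X_{1..m} -> Qb).
Hypotheses (Q0 : Q != 0) (eQ : forall n, smul Q f n = P@_n).
Hypothesis cop : forall D, dvdr D P -> dvdr D Q -> D = (D@_0)%:MP.

Lemma prime_not_const (D : {mpoly Qb[m]}) : prime_elt D -> dvdr D P -> dvdr D Q -> False.
Proof.
move=> [D0 Du _] DP DQ; move: Du; rewrite mpoly_const_unit //; exact: cop.
Qed.

Lemma graded_bezout e P1 Q1 : grd P = 'X^e * P1 -> grd Q = 'X^e * Q1 -> Q1`_0 != 0 ->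
  exists a b r, r != 0 /\ a * P1 + b * Q1 = r%:P.
Proof.
move=> eP eQ1 Q10; apply: ufd_bezout; first exact: mpoly_ufd.
  by apply: contraNneq Q10 => ->; rewrite coef0.
exact: (@graded_coprime _ _ qval qb_char0 _ _ _ _ _ _ Q0 eP eQ1 Q10 cop).
Qed.

(** With [e] the lowest degree in [Q], both [grd Q = t^e Q1] and [grd P = t^e P1], and a Bezout
    relation gives a series whose product with [Q1] is free of [t]. If [e > 0], the lowest part of
    [Q] is not a unit and has a prime factor; by [cv_const_prime] this divides all of [Q1], hence
    all of [P1], against coprimality. *)
Lemma denom_const_neq0 : Q@_0 != 0.
Proof.
have [e0 ne0] : exists e, ~ (grd Q)`_e = 0.
  apply: not_all_ex_not => H; case/eqP: Q0; apply/mpolyP => u.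
  have := mcoeff_grd Q (mdeg u) u; by rewrite H !mcoeff0 eqxx mulr1n => <-.
have [e /eqP ne lte] := ex_first (P := fun e => (grd Q)`_e = 0) ne0.
have [Q1 eQ1] := poly_Xn_factor lte.
have cvQ := cv_grd eQ.
have [P1 eP1] : exists P1, grd P = 'X^e * P1.
  apply: poly_Xn_factor => i ie; rewrite -cvQ; apply: big1 => j _.
  by rewrite /sq lte ?mul0r //; have := ltn_ord j; lia.
have Q1E i : (grd Q)`_(e + i) = Q1`_i by rewrite eQ1; apply: coef_Xn_shift.
have cvQ1 k : cv (sq Q1) (grs f) k = P1`_k.
  by apply: (@cv_shift _ _ _ e); rewrite -eQ1 -eP1; exact: cvQ.
have Q10 : Q1`_0 != 0 by rewrite -Q1E addn0.
have [a [b [r [r0 eab]]]] := graded_bezout eP1 eQ1 Q10.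
have VE := bezout_series cvQ1 eab.
case: (posnP e) => [e00|e_gt0].
  by move: ne; rewrite e00 grd0 mpolyC_eq0.
exfalso; have [u [s [uu sp ed]]] := mpoly_ufd Q10.
case: s sp ed => [|p s] sp ed.
  case/unitrP: uu => v [_ uv]; move/(congr1 (mcoeff 0)): uv.
  have u0 : u@_0 = 0.
    have := mcoeff_grd Q e 0%MM; rewrite mdeg0 (ltn_eqF e_gt0) mulr0n => <-.
    by rewrite -[in RHS](addn0 e) Q1E ed big_nil mulr1.
  by rewrite mcoeff0M u0 mul0r mcoeff1 eqxx => /eqP; rewrite eq_sym oner_eq0.
have pp : prime_elt p by apply: sp; rewrite mem_head.
have pQ1 j : dvdr p Q1`_j.
  apply: (cv_const_prime (q := sq Q1) (V := fun k => cv (sq a) (grs f) k + b`_k) (@mpoly_ufd _ m) pp).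
  - by rewrite VE coefC.
  - by move=> k; rewrite VE coefC.
  - rewrite /sq ed big_cons; exists (u * \prod_(j <- s) j); ring.
have pP1 j : dvdr p P1`_j.
  by rewrite -cvQ1; apply: (dvdr_cv (q := sq Q1)).
have H (X : {mpoly Qb[m]}) (X1 : {poly {mpoly Qb[m]}}) :
    grd X = 'X^e * X1 -> (forall j, dvdr p X1`_j) -> dvdr p X.
  move=> eX H; rewrite -(horner_grd1 X) eX hornerM hornerXn expr1n mul1r.
  exact: dvdr_horner1.
by apply: (prime_not_const pp); [apply: H pP1 | apply: H pQ1].
Qed.

End Denominator.

(** * Descent to the rational numbers *)

Lemma map_smul m (R S : comNzRingType) (h : {rmorphism R -> S}) (Q : {mpoly R[m]})
  (f : 'X_{1..m} -> R) n : h (smul Q f n) = smul (map_mpoly h Q) (h \o f) n.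
Proof.
rewrite !smulE rmorph_sum; apply: eq_bigr => w _.
by rewrite rmorphM mcoeff_map_mpoly.
Qed.

Lemma map_sq_grd m (R S : comNzRingType) (h : {rmorphism R -> S}) (p : {mpoly R[m]}) :
  map_poly (map_mpoly h) (grd p) = grd (map_mpoly h p).
Proof. by apply/polyP => k; rewrite coef_map map_grd. Qed.

Lemma grd1 m (R : comNzRingType) : grd (1 : {mpoly R[m]}) = 1.
Proof.
apply/polyP => k; rewrite coef1; apply/mpolyP => u; rewrite mcoeff_grd mcoeff1.
case: k => [|k]; rewrite ?mcoeff1 ?mcoeff0 -?mdeg_eq0; first by case: eqP.
by case: (eqVneq (mdeg u) 0%N) => [->|]; rewrite ?mul0rn.
Qed.

Lemma map_bezout (A B : comNzRingType) (h : {rmorphism A -> B}) (a p b q : {poly A}) r :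
  map_poly h (a * p + b * q - r%:P) =
  map_poly h a * map_poly h p + map_poly h b * map_poly h q - (h r)%:P.
Proof. by rewrite rmorphB rmorphD !rmorphM /= map_polyC. Qed.

Lemma map_bezout0 (A B : comNzRingType) (h : {rmorphism A -> B}) (a' p' b' q' : {poly A})
  r' a p b q r : map_poly h a' = a -> map_poly h p' = p -> map_poly h b' = b ->
  map_poly h q' = q -> h r' = r ->
  map_poly h (a' * p' + b' * q' - r'%:P) = 0 <-> a * p + b * q = r%:P.
Proof.
move=> <- <- <- <- <-; rewrite map_bezout; split=> [/eqP|->]; last by rewrite subrr.
by rewrite subr_eq0 => /eqP.
Qed.

Section Lifting.
Variables (th : Qb) (m : nat).

Definition liftable (x : Qb) : Prop := exists r, tau th r = x.

Lemma lift_mpoly (X : {mpoly Qb[m]}) : (forall u, u \in msupp X -> liftable X@_u) ->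
  exists Y, map_mpoly (tau th) Y = X.
Proof.
move=> H; rewrite (mpolyE X).
elim: (msupp X) H => [|u s IH] H; first by exists 0; rewrite big_nil rmorph0.
have [|Y eY] := IH; first by move=> w ws; apply: H; rewrite inE ws orbT.
have [r er] := H u (mem_head _ _).
exists (r *: 'X_[u] + Y); rewrite big_cons raddfD /= eY map_mpolyZ map_mpolyX.
by rewrite /= er.
Qed.

Lemma lift_poly (a : {poly {mpoly Qb[m]}}) :
  (forall c, c \in (a : seq _) -> exists Y, map_mpoly (tau th) Y = c) ->
  exists b, map_poly (map_mpoly (tau th)) b = a.
Proof.
move=> H; have Hk k : exists Y, map_mpoly (tau th) Y = a`_k.
  have [ka|ka] := ltnP k (size a); first by apply: H; apply: mem_nth.
  by exists 0; rewrite rmorph0 nth_default.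
pose Y k := proj1_sig (constructive_indefinite_description _ (Hk k)).
exists (\poly_(k < size a) Y k); apply/polyP => k; rewrite coef_map coef_poly /=.
case: ltnP => ka; last by rewrite rmorph0 nth_default.
by rewrite /Y; case: (constructive_indefinite_description _ _).
Qed.

End Lifting.

(** The converse of [tau_ker]: if [th] is not a root of [r], then [r] is coprime to [q], and a
    Bezout relation keeps it from vanishing at any conjugate. *)
Lemma tau_unit_ker th q ts (r : {poly rat}) t : is_min_poly qrat th q ->
  map_poly qrat q = \prod_(t <- ts) ('X - t%:P) -> t \in ts ->
  tau t r = 0 -> tau th r = 0.
Proof.
move=> qmin eq tts rt; have [qm rq H] := qmin.
have q0 := monic_neq0 qm.
have tq x : x \in ts -> tau x q = 0.
  by move=> xts; rewrite /tau /= horner_evalE eq; apply/rootP; rewrite root_prod_XsubC.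
have /dvdpP[h eh] := dvdp_gcdr r q.
have h0 : h != 0 by apply: contraNneq q0 => h0; rewrite eh h0 mul0r.
have g0 : gcdp r q != 0 by rewrite gcdp_eq0 negb_and q0 orbT.
have := rq; rewrite {1}eh rmorphM rootM => /orP[rh|rg]; last first.
  have /dvdpP[c ->] := dvdp_gcdl r q.
  have gth : tau th (gcdp r q) = 0 by apply/rootP.
  by rewrite rmorphM /= gth mulr0.
have : coprimep r q.
  have := H _ h0 rh; rewrite {1}eh size_mul // /coprimep.
  by move: h0 g0; rewrite -!size_poly_gt0; move: (size h) (size _) => x y; lia.
move/Bezout_eq1_coprimepP => [[u v] /= e].
have E : tau t (u * r + v * q) = tau t u * tau t r + tau t v * tau t q.
  by rewrite rmorphD !rmorphM.
move: E; rewrite e rt tq // !mulr0 addr0 rmorph1.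
by move/eqP; rewrite oner_eq0.
Qed.

Section ArithmeticData.
Variables (m : nat) (P Q : {mpoly Qb[m]}) (f : 'X_{1..m} -> Qb).
Hypotheses (Q1 : Q@_0 = 1) (eQ : forall n, smul Q f n = P@_n).
Hypothesis cop : forall D, dvdr D P -> dvdr D Q -> D = (D@_0)%:MP.
Hypothesis hgt : forall eps : Rr, 0 < eps -> exists N0 : nat, forall N : nat,
  (N0 <= N)%N -> height_max (fun n => qval (f n)) N <= eps * N%:R.

(** An identity over [{poly rat}] that holds at [th] holds up to multiples of [q], so it may be read
    at every conjugate [t]. The lift of [f] is obtained by dividing [P'] by [Q'], which shows that
    all its coefficients lie in [Q(th)]. *)
Lemma lifted_data : exists th q ts (P' Q' r' : {mpoly {poly rat}[m]})
    (a' b' : {poly {mpoly {poly rat}[m]}}) (f' : 'X_{1..m} -> {poly rat}),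
  [/\ is_min_poly qrat th q /\ map_poly qrat q = \prod_(t <- ts) ('X - t%:P),
      Q'@_0 = 1 /\ map_mpoly (tau th) Q' = Q, forall n, tau th (f' n) = f n,
      map_mpoly (tau th) r' != 0 /\
        (forall t, t \in ts -> map_poly (map_mpoly (tau t)) a' * grd (map_mpoly (tau t) P') +
         map_poly (map_mpoly (tau t)) b' * grd (map_mpoly (tau t) Q') = (map_mpoly (tau t) r')%:P)
    & forall t, t \in ts -> forall n,
        smul (map_mpoly (tau t) Q') (tau t \o f') n = (map_mpoly (tau t) P')@_n].
Proof.
have Q0 : Q != 0 by apply: contra_eq_neq Q1 => ->; rewrite mcoeff0 eq_sym oner_eq0.
have [a [b [r [r0 eab]]]] : exists a b r, r != 0 /\ a * grd P + b * grd Q = r%:P.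
  apply: (graded_bezout Q0 cop (e := 0)); rewrite ?expr0 ?mul1r //.
  by rewrite grd0 Q1 mpolyC_eq0 oner_eq0.
pose S := [:: P; Q; r] ++ (a : seq _) ++ (b : seq _).
have [th Hth] := qb_PET (flatten [seq [seq (X : {mpoly Qb[m]})@_u | u <- msupp X] | X <- S]).
have lift X : X \in S -> exists Y, map_mpoly (tau th) Y = X.
  move=> XS; apply: lift_mpoly => u us; apply: Hth; apply/flattenP.
  exists [seq X@_u | u <- msupp X]; first by apply/mapP; exists X.
  by apply/mapP; exists u.
have [P' eP'] : exists P', map_mpoly (tau th) P' = P by apply: lift; rewrite !inE eqxx.
have [Q0' eQ0'] : exists Q', map_mpoly (tau th) Q' = Q by apply: lift; rewrite !inE eqxx orbT.
have [r' er'] : exists r', map_mpoly (tau th) r' = r by apply: lift; rewrite !inE eqxx !orbT.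
have [a' ea'] : exists a', map_poly (map_mpoly (tau th)) a' = a.
  by apply: lift_poly => c ca; apply: lift; rewrite !mem_cat ca orbT.
have [b' eb'] : exists b', map_poly (map_mpoly (tau th)) b' = b.
  by apply: lift_poly => c ca; apply: lift; rewrite !mem_cat ca !orbT.
(* The constant term has to be 1 before [tau th] is applied, so that [Q'] is invertible as a series
   over [{poly rat}]; the correction lies in the kernel of [tau th]. *)
have [Q' [eQ' Q'1]] : exists Q', map_mpoly (tau th) Q' = Q /\ Q'@_0 = 1.
  exists (Q0' + (1 - Q0'@_0)%:MP); split; last first.
    by rewrite mcoeffD mcoeffC eqxx mulr1 addrC subrK.
  have E : tau th (1 - Q0'@_0) = 0.
    by rewrite rmorphB rmorph1 -mcoeff_map_mpoly eQ0' Q1 subrr.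
  have EC : map_mpoly (tau th) (1 - Q0'@_0)%:MP_[m] = (tau th (1 - Q0'@_0))%:MP_[m].
    by rewrite map_mpolyC.
  by rewrite raddfD /= EC E eQ0' mpolyC0 addr0.
have [q qmin] := min_poly_exists (qrat_algebraic th).
have [ts ets] : exists ts, map_poly qrat q = \prod_(t <- ts) ('X - t%:P).
  by apply: qb_split; rewrite map_monic; case: qmin.
have Q'0 : sq (grd Q') 0%N = 1 by rewrite /sq grd0 Q'1.
have [F HF] := cv_solve (sq (grd P')) Q'0.
have FE k : map_mpoly (tau th) (F k) = grs f k.
  have q0 : sq (grd Q) 0%N = 1 by rewrite /sq grd0 Q1.
  apply: (cv_inj (b := fun k => map_mpoly (tau th) (F k)) q0) => {}k.
  rewrite (cv_grd eQ) -eP' map_grd -/(sq (grd P') k) -HF (cv_rmorph (map_mpoly (tau th))).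
  by apply: eq_cv => // i _; rewrite /sq /= -map_grd eQ'.
pose f' n := (F (mdeg n))@_n.
have f'E n : tau th (f' n) = f n.
  by rewrite /f' -mcoeff_map_mpoly FE mcoeff_grs eqxx.
exists th, q, ts, P', Q', r', a', b', f'; split=> //.
  split; first by rewrite er'.
  move=> t tts; pose X := a' * grd P' + b' * grd Q' - r'%:P.
  have Xth : map_poly (map_mpoly (tau th)) X = 0.
    have eP2 : map_poly (map_mpoly (tau th)) (grd P') = grd P.
      rewrite map_sq_grd eP'; reflexivity.
    have eQ2 : map_poly (map_mpoly (tau th)) (grd Q') = grd Q.
      rewrite map_sq_grd eQ'; reflexivity.
    exact: (proj2 (map_bezout0 ea' eP2 eb' eQ2 er') eab).
  have Xt : map_poly (map_mpoly (tau t)) X = 0.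
    apply/polyP => k; rewrite coef_map coef0; apply/mpolyP => u.
    rewrite mcoeff_map_mpoly mcoeff0; apply: (tau_ker qmin ets) tts.
    by rewrite -mcoeff_map_mpoly -coef_map Xth coef0 mcoeff0.
  have eP2 := map_sq_grd (tau t) P'; have eQ2 := map_sq_grd (tau t) Q'.
  exact: (proj1 (map_bezout0 (h := map_mpoly (tau t)) erefl eP2 erefl eQ2 erefl) Xt).
move=> t tts n; rewrite -map_smul mcoeff_map_mpoly; apply/eqP; rewrite -subr_eq0 -rmorphB.
apply/eqP/(tau_ker qmin ets) => //; rewrite rmorphB map_smul eQ' -mcoeff_map_mpoly eP'.
apply/eqP; rewrite subr_eq0 -eQ; apply/eqP; rewrite !smulE; apply: eq_bigr => w _.
by rewrite /= f'E.
Qed.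

End ArithmeticData.

Lemma map_mpoly_qrat m (p : {mpoly rat[m]}) :
  map_mpoly (ratr : rat -> Cc) p = map_mpoly qval (map_mpoly qrat p).
Proof.
apply/mpolyP => u; transitivity (ratr p@_u : Cc); first exact: mcoeff_map_mpoly.
symmetry; transitivity (qval (map_mpoly qrat p)@_u); first exact: mcoeff_map_mpoly.
transitivity (qval (qrat p@_u)); last reflexivity.
by congr qval; exact: mcoeff_map_mpoly.
Qed.

Lemma eval_grs_subexp m (g : 'X_{1..m} -> Qb) (c : 'I_m -> Cc) :
  (forall i, cabs (c i) <= 1) ->
  (forall rho : Rr, 1 < rho -> exists C : Rr,
     forall n, cabs (qval (g n)) <= C * rho ^+ mdeg n) ->
  subexp (fun k => (map_mpoly qval (grs g k)).@[c]).
Proof.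
move=> c1 H; apply: subexp_le (subexp_grs c1 H) => k.
by rewrite -(map_grs qval).
Qed.

Lemma eval_cv_subexp m (c : 'I_m -> Cc) (s t : nat -> {mpoly Qb[m]}) :
  subexp (fun k => (map_mpoly qval (s k)).@[c]) ->
  subexp (fun k => (map_mpoly qval (t k)).@[c]) ->
  subexp (fun k => (map_mpoly qval (cv s t k)).@[c]).
Proof.
move=> Hs Ht; apply: subexp_le (subexp_cv Hs Ht) => k.
rewrite (cv_rmorph (map_mpoly qval)) (cv_rmorph (meval c)); exact: lexx.
Qed.

Lemma eval_poly_subexp m (c : 'I_m -> Cc) (a : {poly {mpoly Qb[m]}}) :
  subexp (fun k => (map_mpoly qval (sq a k)).@[c]).
Proof.
apply: (@subexp_eventually0 _ (size a)) => k ak.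
by rewrite /sq nth_default // !rmorph0.
Qed.

Section Norms.
Variables (m : nat) (ts : seq Qb).
Variables (Qt rt : Qb -> {mpoly Qb[m]}) (V : Qb -> nat -> {mpoly Qb[m]}).
Hypothesis HV : forall t, t \in ts -> forall k, cv (sq (grd (Qt t))) (V t) k = (rt t)%:P`_k.
Hypothesis Vp : forall t p, t \in ts -> prime p -> psub p (V t).
Hypothesis Ve : forall t c, t \in ts -> (forall i, cabs (c i) <= 1) ->
  subexp (fun k => (map_mpoly qval (V t k)).@[c]).

Lemma norm_series : exists W : nat -> {mpoly Qb[m]},
  [/\ forall k, cv (sq (grd (\prod_(t <- ts) Qt t))) W k = (\prod_(t <- ts) rt t)%:P`_k,
      forall p, prime p -> psub p W
    & forall c, (forall i, cabs (c i) <= 1) ->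
        subexp (fun k => (map_mpoly qval (W k)).@[c])].
Proof.
elim: ts HV Vp Ve => [|t l IH] HV' Vp' Ve'.
  exists (sq 1); split=> [k|p pp|c c1]; last 2 first.
  - exact: psub_poly.
  - exact: eval_poly_subexp.
  by rewrite !big_nil grd1 cv_sq mulr1.
have tl : t \in t :: l by rewrite mem_head.
have sl x : x \in l -> x \in t :: l by move=> xl; rewrite inE xl orbT.
have [|||W [HW Wp We]] := IH.
- by move=> x /sl; apply: HV'.
- by move=> x p /sl; apply: Vp'.
- by move=> x c /sl; apply: Ve'.
exists (cv (V t) W); split=> [k|p pp|c c1].
- rewrite !big_cons grdM -(cv_scalars (HV' t tl) HW k).
  apply: eq_cv => [i _|i _]; [exact: esym (cv_sq _ _ _)|reflexivity].
- by apply: psub_cv => //; [exact: Vp'|exact: Wp].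
- by apply: eval_cv_subexp; [exact: Ve'|exact: We].
Qed.

End Norms.

Lemma arithmetic_data (m : nat) (P Q : {mpoly Qb[m]}) (f : 'X_{1..m} -> Qb) :
  Q@_0 = 1 -> (forall n, smul Q f n = P@_n) ->
  (forall D, dvdr D P -> dvdr D Q -> D = (D@_0)%:MP) ->
  (forall eps : Rr, 0 < eps -> exists N0 : nat, forall N : nat,
    (N0 <= N)%N -> height_max (fun n => qval (f n)) N <= eps * N%:R) ->
  exists (G RR : {mpoly rat[m]}) (V : nat -> {mpoly rat[m]}),
  [/\ G@_0 = 1, dvdr Q (map_mpoly qrat G), RR != 0,
      forall k, cv (sq (grd G)) V k = RR%:P`_k
    & (forall p, prime p -> psub p (fun k => map_mpoly qrat (V k))) /\
      (forall c, (forall i, cabs (c i) <= 1) ->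
        subexp (fun k => (map_mpoly ratr (V k) : {mpoly Cc[m]}).@[c]))].
Proof.
move=> Q1 eQ cop hgt.
have [th [q [ts [P' [Q' [r' [a' [b' [f' [[qmin ets] [Q'1 eQ'] ef' [r0 Hbez] Hmul]]]]]]]]]] :=
  lifted_data Q1 eQ cop.
have hgt' : forall eps : Rr, 0 < eps -> exists N0 : nat, forall N : nat,
    (N0 <= N)%N -> height_max (fun n => qval (tau th (f' n))) N <= eps * N%:R.
  move=> eps e0; have [N0 HN0] := hgt eps e0; exists N0 => N NN.
  rewrite (_ : height_max _ N = height_max (fun n => qval (f n)) N); first exact: HN0.
  by apply: eq_bigr => n _; rewrite ef'.
have [D [D0 Dint Dgr]] := height_growth qmin ets hgt'.
pose Qt t := map_mpoly (tau t) Q'; pose rt t := map_mpoly (tau t) r'.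
pose V t k := cv (sq (map_poly (map_mpoly (tau t)) a')) (grs (tau t \o f')) k
  + (map_poly (map_mpoly (tau t)) b')`_k.
have HV t : t \in ts -> forall k, cv (sq (grd (Qt t))) (V t) k = (rt t)%:P`_k.
  by move=> tts; apply: (bezout_series (cv_grd (Hmul t tts)) (Hbez t tts)).
have Vp t p : t \in ts -> prime p -> psub p (V t).
  move=> tts pp; apply: psubD => //; last exact: psub_poly.
  apply: psub_cv => //; first exact: psub_poly.
  apply: psub_grs => // M M0.
  have [|C HC] := logn_growth pp (deg := fun n : 'X_{1..m} => mdeg n) D0 _ M0.
    by move=> rho /Dgr[C C0 HC]; exists C => // n; case: (HC n).
  exists C => n; apply: (pden_mono (HC n)).
  by apply: pden_scale => //; apply: Dint.
have Ve t c : t \in ts -> (forall i, cabs (c i) <= 1) ->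
    subexp (fun k => (map_mpoly qval (V t k)).@[c]).
  move=> tts c1.
  have Hg : subexp (fun k => (map_mpoly qval (grs (tau t \o f') k)).@[c]).
    apply: eval_grs_subexp => // rho /Dgr[C C0 HC]; exists C => n.
    by case: (HC n) => _; apply.
  have := subexpD (eval_cv_subexp (eval_poly_subexp c (map_poly (map_mpoly (tau t)) a')) Hg)
    (eval_poly_subexp c (map_poly (map_mpoly (tau t)) b')).
  by apply: subexp_le => k; rewrite /V !raddfD.
have [W [HW Wp We]] := norm_series HV Vp Ve.
have qm : q \is monic by case: qmin.
have tsu : uniq ts.
  by rewrite -separable_prod_XsubC -ets separable_map; apply: min_poly_separable qmin.
have [G eG] := norm_rat qm ets tsu Q'.
have [RR eR] := norm_rat qm ets tsu r'.
rewrite /Qt /rt eG eR in HW.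
have thts := th_conj qmin ets.
have qratI (p p' : {mpoly rat[m]}) : map_mpoly qrat p = map_mpoly qrat p' -> p = p'.
  move=> /mpolyP e; apply/mpolyP => u; apply: (fmorph_inj qrat).
  by rewrite -!mcoeff_map_mpoly e.
have G1 : G@_0 = 1.
  apply: (fmorph_inj qrat); rewrite rmorph1 -mcoeff_map_mpoly -eG.
  elim: (ts) => [|t l IH]; first by rewrite big_nil mcoeff1 eqxx.
  rewrite big_cons mcoeff0M IH mulr1 mcoeff_map_mpoly Q'1; exact: (rmorph1 (tau t)).
have gG0 : sq (grd G) 0%N = 1 by rewrite /sq grd0 G1.
(* [W] is a priori a series over [Qb]; the quotient computed over [rat] maps to it by uniqueness of
   division. *)
have [U HU] := cv_solve (sq RR%:P) gG0.
have eU k : map_mpoly qrat (U k) = W k.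
  have g0 : sq (grd (map_mpoly qrat G)) 0%N = 1.
    rewrite /sq grd0 mcoeff_map_mpoly G1 /= rmorph1; reflexivity.
  apply: (cv_inj (b := fun k => map_mpoly qrat (U k)) g0) => {}k.
  rewrite HW.
  transitivity (map_mpoly qrat (cv (sq (grd G)) U k)).
    rewrite (cv_rmorph (map_mpoly qrat)); apply: eq_cv => // i _.
    by rewrite /sq /= map_grd.
  by rewrite HU /sq !coefC; case: eqP => // _; rewrite rmorph0.
exists G, RR, U; split; [exact: G1| | |exact: HU|].
- rewrite -eG (big_rem th) //= eQ'; exact/dvdr_mulr/dvdr_refl.
(* If the norm vanished, some conjugate of [r'] would vanish, and with it the one at [th]. *)
- apply: contra_neq r0 => R0; have : \prod_(t <- ts) map_mpoly (tau t) r' == 0.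
    by rewrite eR R0 rmorph0.
  rewrite prodf_seq_eq0 => /hasP[t tts /=] /eqP /mpolyP rt0; apply/mpolyP => u.
  rewrite mcoeff_map_mpoly mcoeff0; apply: (tau_unit_ker qmin ets tts).
  by rewrite -mcoeff_map_mpoly rt0 mcoeff0.
split=> [p pp M M0|c c1].
  by have [C HC] := Wp p pp M M0; exists C => k u; rewrite eU; apply: HC.
apply: subexp_le (We c c1) => k; rewrite -eU.
by rewrite map_mpoly_qrat; exact: lexx.
Qed.

(** * Integrality of the denominator *)

Section Valuation.
Variable p : nat.
Hypothesis pp : prime p.

Local Notation pQ := (p%:R : rat).

Definition vge (e : int) (x : rat) : Prop :=
  exists (a : int) (b : nat), ~~ (p %| b)%N /\ x * b%:R = pQ ^ e * a%:~R.

Definition has_val (e : int) (x : rat) : Prop :=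
  exists (a : int) (b : nat),
    [/\ ~~ (p %| `|a|)%N, ~~ (p %| b)%N & x * b%:R = pQ ^ e * a%:~R].

Lemma pQ0 : pQ != 0. Proof. by rewrite pnatr_eq0 -lt0n prime_gt0. Qed.

Lemma ndvd_neq0 (b : nat) : ~~ (p %| b)%N -> (b%:R : rat) != 0.
Proof. by rewrite pnatr_eq0; apply: contra => /eqP->; rewrite dvdn0. Qed.

Lemma hasv_ex x : x != 0 -> exists e, has_val e x.
Proof.
move=> x0.
have [s cs es] := pfactor_coprime pp (n := `|numq x|) (ltac:(by rewrite absz_gt0 numq_eq0)).
have [t ct et] := pfactor_coprime pp (n := `|denq x|) (ltac:(by rewrite absz_gt0 denq_eq0)).
set i := logn p _ in es; set j := logn p _ in et.
exists (i%:Z - j%:Z), (Num.sg (numq x) * s%:Z), t.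
rewrite -!prime_coprime // abszM absz_sg numq_eq0 x0 mul1n; split=> //.
have t0 : (t%:R : rat) != 0 by apply: ndvd_neq0; rewrite -prime_coprime.
have dE : (denq x)%:~R = t%:R * pQ ^+ j :> rat.
  by rewrite -natrX -natrM -et -[RHS]/((`|denq x|%N : int)%:~R) absz_denq.
have nE : (numq x)%:~R = (Num.sg (numq x))%:~R * (s%:R * pQ ^+ i) :> rat.
  by rewrite -natrX -natrM -es -[X in _ * X]/((`|numq x|%N : int)%:~R) -intrM -intEsg.
rewrite -{1}[x]divq_num_den dE nE rmorphM /= expfzDr ?pQ0 // -exprnN.
rewrite invfM mulrACA -!exprnP.
by field; rewrite expf_neq0 ?pQ0 ?t0.
Qed.

(** Meaningful for nonzero arguments only, hence the separate treatment of zero coefficients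
    below. *)
Definition val_p (x : rat) : int := epsilon (inhabits 0) (fun e => has_val e x).

Lemma val_pP x : x != 0 -> has_val (val_p x) x.
Proof. by move/hasv_ex; apply: epsilon_spec. Qed.

Lemma vge0 e : vge e 0.
Proof. by exists 0, 1%N; rewrite Euclid_dvd1 // mul0r mulr0. Qed.

Lemma hasv_vge e x : has_val e x -> vge e x.
Proof. by case=> a [b [_ pb e1]]; exists a, b. Qed.

Lemma pQ_split e e' : e' <= e -> pQ ^ e = pQ ^ e' * pQ ^+ `|e - e'|%N.
Proof.
move=> le; rewrite exprnP -expfzDr ?pQ0 //; congr (_ ^ _).
by rewrite gez0_abs ?subr_ge0 //; ring.
Qed.

Lemma vge_mono e e' x : e' <= e -> vge e x -> vge e' x.
Proof.
move=> le [a [b [pb eb]]]; exists (p%:Z ^+ `|e - e'|%N * a), b; split=> //.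
by rewrite eb (pQ_split le) rmorphM rmorphXn /= -!mulrA.
Qed.

Lemma vgeD e x y : vge e x -> vge e y -> vge e (x + y).
Proof.
move=> [a [b [pb eb]]] [a' [b' [pb' eb']]]; exists (a * b'%:Z + a' * b%:Z), (b * b')%N.
rewrite Euclid_dvdM // negb_or pb; split=> //.
rewrite natrM rmorphD !rmorphM /= mulrDl mulrDr.
have -> : x * (b%:R * b'%:R) = pQ ^ e * a%:~R * b'%:R by rewrite -eb; ring.
have -> : y * (b%:R * b'%:R) = pQ ^ e * a'%:~R * b%:R by rewrite -eb'; ring.
by rewrite !mulrA.
Qed.

Lemma vgeN e x : vge e x -> vge e (- x).
Proof.
by move=> [a [b [pb eb]]]; exists (- a), b; rewrite mulNr eb rmorphN mulrN.
Qed.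

Lemma vge_sum e (I : Type) (r : seq I) (P : pred I) (F : I -> rat) :
  (forall i, P i -> vge e (F i)) -> vge e (\sum_(i <- r | P i) F i).
Proof. by move=> H; elim/big_rec: _ => [|i x Pi]; [exact: vge0|exact/vgeD/H]. Qed.

Lemma hasvM e e' x y : has_val e x -> has_val e' y -> has_val (e + e') (x * y).
Proof.
move=> [a [b [pa pb eb]]] [a' [b' [pa' pb' eb']]]; exists (a * a'), (b * b')%N.
rewrite abszM !Euclid_dvdM // !negb_or pb pa; split=> //.
by rewrite natrM mulrACA eb eb' expfzDr ?pQ0 // rmorphM /= mulrACA.
Qed.

Lemma hasv_ge e e' x : has_val e x -> vge e' x -> e' <= e.
Proof.
move=> [a [b [pa pb eb]]] [a' [b' [pb' eb']]]; rewrite leNgt; apply/negP => lt.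
have : pQ ^ e * (a%:~R * b'%:R) = pQ ^ e * (pQ ^+ `|e' - e|%N * (a'%:~R * b%:R)).
  transitivity (pQ ^ e' * a'%:~R * b%:R); last by rewrite (pQ_split (ltW lt)); ring.
  by rewrite mulrA -eb -eb'; ring.
move/(mulfI (expfz_neq0 _ pQ0)).
have n0 : (0 < `|e' - e|)%N by rewrite absz_gt0 subr_eq0 gt_eqF.
rewrite -(prednK n0) exprS -mulrA -[b'%:R]/(b'%:Z%:~R) -[b%:R]/(b%:Z%:~R).
rewrite -[pQ]/(p%:Z%:~R) -rmorphXn -!rmorphM => /intr_inj /(congr1 absz).
rewrite !abszM !absz_nat => eab.
have : (p %| `|a| * b')%N by rewrite eab dvdn_mulr.
by rewrite Euclid_dvdM // (negPf pa) (negPf pb').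
Qed.

Lemma hasv1 : has_val 0 1.
Proof. by exists 1, 1%N; rewrite Euclid_dvd1 // expr0z. Qed.

End Valuation.

Lemma rat_int_locally (x : rat) : (forall p, prime p -> vge p 0 x) -> x \is a Num.int.
Proof.
move=> H; have [d1|d1] := leqP `|denq x| 1.
  have {}d1 : denq x = 1.
    by have := denq_gt0 x; lia.
  by rewrite -[x]divq_num_den d1 divr1 intr_int.
exfalso; have pp := pdiv_prime d1; set p := pdiv _ in pp.
have [a [b [pb e]]] := H p pp.
have pd : (p %| `|denq x|)%N by apply: pdiv_dvd.
have : (`|numq x| * b)%N = (`|a| * `|denq x|)%N.
  apply/eqP; rewrite -abszM -[b]/(`|b%:Z|%N) -abszM; apply/eqP; congr absz.
  apply: (@intr_inj rat); rewrite !rmorphM /= numqE -[b%:Z%:~R]/(b%:R).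
  by rewrite mulrAC e expr0z mul1r.
move=> eq; have : (p %| `|numq x| * b)%N by rewrite eq dvdn_mull.
rewrite Euclid_dvdM // (negPf pb) orbF => pn.
have := coprime_num_den x; rewrite /coprime => /eqP g1.
have : (p %| gcdn `|numq x| `|denq x|)%N by rewrite dvdn_gcd pn.
by rewrite g1 dvdn1 => /eqP p1; rewrite p1 in pp.
Qed.

Lemma mnm_min n (P : 'X_{1..n} -> Prop) u : P u ->
  exists2 u0, P u0 & forall w, P w -> (u0 <= w)%O.
Proof.
elim/(@ltmwf n): u => u IH Pu.
case: (classic (exists2 w, P w & (w < u)%O)) => [[w Pw lt]|H]; first exact: IH lt Pw.
by exists u => // w Pw; rewrite leNgt; apply/negP => lt; apply: H; exists w.
Qed.

Lemma add_squeeze (x y a b : int) (i j k l : nat) :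
  a + k%:Z <= x + i%:Z -> b + l%:Z <= y + j%:Z -> x + y <= a + b -> (i + j = k + l)%N ->
  x + i%:Z = a + k%:Z /\ y + j%:Z = b + l%:Z.
Proof. by lia. Qed.

Lemma nat_squeeze (i k l : nat) : (k <= i)%N -> (i <= k + l)%N -> (l <= k + l - i)%N ->
  i = k /\ (k + l - i)%N = l.
Proof. by lia. Qed.

Section Fatou.
Variables (p m : nat).
Hypothesis pp : prime p.
Implicit Types (s : nat -> {mpoly rat[m]}) (u : 'X_{1..m}).

(* The Gauss valuation of [p]-adic series in [t] for which [t] has value [1/M], times [M]. *)
Definition wt (M : nat) s k u : int := M%:Z * val_p p (s k)@_u + k%:Z.

(** Weights are integers bounded below, so the minimum is attained. Breaking ties by the least [k]
    and then the least monomial singles out a leading term that behaves multiplicatively. *)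
Lemma wt_min M s k1 u1 (C : nat) : (s k1)@_u1 != 0 ->
  (forall k u, (s k)@_u != 0 -> - C%:Z <= wt M s k u) ->
  exists k0 u0, [/\ (s k0)@_u0 != 0,
    forall k u, (s k)@_u != 0 -> wt M s k0 u0 <= wt M s k u
    & forall k u, (s k)@_u != 0 -> wt M s k u = wt M s k0 u0 ->
        (k0 <= k)%N /\ (k = k0 -> (u0 <= u)%O)].
Proof.
move=> n1 HC.
pose P n := forall k u, (s k)@_u != 0 -> wt M s k u + C%:Z <> n%:Z.
have nP1 : ~ P `|(wt M s k1 u1 + C%:Z)%R|%N.
  by move/(_ k1 u1 n1); apply; rewrite gez0_abs // -lerBlDr sub0r HC.
have [n nP Pn] := ex_first nP1.
have [k2 [u2 [n2 e2]]] : exists k u, (s k)@_u != 0 /\ wt M s k u + C%:Z = n%:Z.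
  by apply: NNPP => H; apply: nP => k u nz e; apply: H; exists k, u.
have le k u : (s k)@_u != 0 -> n%:Z - C%:Z <= wt M s k u.
  move=> nz; rewrite lerBlDr leNgt; apply/negP => lt.
  have ge0 : 0 <= wt M s k u + C%:Z by rewrite -lerBlDr sub0r HC.
  have lt' : (`|(wt M s k u + C%:Z)%R| < n)%N by rewrite -ltz_nat gez0_abs.
  by apply: (Pn _ lt' k u nz); rewrite gez0_abs.
pose K k := forall u, (s k)@_u != 0 -> wt M s k u + C%:Z <> n%:Z.
have nK : ~ K k2 by move/(_ u2 n2); apply.
have [k0 nK0 HK] := ex_first nK.
have [u3 H3] : exists u, (s k0)@_u != 0 /\ wt M s k0 u + C%:Z = n%:Z.
  by apply: NNPP => H; apply: nK0 => u nz e; apply: H; exists u.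
have [u0 [n0 e0] H0] := mnm_min (P := fun u => (s k0)@_u != 0 /\ wt M s k0 u + C%:Z = n%:Z) H3.
have w0 : wt M s k0 u0 = n%:Z - C%:Z by rewrite -e0 addrK.
exists k0, u0; split=> // [k u nz|k u nz e]; first by rewrite w0 le.
have e' : wt M s k u + C%:Z = n%:Z by rewrite e w0 subrK.
split=> [|ek]; first by rewrite leqNgt; apply/negP => /HK/(_ u nz).
by apply: H0; rewrite -ek.
Qed.

Lemma psub_wt s M : psub p (fun k => map_mpoly qrat (s k)) -> (0 < M)%N ->
  exists C : nat, forall k u, (s k)@_u != 0 -> - C%:Z <= wt M s k u.
Proof.
move=> Hs M0; have [C HC] := Hs M M0; exists (M * C)%N => k u nz.
have := HC k u; rewrite mcoeff_map_mpoly => /pden_rat[b [pb xi]].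
set e := (C + k %/ M)%N in xi.
have : vge p (- e%:Z) (s k)@_u.
  exists (Num.floor ((p ^ e * b)%:R * (s k)@_u)), b; split=> //.
  rewrite floorK // natrM natrX -exprnN mulrA mulrA mulVf ?expf_neq0 ?pQ0 //.
  by rewrite mul1r mulrC.
move/(hasv_ge pp (val_pP pp nz)) => ge.
rewrite /wt; have := leq_trunc_div k M; rewrite /e in ge; nia.
Qed.

(** If a coefficient of [G] had negative valuation, the leading term of [G] would sit at a positive
    degree. Its product with the leading term of [V] would be the only summand of least valuation in
    a coefficient of [G V] of positive degree in [t], yet that coefficient is 0. *)
Lemma fatou_vge (G RR : {mpoly rat[m]}) (V : nat -> {mpoly rat[m]}) :
  G@_0 = 1 -> RR != 0 -> (forall k, cv (sq (grd G)) V k = RR%:P`_k) ->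
  psub p (fun k => map_mpoly qrat (V k)) -> forall u, vge p 0 G@_u.
Proof.
move=> G1 R0 HV Vp u; have [->|gu0] := eqVneq G@_u 0; first exact: vge0.
apply: NNPP => nvge.
have gv := val_pP pp gu0.
have vlt : val_p p G@_u < 0.
  by rewrite ltNge; apply/negP => ge; apply: nvge; apply: vge_mono ge (hasv_vge gv).
(* For this [M] the weight at [u] is at most [- M + mdeg u = -1], below the weight 0 of the constant
   term. *)
pose M := (mdeg u).+1; pose g := sq (grd G).
have gE k w : (g k)@_w = G@_w *+ (mdeg w == k) by rewrite /g /sq mcoeff_grd.
have gp : psub p (fun k => map_mpoly qrat (g k)).
  move=> N N0; have [C HC] := psub_poly pp (grd (map_mpoly qrat G)) N0.
  by exists C => k w; have := HC k w; rewrite /sq map_grd.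
have [Cg HCg] := psub_wt gp (ltn0Sn (mdeg u)).
have [CV HCV] := psub_wt Vp (ltn0Sn (mdeg u)).
have ng : (g (mdeg u))@_u != 0 by rewrite gE eqxx.
have [kg [ug [nzg ming lexg]]] := wt_min ng HCg.
have V0 : V 0%N = RR.
  have := HV 0%N; rewrite cv_recl big_ord0 addr0 coefC eqxx.
  by rewrite /sq grd0 G1 mul1r.
have [uV nV] : exists w, (V 0%N)@_w != 0.
  apply: NNPP => H; case/eqP: R0; apply/mpolyP => w; rewrite mcoeff0 -V0.
  by apply/eqP; apply: contraT => nz; case: H; exists w.
have [kv [uv [nzv minv lexv]]] := wt_min nV HCV.
have kg0 : (0 < kg)%N.
  rewrite lt0n; apply: contraTneq (ming _ _ ng) => k0.
  have eug : ug = 0%MM.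
    move: nzg; rewrite gE k0 mdeg_eq0; case: (eqVneq ug 0%MM) => // _; rewrite mulr0n eqxx.
  have v1 : val_p p 1 = 0.
    apply/eqP; rewrite eq_le.
    rewrite (hasv_ge pp (hasv1 pp) (hasv_vge (val_pP pp (oner_neq0 rat)))).
    exact: (hasv_ge pp (val_pP pp (oner_neq0 rat)) (hasv_vge (hasv1 pp))).
  rewrite -ltNge /wt k0 eug !gE mdeg0 !eqxx !mulr1n G1 v1 mulr0 addr0.
  by move: (val_p p _) vlt => x x0; nia.
have HK : (cv g V (kg + kv))@_(ug + uv)%MM = 0.
  by rewrite /g HV coefC addn_eq0 (gtn_eqF kg0) mcoeff0.
have hv := hasvM pp (val_pP pp nzg) (val_pP pp nzv).
set e0 := val_p p (g kg)@_ug in hv; set e1 := val_p p (V kv)@_uv in hv.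
suff : vge p (e0 + e1 + 1) ((g kg)@_ug * (V kv)@_uv).
  by move/(hasv_ge pp hv); lia.
have lt1 : (kg < (kg + kv).+1)%N by lia.
have lt2 : (mdeg ug < (mdeg (ug + uv)%MM).+1)%N by rewrite mdegD; lia.
have le2 : (ug <= ug + uv)%MM by apply: lem_addr.
move: HK; rewrite /cv raddf_sum /=.
under eq_bigr => i _ do rewrite (mcoeff_poly_mul_lin _ _ (ltnSn _)).
rewrite pair_big_dep /= (bigD1 (Ordinal lt1, BMultinom lt2)) //=.
have ev : (ug + uv - ug)%MM = uv by rewrite addmC addmK.
rewrite addKn ev => /eqP; rewrite addr_eq0 => /eqP ->.
apply: vgeN; apply: (vge_sum pp) => -[i w] /= /andP[lew ne].
have [->|nz1] := eqVneq (g i)@_w 0; first by rewrite mul0r; exact: vge0.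
have [->|nz2] := eqVneq (V (kg + kv - i)%N)@_(ug + uv - w)%MM 0.
  by rewrite mulr0; exact: vge0.
have h12 := hasvM pp (val_pP pp nz1) (val_pP pp nz2).
apply: (vge_mono pp _ (hasv_vge h12)).
have w1 := ming _ _ nz1; have w2 := minv _ _ nz2.
have ik : (i <= kg + kv)%N by rewrite -ltnS.
rewrite leNgt; apply/negP => lt.
(* A competing summand of no larger valuation has both factors of minimal weight, because the
   degrees have the same sum; the tie-breaking rules then identify it with the leading product. *)
have {lt}v12 : val_p p (g i)@_w + val_p p (V (kg + kv - i)%N)@_(ug + uv - w)%MM <= e0 + e1.
  by rewrite -ltzD1.
rewrite /wt -/e0 -/e1 in w1 w2 lexg lexv.
have [eq1 eq2] : M%:Z * val_p p (g i)@_w + (i : nat)%:Z = M%:Z * e0 + kg%:Z /\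
    M%:Z * val_p p (V (kg + kv - i)%N)@_(ug + uv - w)%MM + (kg + kv - i)%N%:Z
      = M%:Z * e1 + kv%:Z.
  have M0 : (0 : int) <= M%:Z by [].
  have := ler_wpM2l M0 v12; rewrite !mulrDr => le.
  exact: (add_squeeze w1 w2 le (subnKC ik)).
have [k1 u1] := lexg _ _ nz1 eq1; have [k2 u2] := lexv _ _ nz2 eq2.
have [ei ej] := nat_squeeze k1 ik k2.
have {}u1 := u1 ei; have {}u2 := u2 ej.
case/negP: ne; apply/eqP; congr pair; apply: val_inj => //=.
apply/eqP; rewrite eq_le u1 andbT leNgt; apply/negP => lt.
have := ltmc_le_add lt u2; rewrite [(w + _)%MM]addmC submK // ltxx.
by [].
Qed.
End Fatou.

Lemma fatou_int m (G RR : {mpoly rat[m]}) (V : nat -> {mpoly rat[m]}) :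
  G@_0 = 1 -> RR != 0 -> (forall k, cv (sq (grd G)) V k = RR%:P`_k) ->
  (forall p, prime p -> psub p (fun k => map_mpoly qrat (V k))) ->
  exists H : {mpoly int[m]}, map_mpoly intr H = G.
Proof.
move=> G1 R0 HV Vp.
have Gi u : G@_u \is a Num.int.
  by apply: rat_int_locally => p pp; apply: (fatou_vge pp G1 R0 HV (Vp p pp)).
exists (\sum_(u <- msupp G) Num.floor G@_u *: 'X_[u]).
rewrite raddf_sum [RHS]mpolyE; apply: eq_bigr => u _ /=.
by rewrite map_mpolyZ map_mpolyX /= floorK.
Qed.

(** * Power sums as a logarithmic derivative *)

Section Euler.
Variables (m : nat) (R : comNzRingType).
Implicit Types (X Y : {mpoly R[m]}) (j : 'I_m).

Definition eul j X : {mpoly R[m]} := 'X_j * X^`M(j).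

Lemma mcoeff_eul j X u : (eul j X)@_u = X@_u *+ u j.
Proof.
rewrite /eul; have [uj|uj] := posnP (u j).
  rewrite uj mulr0n (mcoeff_poly_mul_lin _ _ (ltnSn _)) big1 // => w /mnm_lepP lew.
  rewrite mcoeffX; case: eqP; rewrite ?mul0r // => ew.
  by have := lew j; rewrite -ew mnm1E eqxx uj.
have eu : u = (U_(j) + (u - U_(j)))%MM.
  by rewrite addmC submK //; apply/mnm_lepP => i; rewrite mnm1E; case: eqP => // <-.
rewrite [in LHS]eu mulrC mcoeffMX mcoeff_mderiv.
have -> : (u - U_(j) + U_(j))%MM = u by rewrite addmC -eu.
by rewrite mnmBE mnm1E eqxx subn1 prednK.
Qed.

Lemma eulD j X Y : eul j (X + Y) = eul j X + eul j Y.
Proof. by rewrite /eul mderivD mulrDr. Qed.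

Lemma eulN j X : eul j (- X) = - eul j X.
Proof. by rewrite /eul mderivN mulrN. Qed.

Lemma eulM j X Y : eul j (X * Y) = eul j X * Y + X * eul j Y.
Proof. by rewrite /eul mderivM; ring. Qed.

End Euler.

Section Derivations.
Variable A : comNzRingType.
Implicit Types (a b : nat -> A).

Definition dser a : nat -> A := fun k => a k *+ k.

Lemma dserM a b k : dser (cv a b) k = cv (dser a) b k + cv a (dser b) k.
Proof.
rewrite /dser /cv -sumrMnl -big_split /=; apply: eq_bigr => i _.
have ik : (i <= k)%N by rewrite -ltnS.
by rewrite mulrnAl mulrnAr -mulrnDr subnKC.
Qed.

Variable E : A -> A.
Hypotheses (ED : forall x y, E (x + y) = E x + E y) (EN : forall x, E (- x) = - E x).
Hypothesis EM : forall x y, E (x * y) = E x * y + x * E y.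

Lemma der0 : E 0 = 0. Proof. by apply: (addIr (E 0)); rewrite -ED !add0r. Qed.

Lemma der_Mn x n : E (x *+ n) = E x *+ n.
Proof. by elim: n => [|n IH]; rewrite ?mulr0n ?der0 // !mulrS ED IH. Qed.

Lemma der_sum (I : Type) (r : seq I) (F : I -> A) :
  E (\sum_(i <- r) F i) = \sum_(i <- r) E (F i).
Proof. exact: (big_morph E ED der0). Qed.

Lemma der_cv a b k : E (cv a b k) = cv (E \o a) b k + cv a (E \o b) k.
Proof. by rewrite /cv der_sum -big_split; apply: eq_bigr => i _; rewrite EM. Qed.

(** Here [p = - t g' / g] and [q = - E g / g]; both sides are the same mixed logarithmic derivative,
    because [E] and [t d/dt] commute. *)
Lemma log_derivative_comm (g p q : nat -> A) : g 0%N = 1 ->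
  (forall k, cv g p k = - dser g k) -> (forall k, cv g q k = - E (g k)) ->
  forall k, E (p k) = q k *+ k.
Proof.
move=> g0 Hp Hq; apply: (cv_inj (b := E \o p) (c := dser q) g0) => k.
have e1 : cv g (E \o p) k = - E (g k) *+ k - cv (E \o g) p k.
  by apply/(canRL (addrK _)); rewrite addrC -der_cv Hp EN /dser der_Mn mulNrn.
have e2 : cv g (dser q) k = - E (g k) *+ k - cv (dser g) q k.
  by apply/(canRL (addrK _)); rewrite addrC -dserM /dser Hq.
rewrite e1 e2; congr (_ - _).
have n1 i : (E \o g) i = - cv g q i by rewrite Hq opprK.
have n2 i : dser g i = - cv g p i by rewrite Hp opprK.
transitivity (- cv (cv g q) p k).
  by rewrite cvC (eq_cv (a' := p) (b' := fun i => - cv g q i)) // cvNr cvC.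
rewrite [RHS]cvC (eq_cv (a := q) (a' := q) (b' := fun i => - cv g p i)) // cvNr; congr (- _).
rewrite -cvA [RHS]cvC -cvA; apply: eq_cv => // i _; exact: cvC.
Qed.

End Derivations.

Lemma mulrn_int_inj (x : int) (a b : nat) : x != 0 -> x *+ a = x *+ b -> a = b.
Proof.
by move=> x0; rewrite -(mulr_natr x a) -(mulr_natr x b) => /(mulfI x0)/eqP; rewrite eqr_nat => /eqP.
Qed.

Lemma mulrn_int_dvd (x y : int) (a k : nat) : x *+ a = y *+ k -> (k %| `|x| * a)%N.
Proof.
rewrite -(mulr_natr x a) -(mulr_natr y k) => /(congr1 absz); rewrite !abszM !natz !absz_nat => ->.
exact: dvdn_mull.
Qed.

Section PowerSums.
Variables (m : nat) (H : {mpoly int[m]}) (p : nat -> {mpoly int[m]}).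
Hypothesis H1 : H@_0 = 1.
Hypothesis Hp : forall k, cv (sq (grd H)) p k = - dser (sq (grd H)) k.

Let g0 : sq (grd H) 0%N = 1. Proof. by rewrite /sq grd0 H1. Qed.

Lemma partial_power_sums (j : 'I_m) : exists q : nat -> {mpoly int[m]},
  (forall k, cv (sq (grd H)) q k = - eul j (sq (grd H) k)) /\
  forall k u, (p k)@_u *+ u j = (q k)@_u *+ k.
Proof.
have [q Hq] := cv_solve (fun k => - eul j (sq (grd H) k)) g0.
exists q; split=> // k u.
have := log_derivative_comm (@eulD m int j) (@eulN m int j) (@eulM m int j) g0 Hp Hq k.
by move/(congr1 (mcoeff u)); rewrite mcoeff_eul mcoeffMn.
Qed.

(** The sum of the operators [eul j] multiplies the part of degree [k] by [k], so the partial series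
    [q j] add up to [p]. Summing [p_u u_j = k q_u] over [j] then gives [p_u |u| = k p_u]. *)
Lemma power_sum_homog k u : (p k)@_u != 0 -> mdeg u = k.
Proof.
move=> nz; have Hq j := partial_power_sums j.
pose q j := proj1_sig (constructive_indefinite_description _ (Hq j)).
have qP j : (forall k, cv (sq (grd H)) (q j) k = - eul j (sq (grd H) k)) /\
  forall k u, (p k)@_u *+ u j = (q j k)@_u *+ k.
  exact: proj2_sig (constructive_indefinite_description _ (Hq j)).
have pq i : p i = \sum_j q j i.
  apply: (cv_inj (b := p) (c := fun i => \sum_j q j i) g0) => {}i.
  transitivity (\sum_j cv (sq (grd H)) (q j) i); last first.
    by rewrite /cv exchange_big; apply: eq_bigr => l _; rewrite mulr_sumr.
  rewrite Hp /dser; under eq_bigr do rewrite (proj1 (qP _)).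
  rewrite sumrN; congr (- _); apply/mpolyP => w.
  rewrite mcoeffMn raddf_sum /=; under eq_bigr do rewrite mcoeff_eul.
  rewrite sumrMnr -mdegE /sq mcoeff_grd.
  by case: eqP => [->|] //; rewrite !mul0rn.
have : (p k)@_u *+ mdeg u = (p k)@_u *+ k.
  rewrite mdegE -sumrMnr; under eq_bigr do rewrite (proj2 (qP _)).
  by rewrite sumrMnl pq raddf_sum.
exact: mulrn_int_inj.
Qed.

Lemma power_sum_dvd u (j : 'I_m) :
  (mdeg u %| `|(p (mdeg u))@_u| * u j)%N.
Proof.
have [q [_ Hq]] := partial_power_sums j.
exact: mulrn_int_dvd (Hq (mdeg u) u).
Qed.

End PowerSums.

(** * Power sums are bounded *)

Section OneVariable.
Implicit Types (g h f : {poly Cc}) (z : Cc).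

(** Divide the root out: with [g = h (X - z)], the series [y = h v] satisfies [(X - z) y = r], so
    [y_k = - r / z^(k+1)], which is not subexponential when [|z| < 1]. *)
Lemma subexp_root_ge1 g (v : nat -> Cc) (r z : Cc) : g`_0 = 1 -> r != 0 ->
  (forall k, cv (sq g) v k = r%:P`_k) -> subexp v -> root g z -> 1 <= cabs z.
Proof.
move=> g0 r0 Hv vs rz; rewrite leNgt; apply/negP => z1.
have z0 : z != 0.
  by apply: contraTneq rz => ->; rewrite rootE horner_coef0 g0 oner_eq0.
have /factor_theorem[h eg] := rz.
pose y := cv (sq h) v.
have ys : subexp y.
  apply: subexp_cv => //; apply: (@subexp_eventually0 _ (size h)) => k hk.
  by rewrite /sq nth_default.
have ey k : cv (sq ('X - z%:P)) y k = r%:P`_k.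
  by rewrite -Hv /y cvA; apply: eq_cv => // i _; rewrite cv_sq mulrC eg.
have yE k : y k * z ^+ k.+1 = - r.
  elim: k => [|k IH].
    have := ey 0%N; rewrite /cv big_ord1 /sq coefB coefX coefC sub0r coefC eqxx => <-.
    by rewrite mulNr opprK expr1 mulrC.
  have := ey k.+1; rewrite /cv !big_ord_recl big1 => [|i _]; last first.
    by rewrite /sq coefB coefX coefC subrr mul0r.
  rewrite /sq !coefB !coefX !coefC /= sub0r subr0 mul1r addr0 subn0 subSS subn0.
  move/eqP; rewrite mulNr addrC subr_eq0 => /eqP e.
  by rewrite exprS mulrA [y k.+1 * z]mulrC -e IH.
have x0 : 0 < cabs z.
  rewrite lt_neqAle cabs_ge0 andbT eq_sym; apply: contra z0 => /eqP e.
  by apply/eqP; apply: ComplexField.Normc.eq0_normc.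
have rr0 : 0 < cabs r.
  rewrite lt_neqAle cabs_ge0 andbT eq_sym; apply: contra r0 => /eqP e.
  by apply/eqP; apply: ComplexField.Normc.eq0_normc.
have xi : 1 < (cabs z)^-1 by rewrite invf_gt1.
(* As [rho^2 |z| = 1], growth of [y] at rate at most [rho] would keep [|r| rho^k] bounded. *)
have [rho1 rho2] := sqrt_gt1 xi; set rho := Num.sqrt _ in rho1 rho2.
have [C HC] := ys _ rho1; have C0 := subexp_ge0 HC.
have rho0 : 0 < rho by rewrite (lt_trans _ rho1).
have xr : rho * cabs z * rho = 1 by rewrite mulrAC -expr2 rho2 mulVf ?gt_eqF.
have key k : cabs r * rho ^+ k <= C.
  have -> : cabs r = cabs (y k) * cabs z ^+ k.+1.
    by rewrite -cabsXn -cabsM yE cabsN.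
  apply: (@le_trans _ _ (C * rho ^+ k * cabs z ^+ k * rho ^+ k)); last first.
    by rewrite -!mulrA -!exprMn mulrA xr expr1n mulr1.
  apply: ler_wpM2r; first by rewrite exprn_ge0 // ltW.
  apply: (@le_trans _ _ (cabs (y k) * cabs z ^+ k)).
    apply: ler_wpM2l; first exact: cabs_ge0.
    by rewrite exprS ler_piMl ?exprn_ge0 ?cabs_ge0 // ltW.
  by apply: ler_wpM2r; rewrite ?exprn_ge0 ?cabs_ge0.
have d0 : 0 < cabs r * (rho - 1) by rewrite mulr_gt0 // subr_gt0.
have := archi_boundP (divr_ge0 C0 (ltW d0)); set K := Num.bound _.
rewrite ltr_pdivrMr // => ltC; have := key K; rewrite leNgt => /negP; apply.
apply: lt_le_trans ltC _; apply: (@le_trans _ _ (cabs r * (1 + K%:R * (rho - 1)))).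
  rewrite mulrCA; apply: ler_wpM2l; first exact: ltW.
  by rewrite lerDr.
apply: ler_wpM2l; first exact: ltW.
have := bernoulli K (ltW (_ : 0 < rho - 1)); rewrite subr_gt0 => /(_ rho1).
by rewrite [1 + (rho - 1)]addrC subrK.
Qed.

(** [P k] is the sum of the [w ^+ k], except that [P 0 = 0], because [- X g'] has no constant
    term. *)
Lemma power_sums_bound (ws : seq Cc) : (forall w, w \in ws -> cabs w <= 1) ->
  let g := \prod_(w <- ws) (1 - w *: 'X) in
  exists P, (forall k, cv (sq g) P k = - (g`_k *+ k)) /\
    forall k, cabs (P k) <= (size ws)%:R.
Proof.
have dE (a : {poly Cc}) k : ('X * a^`())`_k = a`_k *+ k.
  by rewrite coefXM coef_deriv; case: k.
elim: ws => [|w ws IH] Hw /=.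
  exists (fun=> 0); split=> k; last by rewrite cabs0.
  by rewrite cv0r big_nil coef1; case: k => [|k]; rewrite ?mulr0n ?mul0rn oppr0.
have [|P [HP BP]] := IH; first by move=> x xs; apply: Hw; rewrite inE xs orbT.
set h := \prod_(w <- ws) _ in HP; pose a : {poly Cc} := 1 - w *: 'X.
pose S k : Cc := if k is k'.+1 then w ^+ k else 0.
have HS k : cv (sq a) S k = (- ('X * a^`()))`_k.
  have a0 : a`_0 = 1 by rewrite coefB coef1 coefZ coefX mulr0 subr0.
  have a1 : a`_1 = - w by rewrite coefB coef1 coefZ coefX mulr1 sub0r.
  have a2 i : a`_i.+2 = 0 by rewrite coefB coef1 coefZ coefX mulr0 subr0.
  rewrite coefN dE; case: k => [|[|k]].
  - by rewrite /cv big_ord1 /= mulr0 mulr0n oppr0.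
  - by rewrite /cv !big_ord_recl big_ord0 /sq /= a0 a1 expr1 mulr0 addr0 mul1r addr0 mulr1n opprK.
  rewrite a2 mul0rn oppr0 /cv 2!big_ord_recl /sq /= a0 a1 big1 => [|i _].
    by rewrite /bump /= subn0 mul1r addr0 mulNr -exprS subrr.
  by rewrite a2 mul0r.
exists (fun k => P k + S k); split=> k; last first.
  apply: le_trans (cabsD _ _) _; rewrite /= -natr1; apply: lerD => //.
  case: k => [|k]; first by rewrite [S 0%N]/(0 : Cc) cabs0.
  by rewrite [S k.+1]/(w ^+ k.+1) cabsXn exprn_ile1 ?cabs_ge0 // Hw // mem_head.
rewrite big_cons -/h -/a -dE cvDr.
have HP' i : cv (sq h) P i = sq (- ('X * h^`())) i by rewrite HP /sq coefN dE.
have cvM (x y : {poly Cc}) s i : cv (sq (x * y)) s i = cv (sq x) (cv (sq y) s) i.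
  by rewrite cvA; apply: eq_cv => // l _; rewrite cv_sq.
rewrite cvM (eq_cv (a' := sq a) (b' := sq (- ('X * h^`())))) // cv_sq.
rewrite [a * h]mulrC cvM (eq_cv (a' := sq h) (b' := sq (- ('X * a^`())))) // cv_sq.
rewrite -coefD -coefN; congr (nth _ (polyseq _) _); rewrite derivM; ring.
Qed.

Lemma log_derivative_bound g (v P : nat -> Cc) (r : Cc) : g`_0 = 1 -> r != 0 ->
  (forall k, cv (sq g) v k = r%:P`_k) -> subexp v ->
  (forall k, cv (sq g) P k = - (g`_k *+ k)) ->
  forall k, cabs (P k) <= (size g)%:R.
Proof.
move=> g0 r0 Hv vs HP k.
have gn0 : g != 0 by apply: contra_eq_neq g0 => ->; rewrite coef0 eq_sym oner_eq0.
have [rs ers] := closed_field_poly_normal g.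
have lg : lead_coef g != 0 by rewrite lead_coef_eq0.
have sz : size rs = (size g).-1 by rewrite ers size_scale // size_prod_XsubC.
have rs0 z : z \in rs -> z != 0.
  move=> zrs; apply: contraTneq isT => z0; have : root g z.
    by rewrite ers rootZ // root_prod_XsubC.
  by rewrite rootE z0 horner_coef0 g0 oner_eq0.
have eg : g = \prod_(w <- map GRing.inv rs) (1 - w *: 'X).
  have E : \prod_(z <- rs) ('X - z%:P) =
      (\prod_(z <- rs) (- z))%:P * \prod_(w <- map GRing.inv rs) (1 - w *: 'X).
    rewrite big_map rmorph_prod -big_split /= [LHS]big_seq [RHS]big_seq.
    apply: eq_bigr => z /rs0 z0.
    transitivity (- z%:P + (z / z)%:P * 'X); first by rewrite mulfV // mul1r addrC.
    by rewrite -mul_polyC polyCN polyCM; ring.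
  move: ers; rewrite E -mul_polyC mulrA -polyCM; move: (lead_coef g * _) => c ers.
  have c1 : c = 1.
    move: g0; rewrite ers coefCM.
    suff e1 : (\prod_(w <- map GRing.inv rs) (1 - w *: 'X))`_0 = 1.
      by rewrite e1 mulr1; exact.
    rewrite -horner_coef0 horner_prod; apply: big1 => w _.
    by rewrite hornerD hornerN hornerZ hornerX hornerC mulr0 subr0.
  by rewrite {1}ers c1 mul1r.
have [|P' [HP' BP']] := @power_sums_bound (map GRing.inv rs).
  move=> _ /mapP[z zrs ->]; have z1 : 1 <= cabs z.
    apply: (subexp_root_ge1 g0 r0 Hv vs).
    by rewrite ers rootZ // root_prod_XsubC.
  rewrite [cabs _]ComplexField.Normc.normcV -/(cabs z) invf_le1 //.
  by rewrite (lt_le_trans ltr01).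
rewrite -eg in HP'; have g0' : sq g 0%N = 1 by [].
have <- : P' k = P k by apply: (cv_inj g0') => i; rewrite HP HP'.
by apply: le_trans (BP' k) _; rewrite size_map sz ler_nat leq_pred.
Qed.

End OneVariable.

(** * Coefficient bounds from values on the polydisc *)

Lemma primitive_root_ex N : (0 < N)%N -> exists w : Cc, N.-primitive_root w.
Proof.
move=> N0; have [r Dp] := closed_field_poly_normal ('X^N - 1 : {poly Cc}).
rewrite (monicP (monicXnsubC 1 N0)) scale1r in Dp.
have rn1 : all N.-unity_root r by apply/allP => z; rewrite -root_prod_XsubC -Dp.
have sz_r : (N < (size r).+1)%N.
  by rewrite -(size_prod_XsubC r id) -Dp size_XnsubC.
have [|w] := hasP (has_prim_root N0 rn1 _ sz_r); last by exists w.
by rewrite -separable_prod_XsubC -Dp separable_Xn_sub_1 // pnatr_eq0 -lt0n.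
Qed.

Lemma cabs_real (x : Rr) : 0 <= x -> cabs (x%:C)%C = x.
Proof. by move=> x0; rewrite /cabs /= expr0n addr0 sqrtr_sqr ger0_norm. Qed.

Lemma cabs_int (z : int) : cabs z%:~R = (`|z|%N)%:R.
Proof.
by case: z => n; rewrite ?NegzE ?rmorphN /= ?cabsN ?abszN ?cabs_nat.
Qed.

Lemma cabs_primitive_root N (w : Cc) : N.-primitive_root w -> cabs w = 1.
Proof.
move=> wN; have N0 := prim_order_gt0 wN.
apply/eqP; rewrite -(@eqrXn2 _ N) ?cabs_ge0 // expr1n -cabsXn prim_expr_order //.
by rewrite cabs1.
Qed.

Lemma bernoulli_sub (x : Rr) n : 0 <= x <= 1 -> 1 - n%:R * x <= (1 - x) ^+ n.
Proof.
case/andP=> x0 x1; elim: n => [|n IH]; first by rewrite mul0r subr0 expr0.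
rewrite exprS; apply: (@le_trans _ _ ((1 - x) * (1 - n%:R * x))).
  rewrite -subr_ge0 (_ : _ - _ = n%:R * x ^+ 2); last by rewrite -natr1; ring.
  by rewrite mulr_ge0 ?ler0n ?exprn_ge0.
by rewrite ler_wpM2l // subr_ge0.
Qed.

Lemma sum_prim_root N (w : Cc) j : N.-primitive_root w ->
  \sum_(i < N) (w ^+ j) ^+ i = if (N %| j)%N then N%:R else 0.
Proof.
move=> wN; rewrite (prim_order_dvd wN); case: eqP => [->|/eqP nj].
  by under eq_bigr do rewrite expr1n; rewrite sumr_const card_ord.
have := subrX1 (w ^+ j) N; rewrite -exprM mulnC exprM (prim_expr_order wN) expr1n subrr.
by move/esym/eqP; rewrite mulf_eq0 subr_eq0 (negPf nj) => /eqP.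
Qed.

(** Among the infinitely many radii [1 - 1 / (2 N + i)] one avoids the zeros of [bad] in all [N]
    directions at once; by Bernoulli's inequality their [N]-th powers are at least [1/2]. *)
Lemma generic_radius N (bad : {poly Cc}) (w : Cc) : (0 < N)%N -> w != 0 -> bad != 0 ->
  exists s : Rr, [/\ 0 <= s <= 1, 2^-1 <= s ^+ N &
    forall j, (j < N)%N -> bad.[w ^+ j * (s%:C)%C] != 0].
Proof.
move=> N0 w0 b0; pose x i : Rr := ((2 * N + i)%N%:R)^-1; pose s i := 1 - x i.
have D0 i : 0 < (2 * N + i)%N%:R :> Rr by rewrite ltr0n; lia.
have x01 i : 0 <= x i <= 1.
  by rewrite invr_ge0 ltW //= invf_le1 // ler1n; lia.
pose BAD := \prod_(j < N) (bad \Po (w ^+ j *: 'X)).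
have B0 : BAD != 0.
  apply/prodf_neq0 => j _; rewrite -size_poly_eq0 size_comp_poly2 ?size_poly_eq0 //.
  by rewrite size_scale ?size_polyX // expf_neq0.
have [i Hi] : exists i, ~~ root BAD (s i)%:C%C.
  apply: NNPP => H; have := max_poly_roots B0 (rs := [seq (s i)%:C%C | i <- iota 0 (size BAD)]).
  rewrite size_map size_iota ltnn => K; suff : false by []. apply: K.
    apply/allP => _ /mapP[i _ ->]; apply: contraT => nr; by case: H; exists i.
  rewrite map_inj_uniq ?iota_uniq // => i j /complexI /addrI /oppr_inj /invr_inj /eqP.
  by rewrite eqr_nat eqn_add2l => /eqP.
exists (s i); split.
- by have /andP[a b] := x01 i; rewrite /s; apply/andP; split; lra.
- apply: le_trans (bernoulli_sub N (x01 i)).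
  have : N%:R * x i <= 2^-1.
    rewrite ler_pdivrMr // mulrC ler_pdivlMr ?ltr0n // -natrM ler_nat; lia.
  by lra.
move=> j jN; apply: contra Hi => /eqP e.
rewrite rootE /BAD horner_prod (bigD1 (Ordinal jN)) //= horner_comp hornerZ hornerX e.
by rewrite mul0r.
Qed.

(** Cauchy's estimate, with the integral replaced by a mean over [N]-th roots of unity, which is
    exact since [N] exceeds the degree of [f]. The factor 2 undoes [s ^+ l]. *)
Lemma coef_bound (f bad : {poly Cc}) (B : Rr) : bad != 0 ->
  (forall z, cabs z <= 1 -> bad.[z] != 0 -> cabs f.[z] <= B) ->
  forall l, cabs f`_l <= 2 * B.
Proof.
move=> b0 Hf l; pose N := maxn (size f) l.+1.
have lN : (l < N)%N by rewrite /N; lia.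
have sN : (size f <= N)%N by rewrite /N; lia.
have N0 : (0 < N)%N by apply: leq_ltn_trans lN.
have [w wN] := primitive_root_ex N0; have cw := cabs_primitive_root wN.
have w0 : w != 0 by apply: contra_eq_neq cw => ->; rewrite cabs0 eq_sym oner_eq0.
have [s [/andP[s0 s1] sN2 Hs]] := generic_radius N0 w0 b0.
pose z j : Cc := w ^+ j * (s%:C)%C.
have E : \sum_(j < N) f.[z j] * (w ^+ (N - l)) ^+ j = N%:R * (f`_l * (s%:C)%C ^+ l).
  under eq_bigr => j _ do rewrite (horner_coef_wide _ sN) mulr_suml.
  rewrite exchange_big /= (bigD1 (Ordinal lN)) //= [X in _ + X]big1 ?addr0 => [|i ni].
    transitivity (\sum_(j < N) f`_l * (s%:C)%C ^+ l * (w ^+ (l + (N - l))) ^+ j).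
      by apply: eq_bigr => j _; rewrite /z exprMn -!exprM mulnDl exprD [(j * l)%N]mulnC; ring.
    by rewrite -mulr_sumr (sum_prim_root _ wN) subnKC ?(ltnW lN) // dvdnn mulrC.
  transitivity (\sum_(j < N) f`_i * (s%:C)%C ^+ i * (w ^+ (i + (N - l))) ^+ j).
    by apply: eq_bigr => j _; rewrite /z exprMn -!exprM mulnDl exprD [(j * i)%N]mulnC; ring.
  rewrite -mulr_sumr (sum_prim_root _ wN) ifF ?mulr0 //; apply/negP => /dvdnP[q eq].
  have iN := ltn_ord i; case/eqP: ni; apply: val_inj => /=.
  by case: q eq => [|[|q]] eq; nia.
have zB j : (j < N)%N -> cabs f.[z j] <= B.
  move=> jN; apply: Hf; last exact: Hs.
  by rewrite /z cabsM cabsXn cw expr1n mul1r cabs_real.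
have : N%:R * (cabs f`_l * s ^+ l) <= N%:R * B.
  rewrite -{1}(cabs_real s0) -cabsXn -cabsM -{1}(cabs_nat N) -cabsM -E.
  apply: le_trans (cabs_sum _ _ _) _.
  apply: (@le_trans _ _ (\sum_(j < N) B)); last by rewrite sumr_const card_ord mulr_natl.
  apply: ler_sum => j _; rewrite cabsM !cabsXn cw !expr1n mulr1; exact: zB.
rewrite ler_pM2l ?ltr0n // => H.
have sl : 2^-1 <= s ^+ l.
  by apply: le_trans sN2 _; apply: ler_wiXn2l => //; apply: ltnW.
have : cabs f`_l * 2^-1 <= B.
  by apply: le_trans H; apply: ler_wpM2l => //; apply: cabs_ge0.
by lra.
Qed.

Lemma digits_inj b n (a c : nat -> nat) : (forall i, (i < n)%N -> (a i < b)%N) ->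
  (forall i, (i < n)%N -> (c i < b)%N) ->
  (\sum_(i < n) a i * b ^ i = \sum_(i < n) c i * b ^ i)%N ->
  forall i, (i < n)%N -> a i = c i.
Proof.
elim: n a c => // n IH a c Ha Hc.
have sh (d : nat -> nat) : (\sum_(i < n.+1) d i * b ^ i =
    (\sum_(i < n) d i.+1 * b ^ i) * b + d 0)%N.
  rewrite big_ord_recl expn0 muln1 addnC big_distrl; congr (_ + _)%N.
  by apply: eq_bigr => i _; rewrite expnSr mulnA.
rewrite !sh => e.
have a0 := Ha 0%N isT; have c0 := Hc 0%N isT.
have e0 : a 0%N = c 0%N.
  by move/(congr1 (modn^~ b)): e; rewrite !modnMDl !modn_small.
have b0 : (0 < b)%N by apply: leq_ltn_trans a0.
have {}e : (\sum_(i < n) a i.+1 * b ^ i = \sum_(i < n) c i.+1 * b ^ i)%N.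
  by apply/eqP; rewrite -(eqn_pmul2r b0) -(eqn_add2r (a 0%N)) {2}e0 e.
case=> [|i] // lti; apply: (IH (fun i => a i.+1) (fun i => c i.+1)) => // k lk.
  exact: Ha.
exact: Hc.
Qed.

Section Kronecker.
Variables (m b : nat).
Implicit Types (X : {mpoly Cc[m]}) (u : 'X_{1..m}).

(* Kronecker substitution [x_i := z^(b^i)], injective on monomials of degree below [b]. *)
Definition kexp u : nat := (\sum_(i < m) u i * b ^ i)%N.
Definition kro X : {poly Cc} := \sum_(u <- msupp X) X@_u *: 'X^(kexp u).

Lemma kexp_inj u w : (mdeg u < b)%N -> (mdeg w < b)%N -> kexp u = kexp w -> u = w.
Proof.
move=> ub wb e.
have le (v : 'X_{1..m}) (i : 'I_m) : (v i <= mdeg v)%N by rewrite mdegE (bigD1 i) //= leq_addr.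
pose ext (v : 'X_{1..m}) (i : nat) := if insub i is Some j then v j else 0%N.
have extE (v : 'X_{1..m}) (i : 'I_m) : ext v i = v i by rewrite /ext valK.
have extb (v : 'X_{1..m}) : (mdeg v < b)%N -> forall i, (i < m)%N -> (ext v i < b)%N.
  by move=> vb i im; have := extE v (Ordinal im) => /= ->; apply: leq_ltn_trans (le v _) vb.
apply/mnmP => i; rewrite -[u i]extE -[w i]extE; apply: (digits_inj (extb u ub) (extb w wb)) => //.
by move: e; rewrite /kexp; under eq_bigr do rewrite -extE; under [RHS]eq_bigr do rewrite -extE.
Qed.

Lemma coef_kro X u : (msize X <= b)%N -> (mdeg u < b)%N -> (kro X)`_(kexp u) = X@_u.
Proof.
move=> Xb ub; rewrite coef_sum [in RHS](mpolyE X) raddf_sum /= [LHS]big_seq [RHS]big_seq.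
apply: eq_bigr => w wX; rewrite coefZ coefXn mcoeffZ mcoeffX eq_sym.
congr (_ * _%:R); have wb : (mdeg w < b)%N by apply: leq_trans (msize_mdeg_lt wX) Xb.
by congr nat_of_bool; apply/eqP/eqP => [/(kexp_inj wb ub)|->].
Qed.

Lemma horner_kro X z : (kro X).[z] = X.@[fun i => z ^+ (b ^ i)].
Proof.
rewrite horner_sum mevalE; apply: eq_bigr => u _.
rewrite hornerZ hornerXn /kexp expr_sum; congr (_ * _).
by apply: eq_bigr => i _; rewrite mulnC exprM.
Qed.

End Kronecker.

Lemma map_ratr_intr m (Y : {mpoly int[m]}) :
  map_mpoly ratr (map_mpoly intr Y : {mpoly rat[m]}) = map_mpoly intr Y :> {mpoly Cc[m]}.
Proof.
apply/mpolyP => u.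
rewrite [LHS](mcoeff_map_mpoly ratr u (map_mpoly intr Y)) [RHS](mcoeff_map_mpoly intr u Y).
rewrite (mcoeff_map_mpoly intr u Y); exact: ratr_int.
Qed.

Lemma power_sum_eval_bound m (H : {mpoly int[m]}) (RR : {mpoly rat[m]})
    (V : nat -> {mpoly rat[m]}) (p : nat -> {mpoly int[m]}) (c : 'I_m -> Cc) :
  H@_0 = 1 -> (map_mpoly ratr RR : {mpoly Cc[m]}).@[c] != 0 ->
  (forall k, cv (sq (grd (map_mpoly intr H))) V k = RR%:P`_k) ->
  subexp (fun k => (map_mpoly ratr (V k) : {mpoly Cc[m]}).@[c]) ->
  (forall k, cv (sq (grd H)) p k = - dser (sq (grd H)) k) ->
  forall k, cabs (map_mpoly intr (p k) : {mpoly Cc[m]}).@[c] <= (msize H)%:R.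
Proof.
move=> H1 r0 HV Vs Hp k.
have [ei eiE] : exists e : {rmorphism {mpoly int[m]} -> Cc},
    forall Y, e Y = (map_mpoly intr Y : {mpoly Cc[m]}).@[c].
  by exists (meval c \o map_mpoly intr).
have [er erE] : exists e : {rmorphism {mpoly rat[m]} -> Cc},
    forall Y, e Y = (map_mpoly ratr Y : {mpoly Cc[m]}).@[c].
  by exists (meval c \o map_mpoly ratr).
have erI (Y : {mpoly int[m]}) : er (map_mpoly intr Y) = ei Y.
  rewrite erE eiE map_ratr_intr; reflexivity.
pose g : {poly Cc} := map_poly ei (grd H).
have gE i : g`_i = ei (grd H)`_i by rewrite coef_map.
have szg : (size g <= msize H)%N by apply: leq_trans (size_grd H); apply: size_poly.
apply: (@le_trans _ _ (size g)%:R); last by rewrite ler_nat.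
have g0 : g`_0 = 1.
  by rewrite gE grd0 H1 rmorph1.
rewrite -eiE; rewrite -erE in r0.
have Vs' : subexp (er \o V) by move=> x x1; have [C HC] := Vs x x1; exists C => i; rewrite /= erE.
apply: (@log_derivative_bound g (er \o V) (ei \o p) (er RR) g0 r0 _ Vs') => i.
  rewrite coefC; transitivity (er (RR%:P`_i)); last first.
    by rewrite coefC; case: eqP => // _; rewrite rmorph0.
  rewrite -HV cv_rmorph; apply: eq_cv => // l _.
  by rewrite /sq gE -erI -map_grd.
transitivity (ei (- dser (sq (grd H)) i)).
  by rewrite -Hp cv_rmorph; apply: eq_cv => // l _; rewrite /sq gE.
by rewrite rmorphN /dser rmorphMn gE.
Qed.

Lemma map_ratr_neq0 m (RR : {mpoly rat[m]}) : RR != 0 ->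
  exists w, (map_mpoly ratr RR : {mpoly Cc[m]})@_w != 0.
Proof.
move=> R0; have [w nw] : exists w, RR@_w != 0.
  apply: NNPP => K; case/eqP: R0; apply/mpolyP => w; rewrite mcoeff0.
  by apply/eqP; apply: contraT => nz; case: K; exists w.
by exists w; rewrite (mcoeff_map_mpoly ratr w RR) fmorph_eq0.
Qed.

(** Kronecker substitution maps the unit disc into the unit polydisc and preserves coefficients, so
    [coef_bound] applies with the image of [RC] as [bad]. *)
Lemma cabs_mpoly_bound m (X RC : {mpoly Cc[m]}) (B : Rr) : (exists w, RC@_w != 0) ->
  (forall c, (forall i, cabs (c i) <= 1) -> RC.@[c] != 0 -> cabs X.@[c] <= B) ->
  forall u, cabs X@_u <= 2 * B.
Proof.
move=> [w nw] bnd u; pose b := (msize X + msize RC + mdeg u).+1.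
have [bX bR bu] : [/\ msize X <= b, msize RC <= b & mdeg u < b]%N by rewrite /b; split; lia.
have bad0 : kro b RC != 0.
  have ws : w \in msupp RC by rewrite mcoeff_msupp.
  have wb := leq_trans (msize_mdeg_lt ws) bR.
  by apply: contra nw => /eqP e; rewrite -(coef_kro bR wb) e coef0.
rewrite -(coef_kro bX bu); apply: (coef_bound bad0) => z z1.
rewrite (horner_kro b RC z) (horner_kro b X z); apply: bnd => i.
by rewrite cabsXn exprn_ile1 ?cabs_ge0.
Qed.

Lemma power_sum_coef_bound m (H : {mpoly int[m]}) (RR : {mpoly rat[m]})
    (V : nat -> {mpoly rat[m]}) (p : nat -> {mpoly int[m]}) :
  H@_0 = 1 -> RR != 0 ->
  (forall k, cv (sq (grd (map_mpoly intr H))) V k = RR%:P`_k) ->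
  (forall c, (forall i, cabs (c i) <= 1) ->
        subexp (fun k => (map_mpoly ratr (V k) : {mpoly Cc[m]}).@[c])) ->
  (forall k, cv (sq (grd H)) p k = - dser (sq (grd H)) k) ->
  forall k u, (`|(p k)@_u| <= 2 * msize H)%N.
Proof.
move=> H1 R0 HV Vs Hp k u.
have := cabs_mpoly_bound (X := map_mpoly intr (p k)) (B := (msize H)%:R) (map_ratr_neq0 R0).
move=> /(_ _ u) K; have {K} : cabs (map_mpoly intr (p k) : {mpoly Cc[m]})@_u <= 2 * (msize H)%:R.
  by apply: K => c c1 rc; apply: (power_sum_eval_bound H1 rc HV (Vs c c1) Hp).
by rewrite (mcoeff_map_mpoly intr u (p k)) cabs_int -natrM ler_nat.
Qed.

(** * Periodicity along rays *)

Section Periodicity.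
Implicit Types (a g : nat -> int).

Lemma cv_short g a d k : (forall i, (d <= i)%N -> g i = 0) -> (d <= k)%N ->
  cv g a k = \sum_(i < d) g i * a (k - i)%N.
Proof.
move=> Hg dk; rewrite /cv [RHS](big_ord_widen k.+1 (fun i => g i * a (k - i)%N)); last by lia.
rewrite [RHS]big_mkcond; apply: eq_bigr => i _; case: ltnP => // di.
by rewrite Hg // mul0r.
Qed.

(** Pigeonhole on windows of [d] consecutive values, shifted by [B] to lie between 0 and [2 * B]: as
    [g 0 = 1], a window determines all later values. *)
Lemma recurrence_periodic g a B d K : g 0%N = 1 ->
  (forall i, (d <= i)%N -> g i = 0) -> (forall k, (K <= k)%N -> cv g a k = 0) ->
  (forall k, (`|a k| <= B)%N) ->
  exists M K', (0 < M)%N /\ forall k, (K' <= k)%N -> a (k + M)%N = a k.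
Proof.
move=> g0 Hd Hr HB.
pose b k : 'I_(2 * B).+1 := inord `|(a k + B%:Z)%R|%N.
have bE i j : b i = b j -> a i = a j.
  move/(congr1 val); have hi := HB i; have hj := HB j.
  rewrite /= !inordK; lia.
pose K0 := maxn K d.
pose s (x : nat) : {ffun 'I_d -> 'I_(2 * B).+1} := [ffun i : 'I_d => b (K0 + x + i)%N].
have [x [y [xy exy]]] : exists x y, (x < y)%N /\ s x = s y.
  apply: NNPP => H; suff /leq_card : injective (fun x : 'I_#|{ffun 'I_d -> 'I_(2 * B).+1}|.+1 => s x).
    by rewrite card_ord ltnn.
  move=> x y e; apply: val_inj; apply: NNPP => /= ne; apply: H.
  have [lt|lt|//] := ltngtP x y; first by exists x, y.
  by exists y, x.
have E t : a (K0 + x + t)%N = a (K0 + y + t)%N.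
  elim/ltn_ind: t => t IH; have [td|dt] := ltnP t d.
    by apply: bE; have := congr1 (fun f : {ffun _} => f (Ordinal td)) exy; rewrite !ffunE.
  have := Hr (K0 + x + t)%N; have := Hr (K0 + y + t)%N.
  rewrite !(@cv_short g a d) //; try (rewrite /K0; lia).
  case: d Hd dt @K0 @s IH {exy} => [|d] Hd dt K0 s IH; first by move: (Hd 0%N isT); rewrite g0.
  rewrite !big_ord_recl g0 !mul1r !subn0 => e1 e2.
  have {}e1 := e1 ltac:(rewrite /K0; lia); have {}e2 := e2 ltac:(rewrite /K0; lia).
  apply: (addIr (\sum_(i < d) g (lift ord0 i) * a (K0 + y + t - lift ord0 i)%N)).
  rewrite [RHS]e1 -[RHS]e2; congr (_ + _); apply: eq_bigr => i _; congr (_ * _).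
  have id := ltn_ord i; rewrite -!addnBA; [|rewrite /= /bump; lia..].
  by rewrite IH // /= /bump; lia.
exists (y - x)%N, (K0 + x)%N; split=> [|k]; first by rewrite subn_gt0.
move=> kK; have := E (k - (K0 + x))%N; rewrite subnKC // => ->.
by congr a; lia.
Qed.

End Periodicity.

(** Both [i z] and [W w] lie between 0 and [W i], so [k (z - v) = i z - W w] is smaller than [k] in
    absolute value. *)
Lemma ray_arith (k i W w z v : nat) : (W * i < k)%N -> (w <= i)%N -> (z <= W)%N ->
  (k * z + W * w = k * v + i * z)%N -> z = v.
Proof.
move=> ik wi zW e.
have h1 : (W * w <= W * i)%N by rewrite leq_mul2l wi orbT.
have h2 : (i * z <= W * i)%N by rewrite mulnC leq_mul2r zW orbT.
have [lt|lt|//] := ltngtP z v.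
  have : (k * z.+1 <= k * v)%N by rewrite leq_mul2l lt orbT.
  rewrite mulnS; lia.
have : (k * v.+1 <= k * z)%N by rewrite leq_mul2l lt orbT.
rewrite mulnS; lia.
Qed.

Section Rays.
Variables (m : nat) (H : {mpoly int[m]}) (p : nat -> {mpoly int[m]}) (Bd : nat).
Hypothesis H1 : H@_0 = 1.
Hypothesis Hp : forall k, cv (sq (grd H)) p k = - dser (sq (grd H)) k.
Hypothesis HB : forall k u, (`|(p k)@_u| <= Bd)%N.
Implicit Types (u v w : 'X_{1..m}) (k : nat).

(** A nonzero integer of size at most [Bd] divides this factorial, so one [W] serves all
    coefficients. *)
Let W := Bd`!.
Let W0 : (0 < W)%N. Proof. exact: fact_gt0. Qed.

(* With [|v| = W], [ray_pt v k] is the point of degree [k] on the ray spanned by [v].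
   Every monomial of positive degree of a power sum lies on such a ray: its degree divides
   the product of each of its exponents with a nonzero coefficient of size at most [Bd]. *)
Definition on_ray v k := [forall j, W %| k * v j]%N.
Definition ray_pt v k : 'X_{1..m} := [multinom (k * v j) %/ W | j < m].
Definition ray_coef v k : int := if on_ray v k then (p k)@_(ray_pt v k) else 0.

Lemma ray_ptE v k j : on_ray v k -> (W * ray_pt v k j = k * v j)%N.
Proof. by move=> /forallP/(_ j) d; rewrite mnmE mulnC divnK. Qed.

Lemma ray_pt_uniq v k u : (forall j, W * u j = k * v j)%N -> on_ray v k /\ u = ray_pt v k.
Proof.
move=> e; split; first by apply/forallP => j; rewrite -e dvdn_mulr.
by apply/mnmP => j; rewrite mnmE -e mulKn.
Qed.

Lemma mdeg_scale (a b : nat) u v : (forall j, a * u j = b * v j)%N ->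
  (a * mdeg u = b * mdeg v)%N.
Proof. by move=> e; rewrite !mdegE !big_distrr; apply: eq_bigr => j _; apply: e. Qed.

Lemma mdeg_ray_pt v k : mdeg v = W -> on_ray v k -> mdeg (ray_pt v k) = k.
Proof.
move=> vW d; have := mdeg_scale (fun j => ray_ptE j d); rewrite vW mulnC => /eqP.
by rewrite eqn_pmul2r // => /eqP.
Qed.

Lemma ray_of k u : (0 < k)%N -> (p k)@_u != 0 ->
  exists v, [/\ mdeg v = W, mdeg u = k & forall j, W * u j = k * v j]%N.
Proof.
move=> k0 nz; have uk := power_sum_homog H1 Hp nz.
have d j : (k %| W * u j)%N.
  have := power_sum_dvd H1 Hp u j; rewrite uk => /dvdn_trans; apply.
  by apply: dvdn_mul => //; apply: dvdn_fact; rewrite absz_gt0 nz HB.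
exists [multinom (W * u j) %/ k | j < m].
have e j : (W * u j = k * [multinom (W * u j) %/ k | j < m] j)%N.
  by rewrite mnmE mulnC [RHS]mulnC divnK // mulnC.
split=> //; apply/eqP; rewrite -(eqn_pmul2l k0); apply/eqP.
by rewrite -(mdeg_scale e) uk mulnC.
Qed.

Lemma power_sum_rays k : (0 < k)%N ->
  p k = \sum_(v : 'X_{1..m < W.+1} | mdeg v == W) ray_coef v k *: 'X_[ray_pt v k].
Proof.
move=> k0; apply/mpolyP => u; rewrite raddf_sum /=.
have E v : (ray_coef v k *: 'X_[ray_pt v k])@_u =
    (p k)@_u *+ (on_ray v k && (ray_pt v k == u)).
  rewrite mcoeffZ mcoeffX /ray_coef; case: on_ray; rewrite ?mul0r //=.
  by case: eqP => [->|]; rewrite ?mulr1 ?mulr0.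
under eq_bigr do rewrite E.
have [z|nz] := eqVneq (p k)@_u 0; first by rewrite z big1 // => v _; rewrite mul0rn.
have [v [vW uk e]] := ray_of k0 nz.
have lv : (mdeg v < W.+1)%N by rewrite vW.
have [dv ev] := ray_pt_uniq e.
rewrite (bigD1 (BMultinom lv)) /= ?vW // -ev eqxx dv big1 ?addr0 //.
move=> w /andP[_ nw]; case: andP => // -[dw /eqP ew]; case/eqP: nw; apply: val_inj => /=.
apply/mnmP => j; have := ray_ptE j dw; rewrite ew e => /eqP.
by rewrite eqn_pmul2l // => /eqP.
Qed.

Definition ray_base v i : int := if on_ray v i then H@_(ray_pt v i) else 0.

Lemma ray_base_large v i : mdeg v = W -> (msize H <= i)%N -> ray_base v i = 0.
Proof.
move=> vW hi; rewrite /ray_base; case: ifP => // d.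
by apply: memN_msupp_eq0; apply/negP => /msize_mdeg_lt; rewrite mdeg_ray_pt // ltnNge hi.
Qed.

Lemma on_raySB v i k : on_ray v k -> on_ray v i -> on_ray v (k - i).
Proof.
move=> /forallP dk /forallP di; apply/forallP => j.
by rewrite mulnBl; apply: dvdn_sub.
Qed.

(** Far out, the recurrence restricts to each ray: subtracting a monomial of [H] of degree [i] from
    the ray point of degree [k] leads to a point on some ray [z], and for [k > W i] [ray_arith]
    forces [z = v], so the monomial of [H] lies on the ray too. *)
Lemma ray_product v i k : mdeg v = W -> (W * msize H < k)%N -> (i <= k)%N -> on_ray v k ->
  ((grd H)`_i * p (k - i)%N)@_(ray_pt v k) = ray_base v i * ray_coef v (k - i).
Proof.
move=> vW kl ik dk; set n := ray_pt v k.
rewrite (mcoeff_poly_mul_lin _ _ (ltnSn (mdeg n))).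
have F w : (w <= n)%MM -> ((grd H)`_i)@_w * (p (k - i)%N)@_(n - w) != 0 ->
    on_ray v i /\ w = ray_pt v i.
  move=> /mnm_lepP wn; rewrite mcoeff_grd.
  have [wi|] := eqVneq (mdeg w) i; last by rewrite mulr0n mul0r eqxx.
  rewrite mulr1n mulf_eq0 negb_or => /andP[Hw pw].
  have iH : (i < msize H)%N by rewrite -wi; apply: msize_mdeg_lt; rewrite mcoeff_msupp.
  have Wi : (W * i < k)%N by apply: leq_ltn_trans kl; rewrite leq_mul2l (ltnW iH) orbT.
  have ki : (0 < k - i)%N.
    by rewrite subn_gt0; apply: leq_ltn_trans Wi; rewrite leq_pmull.
  have [z [zW _ e]] := ray_of ki pw; apply: ray_pt_uniq => j.
  have zj : (z j <= W)%N by rewrite -zW mdegE (bigD1 j) //= leq_addr.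
  have wj : (w j <= i)%N by rewrite -wi mdegE (bigD1 j) //= leq_addr.
  have := e j; rewrite mnmBE mulnBr mulnBl (ray_ptE j dk) => e1.
  have le1 : (W * w j <= k * v j)%N by rewrite -(ray_ptE j dk) leq_mul2l wn orbT.
  have le2 : (i * z j <= k * z j)%N by rewrite leq_mul2r ik orbT.
  have zv : z j = v j by apply: (ray_arith Wi wj zj); clear -e1 le1 le2; lia.
  rewrite zv in e1 le2; clear -e1 le1 le2; lia.
rewrite /ray_base; have [di|di] := boolP (on_ray v i); last first.
  rewrite mul0r big1 // => w wn; apply/eqP; apply: contraNT di => nz.
  by case: (F _ wn nz).
have dki := on_raySB dk di; rewrite /ray_coef dki.
have le : (ray_pt v i <= n)%MM.
  apply/mnm_lepP => j; rewrite -(leq_pmul2l W0) !ray_ptE //.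
  by rewrite leq_mul2r ik orbT.
have lt : (mdeg (ray_pt v i) < (mdeg n).+1)%N by rewrite !mdeg_ray_pt.
rewrite (bigD1 (BMultinom lt)) //= big1 ?addr0 => [|w /andP[wn nw]]; last first.
  apply/eqP; apply: contraNT nw => nz; apply/eqP; apply: val_inj.
  by case: (F _ wn nz).
rewrite mcoeff_grd mdeg_ray_pt // eqxx mulr1n; congr (_ * (p _)@_(_)).
apply/mnmP => j; apply/eqP; rewrite -(eqn_pmul2l W0) mnmBE mulnBr !ray_ptE //.
by rewrite mulnBl.
Qed.

Lemma ray_recurrence v k : mdeg v = W -> (W * msize H < k)%N ->
  cv (ray_base v) (ray_coef v) k = 0.
Proof.
move=> vW kl; have [dk|dk] := boolP (on_ray v k); last first.
  apply: big1 => i _; rewrite /ray_base /ray_coef.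
  have ik : (i <= k)%N by rewrite -ltnS.
  case: ifP => di; rewrite ?mul0r //; case: ifP => dki; rewrite ?mulr0 //.
  case/negP: dk; apply/forallP => j; rewrite -(subnK ik) mulnDl.
  by apply: dvdn_add; [move/forallP: dki|move/forallP: di].
transitivity ((cv (sq (grd H)) p k)@_(ray_pt v k)).
  rewrite /cv raddf_sum; apply: eq_bigr => i _; symmetry.
  by apply: ray_product => //; rewrite -ltnS.
rewrite Hp /dser /sq grd_eq0 ?mul0rn ?oppr0 ?mcoeff0 //.
by apply: leq_trans (ltnW kl); rewrite leq_pmull.
Qed.

(** The period is taken to be a multiple of [W], since raising the degree by [M * W] moves the ray
    point by the integral vector [M v], the exponent of the binomial to come. *)
Lemma ray_periodic v : mdeg v = W -> exists M K, (0 < M)%N /\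
  forall k, (K <= k)%N -> ray_coef v (k + M * W) = ray_coef v k.
Proof.
move=> vW; have b0 : ray_base v 0 = 1.
  have d0 : on_ray v 0 by apply/forallP => j; rewrite mul0n.
  rewrite /ray_base d0 -[RHS]H1; congr (_@_(_)); apply/eqP.
  by rewrite -mdeg_eq0 mdeg_ray_pt.
have bd k : (`|ray_coef v k| <= Bd)%N by rewrite /ray_coef; case: ifP => // _; apply: HB.
have [M [K [M0 HM]]] := recurrence_periodic b0 (fun i => @ray_base_large v i vW)
  (fun k => @ray_recurrence v k vW) bd.
exists M, K; split=> // k Kk; rewrite mulnC; elim: (W) => [|n IH]; first by rewrite mul0n addn0.
rewrite mulSn addnCA addnC HM //; lia.
Qed.

End Rays.

(** * Binomial annihilators of the ray series *)

Section Annihilators.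
Variable A : comNzRingType.
Implicit Types (B : {poly A}) (s : nat -> A).

Definition evz s : Prop := exists K, forall k, (K <= k)%N -> s k = 0.

Lemma evz_cv B s : evz s -> evz (cv (sq B) s).
Proof.
case=> K HK; exists (K + size B)%N => k hk; apply: big1 => i _.
have [iB|Bi] := ltnP i (size B); last by rewrite /sq nth_default ?mul0r.
by rewrite HK ?mulr0 //; lia.
Qed.

Lemma evzD s s' : evz s -> evz s' -> evz (fun k => s k + s' k).
Proof.
case=> K HK [K' HK']; exists (K + K')%N => k hk.
by rewrite HK ?HK' ?addr0 //; lia.
Qed.

Lemma eq_evz s s' : (forall k, s k = s' k) -> evz s -> evz s'.
Proof. by move=> e [K HK]; exists K => k hk; rewrite -e HK. Qed.

Lemma cv_polyM B B' s k : cv (sq (B * B')) s k = cv (sq B) (cv (sq B') s) k.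
Proof. by rewrite cvA; apply: eq_cv => // i _; rewrite cv_sq. Qed.

Lemma common_annihilator (I : Type) (r : seq I) (a : I -> A) (n : I -> nat) (s : I -> nat -> A) :
  (forall i, evz (cv (sq (1 - (a i)%:P * 'X^(n i))) (s i))) ->
  evz (cv (sq (\prod_(i <- r) (1 - (a i)%:P * 'X^(n i)))) (fun k => \sum_(i <- r) s i k)).
Proof.
move=> Ha; elim: r => [|i r IH].
  by exists 0%N => k _; apply: big1 => j _; rewrite [X in _ * X]big_nil mulr0.
set B := \prod_(j <- r) _ in IH.
apply: (@eq_evz (fun k => cv (sq B) (cv (sq (1 - (a i)%:P * 'X^(n i))) (s i)) k +
  cv (sq (1 - (a i)%:P * 'X^(n i))) (cv (sq B) (fun k => \sum_(i <- r) s i k)) k)).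
  move=> k; rewrite -!cv_polyM big_cons -/B [B * _]mulrC -cvDr.
  by apply: eq_cv => // l _; rewrite big_cons.
by apply: evzD; apply: evz_cv.
Qed.

Lemma cv_binomial (a : A) n s k : (0 < n <= k)%N ->
  cv (sq (1 - a%:P * 'X^n)) s k = s k - a * s (k - n)%N.
Proof.
case/andP=> n0 nk; have n1 : n != 0%N by rewrite -lt0n.
have c i : sq (1 - a%:P * 'X^n) i = (i == 0%N)%:R - a * (i == n)%:R.
  by rewrite /sq coefB coef1 coefCM coefXn.
have -> : s k = \sum_(i < k.+1) (nat_of_ord i == 0%N)%:R * s (k - i)%N.
  rewrite (bigD1 ord0) //= mul1r subn0 big1 ?addr0 // => i ni.
  by rewrite -[nat_of_ord i == _]/(i == ord0) (negPf ni) mul0r.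
have nk' : (n < k.+1)%N by [].
have -> : a * s (k - n)%N = \sum_(i < k.+1) a * (nat_of_ord i == n)%:R * s (k - i)%N.
  rewrite (bigD1 (Ordinal nk')) //= eqxx mulr1 big1 ?addr0 // => i ni.
  by rewrite -[nat_of_ord i == _]/(i == Ordinal nk') (negPf ni) mulr0 mul0r.
by rewrite -sumrB; apply: eq_bigr => i _; rewrite c mulrBl.
Qed.

Lemma evz_poly s : evz s -> exists Y : {poly A}, forall k, Y`_k = s k.
Proof.
case=> K HK; exists (\poly_(i < K) s i) => k; rewrite coef_poly.
by case: ltnP => // /HK ->.
Qed.

End Annihilators.

Definition euler m (R : comNzRingType) (X : {mpoly R[m]}) : {mpoly R[m]} := \sum_j eul j X.

Lemma mcoeff_euler m (R : comNzRingType) (X : {mpoly R[m]}) u : (euler X)@_u = X@_u *+ mdeg u.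
Proof.
rewrite /euler raddf_sum /=; under eq_bigr do rewrite mcoeff_eul.
by rewrite sumrMnr -mdegE.
Qed.

Lemma grd_euler m (R : comNzRingType) (X : {mpoly R[m]}) :
  grd (euler X) = 'X * (grd X)^`().
Proof.
apply/polyP => k; transitivity ((grd X)`_k *+ k).
  apply/mpolyP => u; rewrite mcoeff_grd mcoeff_euler mcoeffMn mcoeff_grd.
  by case: eqP => [->|] //; rewrite !mul0rn.
by rewrite coefXM coef_deriv; case: k.
Qed.

(** On a ray, [1 - x^(M v) t^(M W)] turns the periodic series into a polynomial, so with [B] the
    product of these binomials [Y = B p] is a polynomial in [t]. Multiplying by [grd H] gives
    [grd H Y = - B grd (euler H)], to be read at [t = 1]. *)
Lemma log_derivative_cyclotomic m (H : {mpoly int[m]}) (p : nat -> {mpoly int[m]}) Bd :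
  H@_0 = 1 -> (forall k, cv (sq (grd H)) p k = - dser (sq (grd H)) k) ->
  (forall k u, (`|(p k)@_u| <= Bd)%N) ->
  exists ws : seq 'X_{1..m}, (forall w, w \in ws -> w != 0%MM) /\
    dvdr H (\prod_(w <- ws) (1 - 'X_[w]) * euler H).
Proof.
move=> H1 Hp HB; set W := Bd`!; have W0 : (0 < W)%N by apply: fact_gt0.
have per (v : 'X_{1..m < W.+1}) : exists M, (0 < M)%N /\ (mdeg v = W -> exists K,
    forall k, (K <= k)%N -> ray_coef p Bd v (k + M * W) = ray_coef p Bd v k).
  have [vW|vW] := eqVneq (mdeg v) W; last by exists 1%N; split=> // e; rewrite e eqxx in vW.
  have [M [K [M0 HM]]] := ray_periodic H1 Hp HB vW.
  by exists M; split=> // _; exists K.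
have [M HM] : exists M : 'X_{1..m < W.+1} -> nat, forall v, (0 < M v)%N /\
    (mdeg v = W -> exists K, forall k, (K <= k)%N ->
      ray_coef p Bd v (k + M v * W) = ray_coef p Bd v k).
  by exists (fun v => proj1_sig (constructive_indefinite_description _ (per v))) => v;
    case: constructive_indefinite_description.
pose w (v : 'X_{1..m < W.+1}) : 'X_{1..m} := (v *+ M v)%MM.
pose s (v : 'X_{1..m < W.+1}) k : {mpoly int[m]} :=
  if mdeg v == W then ray_coef p Bd v k *: 'X_[ray_pt Bd v k] else 0.
have Hs v : evz (cv (sq (1 - ('X_[w v])%:P * 'X^(M v * W))) (s v)).
  have [M0 HK] := HM v; rewrite /s; have [vW|_] := eqVneq (mdeg v) W; last first.
    by exists 0%N => k _; apply: cv0r.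
  have [K {}HK] := HK vW; exists (K + M v * W)%N => k hk.
  rewrite cv_binomial; last by rewrite muln_gt0 M0 W0 /=; apply: leq_trans hk; apply: leq_addl.
  have [k' ek hk'] : exists2 k', k = (k' + M v * W)%N & (K <= k')%N.
    by exists (k - M v * W)%N; lia.
  rewrite ek addnK HK // -scalerAr -mpolyXD.
  rewrite (_ : ray_pt _ _ (k' + _) = w v + ray_pt Bd v k')%MM ?subrr //.
  apply/mnmP => j; rewrite mnmDE mulmnE !mnmE mulnDl.
  by rewrite [in X in (_ + X)%N]mulnAC addnC divnMDl // mulnC.
pose r := [seq v : 'X_{1..m < W.+1} <- index_enum _ | mdeg v == W].
have ps k : (0 < k)%N -> p k = \sum_(v <- r) s v k.
  move=> k0; rewrite (power_sum_rays H1 Hp HB k0) -/W big_filter.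
  by apply: eq_big => // v vW; rewrite /s vW.
have [Y HY] : exists Y : {poly {mpoly int[m]}}, forall k, Y`_k =
    cv (sq (\prod_(v <- r) (1 - ('X_[w v])%:P * 'X^(M v * W)))) p k.
  apply: evz_poly; set B := \prod_(v <- _) _.
  apply: (@eq_evz _ (fun k => cv (sq B) (fun k => p k - \sum_(v <- r) s v k) k +
     cv (sq B) (fun k => \sum_(v <- r) s v k) k)).
    by move=> k; rewrite -cvDr; apply: eq_cv => // l _; rewrite subrK.
  apply: evzD; last exact: common_annihilator Hs.
  (* The rays account for all coefficients of [p] except the one of index 0. *)
  by apply: evz_cv; exists 1%N => k k0; rewrite ps // subrr.
exists [seq w v | v <- r]; split.
  move=> x /mapP[v]; rewrite mem_filter => /andP[/eqP vW _] ->; apply: contraTneq W0 => wv.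
  have := congr1 (@mdeg m) wv; rewrite mdegMn vW mdeg0 => /eqP.
  by rewrite muln_eq0 [M v == _]eqn0Ngt (proj1 (HM v)) orbF => /eqP ->.
exists (- Y.[1]); rewrite big_map.
have E : grd H * Y = - (\prod_(v <- r) (1 - ('X_[w v])%:P * 'X^(M v * W)) * grd (euler H)).
  set B := \prod_(v <- _) _ in HY *; apply/polyP => k.
  rewrite -cv_sq coefN; transitivity (cv (sq (grd H)) (cv (sq B) p) k).
    by apply: eq_cv => // i _; rewrite -HY.
  rewrite -cv_polyM mulrC cv_polyM grd_euler -cv_sq -cvNr; apply: eq_cv => // i _.
  by rewrite Hp /dser /sq coefXM coef_deriv; case: i.
have e1 : (grd H * Y).[1] = H * Y.[1] by rewrite (hornerM (grd H) Y 1) (horner_grd1 H).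
have e2 : (\prod_(v <- r) (1 - ('X_[w v])%:P * 'X^(M v * W))).[1] =
    \prod_(v <- r) (1 - 'X_[w v]) :> {mpoly int[m]}.
  rewrite horner_prod; apply: eq_bigr => v _.
  by rewrite hornerD hornerN hornerM !hornerC hornerXn expr1n mulr1.
rewrite mulNr [Y.[1] * H]mulrC -e1 E hornerN opprK
  (hornerM _ (grd (euler H)) 1) e2 (horner_grd1 (euler H)).
reflexivity.
Qed.

(** * Prime divisors of cyclotomic binomials *)

Section WeightedDerivation.
Variables (m : nat) (R : comNzRingType) (l : 'I_m -> R).
Implicit Types X Y : {mpoly R[m]}.

Definition wder X : {mpoly R[m]} := \sum_j l j *: eul j X.

Lemma mcoeff_wder X u : (wder X)@_u = X@_u * \sum_j l j *+ u j.
Proof.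
rewrite /wder raddf_sum /= mulr_sumr; apply: eq_bigr => j _.
by rewrite mcoeffZ mcoeff_eul !mulrnAr mulrC.
Qed.

Lemma wderM X Y : wder (X * Y) = wder X * Y + X * wder Y.
Proof.
rewrite /wder mulr_suml mulr_sumr -big_split; apply: eq_bigr => j _.
by rewrite eulM scalerDr -scalerAl -scalerAr.
Qed.

Lemma msize_wder X : (msize (wder X) <= msize X)%N.
Proof.
rewrite [X in (X <= _)%N]mmeasureE; apply/bigmax_leqP_seq => u us _.
apply: msize_mdeg_lt; rewrite mcoeff_msupp.
by apply: contraTneq us => e; rewrite mcoeff_msupp mcoeff_wder e mul0r eqxx.
Qed.

End WeightedDerivation.

Lemma euler_wder m (R : comNzRingType) (X : {mpoly R[m]}) : euler X = wder (fun=> 1) X.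
Proof. by apply: eq_bigr => j _; rewrite scale1r. Qed.

Lemma derivation_exp (A : comNzRingType) (E : A -> A) (D C : A) e :
  (forall x y, E (x * y) = E x * y + x * E y) ->
  E (D ^+ e.+1 * C) = D ^+ e * (E D *+ e.+1 * C + D * E C).
Proof.
move=> EM; elim: e C => [|e IH] C.
  by rewrite expr1 expr0 mul1r mulr1n EM.
by rewrite exprSr -mulrA IH EM [in RHS]exprSr [E D *+ e.+2]mulrSr; ring.
Qed.

Section Divisors.
Variables (k : fieldType) (m : nat).
Hypothesis chk : [pchar k] =i pred0.
Implicit Types (D G S X : {mpoly k[m]}) (u w : 'X_{1..m}).

Lemma prime_dvd_unit D X : prime_elt D -> dvdr D X -> X \isn't a GRing.unit.
Proof. by case=> _ Du _ [Y ->]; rewrite unitrM (negPf Du) andbF. Qed.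

Lemma natr_eq0_char0 n : (n%:R == 0 :> k) = (n == 0%N).
Proof. by move/pcharf0P: chk. Qed.

(** [wder l] does not raise the degree, so a nonzero cofactor is a constant; but then [wder l D]
    would have a constant term, as [D] does. *)
Lemma dvdr_wder (l : 'I_m -> k) D : D@_0 != 0 -> dvdr D (wder l D) -> wder l D = 0.
Proof.
move=> D0 [Y e]; have [->//|n0] := eqVneq (wder l D) 0.
have Dn : D != 0 by apply: contraNneq D0 => ->; rewrite mcoeff0.
have Yn : Y != 0 by apply: contraNneq n0 => Y0; rewrite e Y0 mul0r.
have := msize_wder l D; rewrite e msizeM // => le.
have sD : (0 < msize D)%N by rewrite lt0n msize_poly_eq0.
have sY : (0 < msize Y)%N by rewrite lt0n msize_poly_eq0.
have /msize_poly1P[c c0 eY] : msize Y == 1%N.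
    rewrite eqn_leq sY andbT; move: (msize Y) (msize D) le sD => a b le sD; lia.
have := congr1 (mcoeff 0) e; rewrite mcoeff_wder big1 => [|j _]; last by rewrite mnm0E mulr0n.
by rewrite mulr0 eY mcoeffCM => /esym/eqP; rewrite mulf_eq0 (negPf c0) (negPf D0).
Qed.

Lemma not_dvdr_euler D : prime_elt D -> D@_0 != 0 -> ~ dvdr D (euler D).
Proof.
move=> pD D0; rewrite euler_wder => /(dvdr_wder D0) e.
have [Dn Du _] := pD; case/negP: Du; apply: mpoly_const_unit => //.
apply/mpolyP => u; rewrite mcoeffC.
have [->|u0] := eqVneq u 0%MM; first by rewrite mulr1.
rewrite mulr0; apply/eqP.
have := congr1 (mcoeff u) e; rewrite -euler_wder mcoeff_euler mcoeff0 => /eqP.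
by rewrite -mulr_natr mulf_eq0 natr_eq0_char0 mdeg_eq0 (negPf u0) orbF.
Qed.

(** If [D^(e+1)] divides [G] exactly, then [D^e] divides [euler G] exactly, as [D] does not divide
    [euler D] and the characteristic is 0; the missing factor comes from [S]. *)
Lemma prime_dvd_log_derivative D G S : prime_elt D -> D@_0 != 0 -> G != 0 ->
  dvdr D G -> dvdr G (S * euler G) -> dvdr D S.
Proof.
move=> pD D0 G0 DG GS; have [Dn Du DM] := pD.
have [n0 Hn0] := prime_exp_bound (@mpoly_ufd k m) pD G0.
have [n Hn Hlt] := ex_first (P := fun n => dvdr (D ^+ n) G) Hn0.
case: n Hn Hlt => [|[|e]] Hn Hlt.
- by case: Hn; exists G; rewrite mulr1.
- by case: Hn.
have [C eG] := Hlt e.+1 (ltnSn _).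
have nC : ~ dvdr D C.
  by case=> C' eC; apply: Hn; exists C'; rewrite eG eC [in RHS]exprS; ring.
have [Z eZ] := GS; move: eZ; rewrite eG [C * _]mulrC euler_wder.
rewrite (derivation_exp _ _ _ (wderM (fun=> 1))) -euler_wder => eZ.
have : dvdr D (S * (euler D *+ e.+1 * C + D * wder (fun=> 1) C)).
  exists (Z * C); apply: (mulfI (expf_neq0 e Dn)).
  by rewrite mulrCA eZ exprS; ring.
case/DM=> // H.
have : dvdr D (euler D *+ e.+1 * C).
  by apply: dvdr_addl H; apply: dvdr_mulr; apply: dvdr_refl.
case/DM=> // -[Y eY]; case: (not_dvdr_euler pD D0).
exists (e.+1%:R^-1 *: Y); rewrite -scalerAl -eY -scaler_nat scalerA mulVf ?scale1r //.
by rewrite natr_eq0_char0.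
Qed.

Lemma prime_dvd_prod_binomial D (ws : seq 'X_{1..m}) : prime_elt D ->
  dvdr D (\prod_(w <- ws) (1 - 'X_[w])) -> exists2 w, w \in ws & dvdr D (1 - 'X_[w]).
Proof.
move=> pD Dp; have [|q /mapP[w ws' ->] Dw] := @prime_dvdr_prod _ D 1
  [seq 1 - 'X_[w] : {mpoly k[m]} | w <- ws] pD (unitr1 _); last by exists w.
by rewrite mul1r big_map.
Qed.

(** [D] divides [1 - x^w] only once: otherwise it would divide the Euler derivative, a nonzero
    multiple of [x^w], and so a unit. A derivation killing [x^w] then makes [D] divide [wder l D],
    so [wder l D = 0], and the support of [D] lies in the kernel of the linear form [l]. *)
Lemma binomial_divisor_support D w : prime_elt D -> D@_0 != 0 -> w != 0%MM ->
  dvdr D (1 - 'X_[w]) -> forall u, u \in msupp D -> forall a b, (w a * u b = w b * u a)%N.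
Proof.
move=> pD D0 w0 Dw u us a b; have [Dn Du DM] := pD; have [Y eY] := Dw.
have dX (l : 'I_m -> k) : wder l (1 - 'X_[w]) = - ((\sum_j l j *+ w j) *: 'X_[w]).
  apply/mpolyP => v; rewrite mcoeff_wder mcoeffN mcoeffZ mcoeffB mcoeff1 mcoeffX.
  have [->|v0] := eqVneq v 0%MM.
    rewrite (negPf w0) mulr0 oppr0 big1 ?mulr0 // => j _; by rewrite mnm0E mulr0n.
  by rewrite sub0r; case: eqP => [->|_]; rewrite ?mulr1 ?mulN1r // ?oppr0 mul0r mulr0 oppr0.
have nY : ~ dvdr D Y.
  case=> Y' eY'; have : dvdr D (euler (1 - 'X_[w])).
    rewrite eY eY' euler_wder !wderM; exists (wder (fun=> 1) Y' * D + Y' * wder (fun=> 1) D *+ 2); ring.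
  rewrite euler_wder dX => /dvdrN; rewrite opprK.
  have -> : \sum_j (1 : k) *+ w j = (mdeg w)%:R by rewrite sumrMnr -mdegE.
  set c := _%:R => DX; have c0 : c != 0 by rewrite natr_eq0_char0 mdeg_eq0.
  have : dvdr D c%:MP.
    have -> : c%:MP = c%:MP * (1 - 'X_[w]) + c *: 'X_[w] :> {mpoly k[m]}.
      by rewrite -mul_mpolyC; ring.
    by apply: dvdrD => //; apply: dvdr_mull.
  move/(prime_dvd_unit pD); rewrite (rmorph_unit (@mpolyC m k)) //.
  by rewrite unitfE.
(* The linear form sending [u] to [w_b u_a - w_a u_b], which vanishes at [w]. *)
pose l j : k := (w b)%:R *+ (j == a) - (w a)%:R *+ (j == b).
have lE v : \sum_j l j *+ v j = (w b * v a)%:R - (w a * v b)%:R.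
  rewrite /l; under eq_bigr do rewrite mulrnBl.
  rewrite sumrB (bigD1 a) //= eqxx big1 ?addr0 => [|j nj]; last by rewrite (negPf nj) mul0rn.
  rewrite [X in _ - X](bigD1 b) //= eqxx big1 ?addr0 => [|j nj]; last by rewrite (negPf nj) mul0rn.
  by rewrite !mulr1n -!mulrnA.
have e0 : wder l (1 - 'X_[w]) = 0 by rewrite dX lE mulnC subrr scale0r oppr0.
have : dvdr D (Y * wder l D).
  by apply: (@dvdr_addl _ _ (wder l Y * D)); 
    [exact/dvdr_mull/dvdr_refl|rewrite addrC -wderM -eY e0; exact: dvdr0].
case/DM=> // /(dvdr_wder D0) /(congr1 (mcoeff u)); rewrite mcoeff_wder mcoeff0 lE.
move/eqP; rewrite mulf_eq0 mcoeff_eq0 us /= subr_eq0 -subr_eq0.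
have [le|/ltnW le] := leqP (w b * u a) (w a * u b).
  rewrite -oppr_eq0 opprB -natrB // natr_eq0_char0 subn_eq0 => le2.
  by apply/eqP; rewrite eqn_leq le le2.
rewrite -natrB // natr_eq0_char0 subn_eq0 => le2.
by apply/eqP; rewrite eqn_leq le le2.
Qed.

End Divisors.

(** Fix [j] with [w j] nonzero and take the parallel vector with least positive coordinate at [j].
    Division with remainder by it leaves a parallel vector whose coordinate at [j] is 0, hence 0. *)
Lemma line_generator m (w : 'X_{1..m}) : w != 0%MM -> exists2 n : 'X_{1..m}, n != 0%MM &
  forall u : 'X_{1..m}, (forall a b, w a * u b = w b * u a)%N -> exists t, u = (n *+ t)%MM.
Proof.
move=> w0; have [j wj] : exists j, w j != 0%N.
  apply: NNPP => H; case/eqP: w0; apply/mnmP => j; rewrite mnm0E.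
  by apply/eqP; apply: contraT => nz; case: H; exists j.
pose par (u : 'X_{1..m}) := forall a b, (w a * u b = w b * u a)%N.
have [d Hd Hlt] := ex_first (P := fun d => ~ exists n, [/\ par n, n j = d & d != 0%N]) (i := w j)
  (fun H => H (ex_intro _ w (And3 (fun a b => mulnC _ _) (erefl _) wj))).
have [n [pn nj d0]] := NNPP _ Hd; exists n.
  by apply: contraNneq d0 => n0; rewrite -nj n0 mnm0E.
move=> u pu; exists (u j %/ d)%N; set q := (_ %/ _)%N.
have wj0 : (0 < w j)%N by rewrite lt0n.
have le : (n *+ q <= u)%MM.
  apply/mnm_lepP => i; rewrite mulmnE -(leq_pmul2l wj0) mulnA pn pu -mulnA leq_mul2l.
  by rewrite mulnC nj leq_divM orbT.
pose v := (u - n *+ q)%MM.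
have vE i : (u i = v i + n i * q)%N.
  by rewrite mnmBE mulmnE subnK //; move/mnm_lepP: le => /(_ i); rewrite mulmnE.
have pv : par v.
  move=> a b; have := pu a b; have := pn a b; rewrite !vE; nia.
have vj : (v j < d)%N.
  have := vE j; rewrite nj /q mulnC [X in X = _](divn_eq _ d) addnC => /addIn <-.
  by rewrite ltn_mod lt0n.
have vj0 : v j = 0%N.
  by apply/eqP; apply: contraT => nz; case: (Hlt _ vj); exists v.
apply/mnmP => i; rewrite vE mulmnE; have := pv j i; rewrite vj0 muln0 => /eqP.
by rewrite muln_eq0 (negPf wj) => /eqP ->.
Qed.

Lemma line_poly (k : comNzRingType) m (n : 'X_{1..m}) (D : {mpoly k[m]}) :
  (forall u, u \in msupp D -> exists t, u = (n *+ t)%MM) ->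
  exists d : {poly k}, D = (map_poly (@mpolyC m k) d).['X_[n]].
Proof.
move=> H; have [t Ht] : exists t : 'X_{1..m} -> nat,
    forall u, u \in msupp D -> u = (n *+ t u)%MM.
  have Ex u : exists t, u \in msupp D -> u = (n *+ t)%MM.
    by have [/H[t ->]|_] := boolP (u \in msupp D); [exists t|exists 0%N].
  exists (fun u => proj1_sig (constructive_indefinite_description _ (Ex u))) => u.
  by case: constructive_indefinite_description.
exists (\sum_(u <- msupp D) D@_u *: 'X^(t u)).
rewrite rmorph_sum horner_sum /= {1}(mpolyE D) [LHS]big_seq [RHS]big_seq.
apply: eq_bigr => u us; rewrite map_polyZ map_polyXn hornerZ hornerXn.
by rewrite mpolyXn -Ht // mul_mpolyC.
Qed.

Lemma qb_root (p : {poly Qb}) : (1 < size p)%N -> exists y, root p y.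
Proof.
move=> sp; have p0 : p != 0 by rewrite -size_poly_gt0 ltnW.
have l0 : (lead_coef p)^-1 != 0 by rewrite invr_eq0 lead_coef_eq0.
have pm : (lead_coef p)^-1 *: p \is monic by rewrite monicE lead_coefZ mulVf // lead_coef_eq0.
have [[|y ts] e] := qb_split pm.
  by move: sp; rewrite -(size_scale p l0) e big_nil size_poly1.
by exists y; rewrite -(rootZ _ _ l0) e root_prod_XsubC mem_head.
Qed.

Lemma mpoly_unit_const (k : fieldType) m (X : {mpoly k[m]}) : X \is a GRing.unit ->
  exists2 c, c != 0 & X = c%:MP.
Proof. by case/andP => /eqP e; rewrite unitfE => c0; exists X@_0. Qed.

Lemma meval_monomial_root m (n : 'X_{1..m}) (y : Qb) : n != 0%MM ->
  exists c : 'I_m -> Qb, ('X_[n] : {mpoly Qb[m]}).@[c] = y.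
Proof.
move=> n0; have [j nj] : exists j, n j != 0%N.
  apply: NNPP => H; case/eqP: n0; apply/mnmP => j; rewrite mnm0E.
  by apply/eqP; apply: contraT => nz; case: H; exists j.
have [|z /rootP] := @qb_root ('X^(n j) - y%:P).
  by rewrite size_XnsubC ?lt0n // ltnS lt0n.
rewrite hornerD hornerN hornerXn hornerC => /eqP; rewrite subr_eq0 => /eqP zy.
exists (fun i => if i == j then z else 1); rewrite mevalX (bigD1 j) //= eqxx zy.
by rewrite big1 ?mulr1 // => i /negPf ->; rewrite expr1n.
Qed.

(** As [D = d(x^n)], a root [y] of [d] splits off a factor [x^n - y], to which the prime [D] must be
    associated. *)
Lemma binomial_prime_divisor m (D : {mpoly Qb[m]}) (w : 'X_{1..m}) :
  prime_elt D -> D@_0 != 0 -> w != 0%MM -> dvdr D (1 - 'X_[w]) ->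
  exists c zeta (n : 'X_{1..m}), [/\ c != 0, (exists2 g, (0 < g)%N & zeta ^+ g = 1), n != 0%MM
    & D = c *: (1 - zeta *: 'X_[n])].
Proof.
move=> pD D0 w0 Dw; have [Dn Du DM] := pD.
have [n n0 Hn] := line_generator w0.
have [|d eD] := @line_poly Qb m n D.
  by move=> u /(binomial_divisor_support qb_char0 pD D0 w0 Dw) /Hn.
have sd : (1 < size d)%N.
  rewrite ltnNge; apply: contraNN Du => /size1_polyC ed.
  apply: mpoly_const_unit => //; rewrite eD ed map_polyC hornerC mcoeffC eqxx mulr1; reflexivity.
have [y /factor_theorem[q ed]] := qb_root sd.
have [D2 eD2] : exists D2, D = D2 * ('X_[n] - y%:MP).
  exists (map_poly (@mpolyC m Qb) q).['X_[n]]; rewrite {1}eD ed rmorphM hornerM.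
  by rewrite rmorphB /= map_polyX map_polyC hornerD hornerN hornerX hornerC.
have y0 : y != 0.
  apply: contraNneq D0 => y0; rewrite eD2 mcoeff0M mcoeffB mcoeffX mcoeffC (negPf n0) y0.
  by rewrite mul0r subr0 mulr0.
have [g ew] : exists g, w = (n *+ g)%MM by apply: Hn => a b; rewrite mulnC.
have g0 : (0 < g)%N by rewrite lt0n; apply: contraNneq w0 => g0; rewrite ew g0 mulm0n.
have yg : y ^+ g = 1.
  (* A point where [x^n] takes the value [y] is a zero of [D], hence of [1 - x^w = 1 - (x^n)^g]. *)
  have [c ec] := meval_monomial_root y n0; have [Y eY] := Dw.
  have Dc : D.@[c] = 0 by rewrite eD2 mevalM mevalB mevalC ec subrr mulr0.
  have := congr1 (meval c) eY; rewrite mevalM Dc mulr0 mevalB meval1 ew -mpolyXn.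
  by rewrite rmorphXn /= ec => /eqP; rewrite subr_eq0 => /eqP.
have b0 : 'X_[n] - y%:MP != 0 :> {mpoly Qb[m]}.
  by apply: contraNneq Dn => e; rewrite eD2 e mulr0.
have D20 : D2 != 0 by apply: contraNneq Dn => e; rewrite eD2 e mul0r.
case: (DM D2 ('X_[n] - y%:MP)) => [|[X eX]|[X eX]]; first by rewrite -eD2; apply: dvdr_refl.
  have [|c c0 /(congr1 (mcoeff n))] := @mpoly_unit_const Qb m ('X_[n] - y%:MP).
    apply/unitrP; exists X; have e1 : X * ('X_[n] - y%:MP) = 1.
      by apply: (mulIf D20); rewrite mul1r [RHS]eX eD2; ring.
    by split=> //; rewrite mulrC.
  rewrite mcoeffB mcoeffX !mcoeffC eqxx (negPf n0) !mulr0 subr0 => /eqP.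
  by rewrite oner_eq0.
have [|c c0 ec] := @mpoly_unit_const Qb m D2.
  apply/unitrP; exists X; have e1 : X * D2 = 1.
    by apply: (mulIf b0); rewrite mul1r [RHS]eX eD2; ring.
  by split=> //; rewrite mulrC.
(* From [c (x^n - y) = - c y (1 - y^-1 x^n)]. *)
exists (- (c * y)), y^-1, n; split=> //.
- by rewrite oppr_eq0 mulf_neq0.
- by exists g => //; rewrite exprVn yg invr1.
rewrite eD2 ec scalerBr scalerA mulNr mulfK // -[_ *: 'X_[n]]mul_mpolyC -[_ *: 1]mul_mpolyC.
by rewrite !mpolyCN mpolyCM; ring.
Qed.

(** * The theorem *)

Lemma denominator_prime_divisor m (P Q D : {mpoly Qb[m]}) (f : 'X_{1..m} -> Qb) :
  Q@_0 = 1 -> (forall n, smul Q f n = P@_n) ->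
  (forall D, dvdr D P -> dvdr D Q -> D = (D@_0)%:MP) ->
  (forall eps : Rr, 0 < eps -> exists N0 : nat, forall N : nat,
    (N0 <= N)%N -> height_max (fun n => qval (f n)) N <= eps * N%:R) ->
  prime_elt D -> dvdr D Q ->
  exists c zeta (n : 'X_{1..m}), [/\ c != 0, (exists2 g, (0 < g)%N & zeta ^+ g = 1), n != 0%MM
    & D = c *: (1 - zeta *: 'X_[n])].
Proof.
move=> Q1 eQ cop hgt pD DQ.
have [G [RR [V [G1 QG R0 HV [Vp Ve]]]]] := arithmetic_data Q1 eQ cop hgt.
have [H eH] := fatou_int G1 R0 HV Vp.
have H1 : H@_0 = 1.
  by apply: (@intr_inj rat); rewrite rmorph1 -(mcoeff_map_mpoly intr 0%MM H) eH.
have g0 : sq (grd H) 0%N = 1 by rewrite /sq grd0 H1.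
have [p Hp] := cv_solve (fun k => - dser (sq (grd H)) k) g0.
rewrite -eH in HV; have HB := power_sum_coef_bound H1 R0 HV Ve Hp.
have [ws [ws0 [Y eY]]] := log_derivative_cyclotomic H1 Hp HB.
pose h : {rmorphism {mpoly int[m]} -> {mpoly Qb[m]}} := map_mpoly intr.
have hc (X : {mpoly int[m]}) u : (h X)@_u = (X@_u)%:~R by apply: mcoeff_map_mpoly.
have hE : h (euler H) = euler (h H).
  by apply/mpolyP => u; rewrite hc !mcoeff_euler hc rmorphMn.
have hX w : h (1 - 'X_[w]) = 1 - 'X_[w].
  by apply/mpolyP => u; rewrite hc !mcoeffB !mcoeff1 !mcoeffX rmorphB /= !rmorph_nat.
have hG : h H = map_mpoly qrat G.
  apply/mpolyP => u; rewrite hc -eH [RHS](mcoeff_map_mpoly qrat u) (mcoeff_map_mpoly intr u H).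
  symmetry; exact: (rmorph_int qrat).
have D0 : D@_0 != 0.
  have [E eE] := DQ; move: (oner_neq0 Qb); rewrite -Q1 eE mcoeff0M.
  by apply: contraNneq => ->; rewrite mulr0.
have h0 : h H != 0.
  apply/eqP => e; have := hc H 0%MM; rewrite e H1 mcoeff0 => /eqP.
  by rewrite rmorph1 eq_sym oner_eq0.
have Dh : dvdr D (h H) by rewrite hG; apply: dvdr_trans QG.
have hS : dvdr (h H) (\prod_(w <- ws) (1 - 'X_[w]) * euler (h H)).
  exists (h Y); rewrite -rmorphM -eY rmorphM rmorph_prod hE; congr (_ * _).
  by apply: eq_bigr => w _; rewrite hX.
have DS := prime_dvd_log_derivative qb_char0 pD D0 h0 Dh hS.
have [w wws Dw] := prime_dvd_prod_binomial pD DS.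
exact: binomial_prime_divisor pD D0 (ws0 _ wws) Dw.
Qed.

(** * Transfer between [Qb] and the algebraic elements of [Cc] *)

Section Transfer.
Variable m : nat.
Implicit Types X Y : {mpoly Qb[m]}.
Local Notation toC := (map_mpoly qval).

Lemma mcoeff_toC X u : (toC X)@_u = qval X@_u. Proof. exact: mcoeff_map_mpoly. Qed.

Lemma toC_inj X Y : toC X = toC Y -> X = Y.
Proof. by move=> e; apply/mpolyP => u; apply: qval_inj; rewrite -!mcoeff_toC e. Qed.

Lemma toC_qbar X : qbar_poly (toC X).
Proof. by move=> u; rewrite mcoeff_toC; apply/algbP; apply: qvalP. Qed.

Lemma qbar_lift (Z : {mpoly Cc[m]}) : qbar_poly Z -> exists X, toC X = Z.
Proof.
move=> Hz; exists (\sum_(u <- msupp Z) MkQb (introT (algbP _) (Hz u)) *: 'X_[u]).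
apply/mpolyP => v; rewrite mcoeff_toC [in RHS](mpolyE Z) !raddf_sum.
by apply: eq_bigr => u _ /=; rewrite !mcoeffZ !mcoeffX rmorphM rmorph_nat.
Qed.

Lemma toC_const X : is_const (toC X) <-> X = (X@_0)%:MP.
Proof.
have e : toC (X@_0)%:MP_[m] = ((toC X)@_0)%:MP_[m].
  by apply/mpolyP => u; rewrite !mcoeff_toC !mcoeffC rmorphM rmorph_nat.
split=> [c|c]; last by rewrite /is_const -e -c.
by apply: toC_inj; rewrite e.
Qed.

Lemma toC_dvd X Y : qbar_dvd (toC X) (toC Y) <-> dvdr X Y.
Proof.
split.
  case=> E [HE e]; have [Z eZ] := qbar_lift HE; exists Z; apply: toC_inj.
  rewrite e -eZ [in RHS]mulrC; symmetry; exact: rmorphM.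
case=> Z e; exists (toC Z); split; first exact: toC_qbar.
rewrite e [in LHS]mulrC; exact: rmorphM.
Qed.

Lemma toC_irreducible X : qbar_irreducible (toC X) -> prime_elt X.
Proof.
case=> _ Xc Xirr; have nc : X <> (X@_0)%:MP by move/toC_const.
have X0 : X != 0 by apply: contra_not_neq nc => ->; rewrite mcoeff0 mpolyC0.
apply: irreducible_prime => //; first exact: mpoly_ufd.
  by apply/negP => /mpoly_unit_const[c _ eX]; apply: nc; rewrite eX mcoeffC eqxx mulr1.
move=> b c e; have [b0 c0] : b != 0 /\ c != 0.
  by apply/andP; rewrite -negb_or -mulf_eq0 -e.
case: (Xirr (toC b) (toC c)) => [|||/toC_const H|/toC_const H].
- exact: toC_qbar.
- exact: toC_qbar.
- rewrite e; exact: rmorphM.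
- by left; apply: mpoly_const_unit.
by right; apply: mpoly_const_unit.
Qed.

End Transfer.

Lemma smulZ m (R : comNzRingType) (a : R) (Q : {mpoly R[m]}) f n :
  smul (a *: Q) f n = a * smul Q f n.
Proof.
by rewrite !smulE mulr_sumr; apply: eq_bigr => w _; rewrite mcoeffZ mulrA.
Qed.

Theorem theorem3p7 (m : nat) (f : 'X_{1..m} -> Cc) :
  (forall n, algebraic (f n)) ->
  rational_series f ->
  (forall eps : Rr, 0 < eps ->
     exists N0 : nat, forall N : nat, (N0 <= N)%N -> height_max f N <= eps * N%:R) ->
  forall P Q : {mpoly Cc[m]},
    qbar_poly P -> qbar_poly Q -> Q != 0 ->
    (forall n, series_mul Q f n = P@_n) -> qbar_coprime P Q ->
  forall D : {mpoly Cc[m]}, qbar_irreducible D -> qbar_dvd D Q ->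
    exists (c zeta : Cc) (n : 'X_{1..m}),
      [/\ c != 0, (exists2 k : nat, (0 < k)%N & k.-unity_root zeta), n != 0%MM &
          D = c *: (1 - zeta *: 'X_[n])].
Proof.
move=> fa _ hgt P Q /qbar_lift[P' eP] /qbar_lift[Q' eQ'] Q0 eQ cop D Dirr DQ.
have [D' eD] : exists X, map_mpoly qval X = D by case: Dirr => /qbar_lift.
subst P Q D; have pD := toC_irreducible Dirr; move/toC_dvd: DQ => DQ.
pose f' n := MkQb (introT (algbP _) (fa n)).
have Q'0 : Q' != 0 by apply: contraNneq Q0 => ->; rewrite rmorph0.
have eQf n : smul Q' f' n = P'@_n.
  by apply: qval_inj; rewrite (map_smul qval) -mcoeff_toC; exact: eQ.
have cop' X : dvdr X P' -> dvdr X Q' -> X = (X@_0)%:MP.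
  by move=> XP XQ; apply/toC_const; apply: cop; [exact: toC_qbar|exact/toC_dvd|exact/toC_dvd].
have q0 := denom_const_neq0 Q'0 eQf cop'; set a := Q'@_0 in q0.
have dZ (X Y : {mpoly Qb[m]}) : dvdr X (a^-1 *: Y) -> dvdr X Y.
  by case=> Z eZ; exists (a *: Z); rewrite -scalerAl -eZ scalerA mulfV // scale1r.
(* Scaling [P'] and [Q'] by the inverse of [a] makes the constant term of the denominator 1 and
   preserves the divisors of both. *)
have [||||||c [zeta [n [c0 [g g0 zg] n0 e]]]] :=
  @denominator_prime_divisor m (a^-1 *: P') (a^-1 *: Q') D' f'.
- by rewrite mcoeffZ mulVf.
- by move=> n; rewrite smulZ eQf mcoeffZ.
- by move=> X /dZ XP /dZ XQ; exact: cop'.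
- exact: hgt.
- exact: pD.
- by case: DQ => Z eZ; exists (a^-1 *: Z); rewrite -scalerAl -eZ.
exists (qval c), (qval zeta), n; split=> //.
- by exists g => //; apply/unity_rootP; rewrite -rmorphXn zg rmorph1.
apply/mpolyP => u; rewrite mcoeff_toC e !mcoeffZ !mcoeffB !mcoeffZ !mcoeff1 !mcoeffX.
by rewrite rmorphM rmorphB rmorphM !rmorph_nat.
Qed.
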